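(* Let $r=p/d$ for some integer $d\ge2$ and a real number $p\ge d$. Let $T$ be an ergodic measure preserving transformation of a probability space $(X,\mathcal F,\mu)$. Assume that $f\in L_{p,\pi}(\mu^d)$. Then, as $n\to\infty$, the sequence $$\frac1{n^d}\sum_{0\le k_1,\dots,k_d\le n-1}D_dV^{(k_1,\dots,k_d)}f$$ converges with probability $1$ and in $L_r(\mu)$ to the limit $$\int_{X^d}(J_df)(x_1,\dots,x_d)\,\mu(dx_1)\cdots\mu(dx_d).$$
   Context: $(X,\mathcal F,\mu)$ is assumed standard (a Lebesgue space); $L_p(\mu)$ consists of complex-valued functions. $L_{p,\pi}(\mu^d)$ is the projective tensor product of $d$ copies of $L_p(\mu)$ (completion of the algebraic tensor product in the largest cross norm). $J_d:L_{p,\pi}(\mu^d)\to L_p(X^d,\mathcal F^{\otimes d},\mu^d)$ is the injective norm one linear map determined by $J_d(f_1\otimes\cdots\otimes f_d)(x_1,\dots,x_d)=f_1(x_1)\cdots f_d(x_d)$; it identifies elements of $L_{p,\pi}(\mu^d)$ with functions. $D_d:L_{p,\pi}(\mu^d)\to L_r(\mu)$, $r=p/d$, is the norm one linear map determined by $D_d(f_1\otimes\cdots\otimes f_d)(x)=f_1(x)\cdots f_d(x)$. $V^{(k_1,\dots,k_d)}f(x_1,\dots,x_d)=f(T^{k_1}x_1,\dots,T^{k_d}x_d)$, i.e. $V^{(k_1,\dots,k_d)}(f_1\otimes\cdots\otimes f_d)=(f_1\circ T^{k_1})\otimes\cdots\otimes(f_d\circ T^{k_d})$ on $L_{p,\pi}(\mu^d)$.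 *)

(* Defs.v *)
(* MathComp-Analysis, with the complex numbers [R[i]] of mathcomp-real-closed *)
From HB Require Import structures.
From mathcomp Require Import all_boot all_order all_algebra.
From mathcomp Require Import complex.
From mathcomp Require Import all_classical all_reals all_analysis.
From mathcomp Require Import measurable_realfun.

Set Implicit Arguments.
Unset Strict Implicit.
Unset Printing Implicit Defensive.

Import Order.TTheory GRing.Theory Num.Theory.
Import numFieldNormedType.Exports.

Local Open Scope classical_set_scope.
Local Open Scope ring_scope.

(* Modulus of a complex number as an element of [R]; the norm [`|z|] of [R[i]]
   takes its values in [R[i]]. *)
Definition cmod {R : realType} (z : R[i]) : R :=
  Num.sqrt (complex.Re z ^+ 2 + complex.Im z ^+ 2).

Section complex_Lp.
Context {dY} {Y : measurableType dY} {R : realType}.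
Variable mu : {measure set Y -> \bar R}.
Implicit Types g : Y -> R[i].

Definition cmeasurable g : Prop :=
  measurable_fun [set: Y] (fun y => complex.Re (g y)) /\
  measurable_fun [set: Y] (fun y => complex.Im (g y)).

Definition CLnorm (p : R) g : \bar R := Lnorm mu p%:E (fun y => (cmod (g y))%:E).

Definition CLfun (p : R) g : Prop := cmeasurable g /\ (CLnorm p g < +oo)%E.

(* A representative of the limit in L_p of a sequence of functions
   (the zero function when there is no limit). *)
Definition CLlim (p : R) (u : nat -> Y -> R[i]) : Y -> R[i] :=
  xget (fun=> 0) [set g | CLfun p g /\
    CLnorm p (fun y => u n y - g y) @[n --> \oo] --> 0%E].

Definition Cintegral g : R[i] :=
  Complex (\int[mu]_y complex.Re (g y)) (\int[mu]_y complex.Im (g y)).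

End complex_Lp.

Section product_probability.
Context {dX} {X : measurableType dX} {R : realType}.
Variable mu : probability X R.

Definition tcons n (x : X * n.-tuple X) : n.+1.-tuple X :=
  [the n.+1.-tuple X of x.1 :: x.2].

Lemma measurable_tcons n : measurable_fun [set: X * n.-tuple X] (@tcons n).
Proof. exact: measurable_cons. Qed.

HB.instance Definition _ n :=
  isMeasurableFun.Build _ _ _ _ (@tcons n) (@measurable_tcons n).

Fixpoint prob_pow n : probability (n.-tuple X) R :=
  if n is m.+1 return probability (n.-tuple X) R
  then distribution (mu \x prob_pow m)%E (@tcons m)
  else \d_([tuple] : 0.-tuple X).

End product_probability.

Section transformations.
Context {dX} {X : measurableType dX} {R : realType}.
Variables (mu : probability X R) (T : {mfun X >-> X}).

Definition measure_preserving : Prop :=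
  forall A, measurable A -> mu (T @^-1` A) = mu A.

Definition ergodic : Prop :=
  forall A, measurable A -> T @^-1` A = A -> mu A = 0%E \/ mu A = 1%E.

End transformations.

Section Lebesgue_space.
Context {R : realType}.

(* Lebesgue measure on [0, a] plus atoms of mass [c k] at the points [k + 2]. *)
Definition interval_with_atoms (a : R) (c : nat -> R) (B : set R) : \bar R :=
  (lebesgue_measure (B `&` `[0%R, a]) +
   \sum_(0 <= k <oo) (c k)%:E * \d_(k.+2%:R : R) B)%E.

(* [mu] is isomorphic mod 0 to an interval with atoms. The inverse isomorphism
   is only required to be measurable up to null sets, i.e. for the completion of
   the Borel sets: thus both standard Borel spaces with a Borel probability and
   their completions (Rokhlin's complete Lebesgue spaces) are covered. *)
Definition Lebesgue_space {dX} {X : measurableType dX} (mu : probability X R) :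
    Prop :=
  exists (a : R) (c : nat -> R), [/\ 0 <= a <= 1, (forall k, 0 <= c k) &
  let nu := interval_with_atoms a c in
  exists (phi : {mfun X >-> R}) (N : set X) (M : set R),
  [/\ measurable N /\ mu N = 0%E,
      measurable M /\ nu M = 0%E,
      set_bij (~` N) (~` M) phi,
      (forall B, measurable B -> mu (phi @^-1` B) = nu B) &
      (forall A, measurable A -> exists2 B, measurable B &
         nu.-negligible ((phi @` (A `\` N)) `+` B))]].

End Lebesgue_space.

Section projective_tensor_product.
Context {dX} {X : measurableType dX} {R : realType}.
Variables (mu : probability X R) (p : R) (d : nat).

(* Functions with finite L_p norm; equality in L_p is equality a.e., which is
   built into [tensor_eq] below. *)
Record Lp := MkLp { Lp_fun :> X -> R[i]; LpP : CLfun mu p Lp_fun }.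

(* The formal sum of the [a] (u_1 (x) ... (x) u_d), for [(a, u)] in the list. *)
Definition tensor := seq (R[i] * ('I_d -> Lp)).

Definition tscale (a : R[i]) (t : tensor) : tensor :=
  [seq (a * au.1, au.2) | au <- t].

(* Equality in the algebraic tensor product: the congruence on formal sums
   generated by the axioms of vector spaces and by multilinearity. *)
Inductive tensor_eq : tensor -> tensor -> Prop :=
| teq_refl t : tensor_eq t t
| teq_sym s t : tensor_eq s t -> tensor_eq t s
| teq_trans s t w : tensor_eq s t -> tensor_eq t w -> tensor_eq s w
| teq_cat s s' t t' :
    tensor_eq s s' -> tensor_eq t t' -> tensor_eq (s ++ t) (s' ++ t')
| teq_catC s t : tensor_eq (s ++ t) (t ++ s)
| teq_zero u : tensor_eq [:: (0, u)] [::]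
| teq_add a b u : tensor_eq [:: (a, u); (b, u)] [:: (a + b, u)]
| teq_linear (a b c : R[i]) (i : 'I_d) (u v w : 'I_d -> Lp) :
    (forall j, j != i -> ae_eq mu setT (u j) (v j) /\
                         ae_eq mu setT (u j) (w j)) ->
    ae_eq mu setT (u i) (fun x => b * v i x + c * w i x) ->
    tensor_eq [:: (a, u)] [:: (a * b, v); (a * c, w)].

Definition Lp_norm (f : Lp) : R := fine (CLnorm mu p f).

Record cross_norm (alpha : tensor -> R) : Prop := {
  cross_norm_eq : forall s t, tensor_eq s t -> alpha s = alpha t ;
  cross_norm_eq0 : forall t, alpha t = 0 -> tensor_eq t [::] ;
  cross_norm_triangle : forall s t, alpha (s ++ t) <= alpha s + alpha t ;
  cross_norm_scale : forall a t, alpha (tscale a t) = cmod a * alpha t ;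
  cross_norm_elementary :
    forall u, alpha [:: (1, u)] = \prod_(i < d) Lp_norm (u i) }.

(* The largest cross norm. *)
Definition projective_norm (t : tensor) : R :=
  sup [set alpha t | alpha in cross_norm].

(* Elements of the completion are given by Cauchy sequences (two of them
   represent the same element when their difference tends to 0). *)
Record Lpi := MkLpi {
  Lpi_seq :> nat -> tensor ;
  Lpi_cauchy : forall e, 0 < e -> exists N, forall m n, (N <= m)%N -> (N <= n)%N ->
    projective_norm (Lpi_seq m ++ tscale (-1) (Lpi_seq n)) < e }.

Definition tensor_fun (t : tensor) (x : d.-tuple X) : R[i] :=
  \sum_(au <- t) au.1 * \prod_(i < d) au.2 i (tnth x i).

Definition tensor_diag (t : tensor) (x : X) : R[i] :=
  \sum_(au <- t) au.1 * \prod_(i < d) au.2 i x.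

(* [tensor_fun] and [tensor_diag] are contractions from the projective norm to
   the norms of L_p(mu^d) and (by Hoelder) L_(p/d)(mu), when [d <= p]; [J] and [D]
   are their continuous extensions to the completion. *)
Definition J (f : Lpi) : d.-tuple X -> R[i] :=
  CLlim (prob_pow mu d) p (fun n => tensor_fun (f n)).

Definition D (f : Lpi) : X -> R[i] :=
  CLlim mu (p / d%:R) (fun n => tensor_diag (f n)).

Lemma cross_norm_ge0 alpha : cross_norm alpha -> forall t, 0 <= alpha t.
Proof.
move=> ca t.
have a0 : alpha [::] = 0.
  have := cross_norm_scale ca 0 [::]; rewrite /= => ->.
  by rewrite /cmod/= expr0n/= addr0 sqrtr0 mul0r.
have aN : alpha (tscale (-1) t) = alpha t.
  rewrite (cross_norm_scale ca) /cmod/= oppr0 expr0n/= addr0 sqrrN expr1n.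
  by rewrite sqrtr1 mul1r.
have tN : tensor_eq (t ++ tscale (-1) t) [::].
  elim: t {aN} => [|[a u] t IH]; first exact: teq_refl.
  apply: (teq_trans (t := ([:: (a, u); (-1 * a, u)] ++ (t ++ tscale (-1) t)))).
    rewrite /= -cat1s -[in X in tensor_eq _ X]cat1s.
    apply: teq_cat; first exact: teq_refl.
    rewrite -cat1s -[X in tensor_eq _ X]cat1s !catA.
    by apply: teq_cat; [exact: teq_catC|exact: teq_refl].
  rewrite -[X in tensor_eq _ X]cats0; apply: teq_cat => //.
  apply: teq_trans (teq_add _ _ _) _.
  by rewrite mulN1r subrr; exact: teq_zero.
have := cross_norm_triangle ca t (tscale (-1) t).
by rewrite (cross_norm_eq ca tN) a0 aN -mulr2n pmulrn_lge0.
Qed.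

Lemma cross_norm_bound t :
  exists M, forall alpha, cross_norm alpha -> alpha t <= M.
Proof.
elim: t => [|[a u] t [M IH]].
  exists 0 => alpha ca; have := cross_norm_scale ca 0 [::]; rewrite /= => ->.
  by rewrite /cmod/= expr0n/= addr0 sqrtr0 mul0r.
exists (cmod a * \prod_(i < d) Lp_norm (u i) + M) => alpha ca.
rewrite -cat1s; apply: le_trans (cross_norm_triangle ca _ _) _.
apply: lerD (IH _ ca).
rewrite -(cross_norm_elementary ca) -(cross_norm_scale ca)/=.
by rewrite mulr1.
Qed.

Lemma cross_norm_le alpha t : cross_norm alpha -> alpha t <= projective_norm t.
Proof.
move=> ca; have [M HM] := cross_norm_bound t.
apply: ub_le_sup; last by exists alpha.
by exists M => _ [b cb <-]; exact: HM.
Qed.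

End projective_tensor_product.

Section translations.
Context {dX} {X : measurableType dX} {R : realType}.
Variables (mu : probability X R) (p : R) (d : nat).
Variables (T : {mfun X >-> X}) (Tmp : measure_preserving mu T).

Lemma measurable_iter k : measurable_fun [set: X] (iter k T).
Proof.
elim: k => [|k IH]; first exact: measurable_id.
exact: (measurableT_comp (@measurable_funP _ _ _ _ setT T) IH).
Qed.

Lemma iter_measure_preserving k A :
  measurable A -> mu (iter k T @^-1` A) = mu A.
Proof.
move=> mA; elim: k => [//|k IH].
have mk : measurable (iter k T @^-1` A).
  by rewrite -[X in measurable X]setTI; exact: measurable_iter.
rewrite -IH -(Tmp mk); congr (mu _).
by apply/seteqP; split => x /=; rewrite -iterSr.
Qed.

Lemma ae_iter k (P : set X) :
  {ae mu, forall x, P x} -> {ae mu, forall x, P (iter k T x)}.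
Proof.
move=> [A [mA A0 PA]]; exists (iter k T @^-1` A); split.
- by rewrite -[X in measurable X]setTI; exact: measurable_iter.
- by rewrite iter_measure_preserving.
- by move=> x /= nP; exact: PA.
Qed.

Lemma measurable_cmod (g : X -> R[i]) : cmeasurable g ->
  measurable_fun [set: X] (fun x => cmod (g x)).
Proof.
move=> [mr mi].
rewrite (_ : (fun _ => _) = fun x => (complex.Re (g x) ^+ 2 +
    complex.Im (g x) ^+ 2) `^ 2^-1); last first.
  by apply/funext => x; rewrite powR12_sqrt// addr_ge0 ?sqr_ge0.
apply: (measurableT_comp (measurable_powR _)) => //.
by apply: measurable_funD; exact: measurable_funX.
Qed.

Lemma CLnorm_iter k (g : X -> R[i]) : cmeasurable g ->
  CLnorm mu p (fun x => g (iter k T x)) = CLnorm mu p g.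
Proof.
move=> mg; rewrite /CLnorm !Lnorm.unlock.
pose h x : \bar R := (`|(cmod (g x))%:E| `^ p)%E.
have mh : measurable_fun setT h.
  rewrite /h; apply: (@measurableT_comp _ _ _ _ _ _ (fun x => x `^ p)%E) => //=.
    exact: measurable_poweR.
  have mE : measurable_fun setT (fun x => (cmod (g x))%:E).
    by apply/measurable_EFinP; exact: measurable_cmod.
  exact: (measurableT_comp (@abse_measurable R setT) mE).
have hE := ge0_integral_pushforward (measurable_iter k) mu measurableT mh
  (fun y _ => poweR_ge0 _ _).
rewrite preimage_setT in hE.
have hT : (\int[mu]_x h (iter k T x) = \int[mu]_x h x)%E.
  apply: etrans (esym hE) _.
  apply: eq_measure_integral => [|mk A mA _]; first exact: measurable_iter.
  exact: (iter_measure_preserving k mA).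
exact: (f_equal (fun z => (z `^ p^-1)%E) hT).
Qed.

Lemma CLfun_iter k (g : X -> R[i]) :
  CLfun mu p g -> CLfun mu p (fun x => g (iter k T x)).
Proof.
move=> [mg fg]; split; last by rewrite CLnorm_iter.
by split; [exact: (measurableT_comp mg.1 (measurable_iter k))
          |exact: (measurableT_comp mg.2 (measurable_iter k))].
Qed.

Definition Lp_iter k (g : Lp mu p) : Lp mu p := MkLp (CLfun_iter k (LpP g)).

Definition tensor_V (k : 'I_d -> nat) (t : tensor mu p d) : tensor mu p d :=
  [seq (au.1, fun i => Lp_iter (k i) (au.2 i)) | au <- t].

Lemma tensor_V_scale k a t :
  tensor_V k (tscale a t) = tscale a (tensor_V k t).
Proof. by rewrite /tensor_V /tscale -!map_comp. Qed.

Lemma tensor_V_eq k s t :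
  tensor_eq s t -> tensor_eq (tensor_V k s) (tensor_V k t).
Proof.
elim => {s t}.
- by move=> t; exact: teq_refl.
- by move=> s t _; exact: teq_sym.
- by move=> s t w _ st _; exact: teq_trans.
- by move=> s s' t t' _ ? _ ?; rewrite /tensor_V !map_cat; exact: teq_cat.
- by move=> s t; rewrite /tensor_V !map_cat; exact: teq_catC.
- by move=> u; exact: teq_zero.
- by move=> a b u; exact: teq_add.
- move=> a b c i u v w uvw ui.
  apply: (@teq_linear _ _ _ _ _ _ _ _ _ i) => [j /uvw[uv uw]|]; last exact: (ae_iter _ ui).
  by split; [exact: (ae_iter _ uv)|exact: (ae_iter _ uw)].
Qed.

Lemma projective_norm_V k t : projective_norm (tensor_V k t) <= projective_norm t.
Proof.
have [[alpha0 ca0]|none] := pselect (exists alpha, @cross_norm _ X R mu p d alpha).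
  apply: ge_sup; first by exists (alpha0 (tensor_V k t)), alpha0.
  move=> _ [alpha ca <-].
  pose beta s := Num.max (alpha s) (alpha (tensor_V k s)).
  suff cb : cross_norm beta.
    by apply: le_trans (cross_norm_le _ cb); rewrite /beta le_max lexx orbT.
  split.
  - move=> s s' ss'; rewrite /beta (cross_norm_eq ca ss').
    by rewrite (cross_norm_eq ca (tensor_V_eq k ss')).
  - move=> s bs; apply: (cross_norm_eq0 ca); apply/eqP.
    by rewrite eq_le (cross_norm_ge0 ca) -bs /beta le_max lexx.
  - move=> s s'; rewrite /beta ge_max; apply/andP; split.
      apply: le_trans (cross_norm_triangle ca _ _) _.
      by apply: lerD; rewrite le_max lexx.
    rewrite /tensor_V map_cat; apply: le_trans (cross_norm_triangle ca _ _) _.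
    by apply: lerD; rewrite le_max lexx orbT.
  - move=> a s; rewrite /beta tensor_V_scale !(cross_norm_scale ca).
    by rewrite maxr_pMr// /cmod sqrtr_ge0.
  - move=> u; rewrite /beta /= !(cross_norm_elementary ca).
    rewrite (_ : \prod_(i < d) Lp_norm (Lp_iter _ _) = \prod_(i < d) Lp_norm (u i)).
      by rewrite maxxx.
    apply: eq_bigr => i _; rewrite /Lp_norm CLnorm_iter//.
    exact: (LpP (u i)).1.
have pn (s : tensor mu p d) : projective_norm s = sup set0.
  rewrite /projective_norm; congr sup; apply/seteqP; split => // y [alpha ca].
  by case: none; exists alpha.
by rewrite (pn (tensor_V k t)) (pn t).
Qed.

Lemma V_cauchy (k : 'I_d -> nat) (f : Lpi mu p d) e : 0 < e ->
  exists N, forall m n, (N <= m)%N -> (N <= n)%N ->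
    projective_norm (tensor_V k (f m) ++ tscale (-1) (tensor_V k (f n))) < e.
Proof.
move=> /(Lpi_cauchy f)[N HN]; exists N => m n Nm Nn.
apply: le_lt_trans (HN m n Nm Nn).
rewrite -tensor_V_scale /tensor_V -map_cat.
exact: projective_norm_V.
Qed.

Definition V (k : 'I_d -> nat) (f : Lpi mu p d) : Lpi mu p d :=
  MkLpi (V_cauchy k f).

End translations.

(* Main.v *)
(** The projective norm is the largest cross norm, so it dominates every
    seminorm on the algebraic tensor product that is at most
    [K * \prod_i ||u_i||_p] on elementary tensors, up to the factor [K]: the
    maximum of such a seminorm (divided by [K]) with the norm of [J] in
    [L_p(mu^d)], which is a cross norm since [J] is injective, is again a cross
    norm. This applies to the maximal function [sup_n |A_n t|], where [A_n t] is
    the average of the [D V^k t] over the cube of side [n]. Indeed on an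
    elementary tensor [A_n] is the product of the Birkhoff averages of the
    factors, so that the maximal inequality in [L_p] ([p >= 2]) bounds the
    maximal function in [L_(p/d)]. Birkhoff's theorem gives the convergence of
    [A_n t] for algebraic tensors [t], and the maximal inequality carries it
    over to their limits: along a rapidly converging subsequence the [A_n t_j]
    converge almost everywhere as [j] grows, uniformly in [n]. *)

Require Import Defs.
From HB Require Import structures.
From mathcomp Require Import all_boot all_order all_algebra.
From mathcomp Require Import complex.
From mathcomp Require Import all_classical all_reals all_analysis.
From mathcomp Require Import measurable_realfun lra ring.

Set Implicit Arguments.
Unset Strict Implicit.
Unset Printing Implicit Defensive.

Import Order.TTheory GRing.Theory Num.Theory.
Import numFieldNormedType.Exports.

Local Open Scope classical_set_scope.
Local Open Scope ring_scope.

(** * Complex-valued functions and their L_p norms *)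

(** The supremum defining the projective norm yields no decomposition of a tensor into elementary
    ones of nearly minimal total norm, so estimates cannot be summed term by term: each must come
    from a seminorm on all formal sums. Besides definiteness, a cross norm needs exact values on
    elementary tensors, where the seminorms at hand only have upper bounds; Tonelli gives the norm
    of [J] these exact values. Constants are free, since bounds are needed only for differences that
    tend to 0 or for finiteness. Hence a bound of a product by a sum of powers can replace Hoelder's
    inequality, and dyadic sums, geometric with ratio at least 2 because [p >= 2], can replace
    integration over levels in the maximal inequality. [D] and [J] are limits in norm, with
    arbitrary representatives. The averages involve countably many functions [D (V Tmp k f)], and
    one subsequence reaches all of them almost everywhere because [V] does not increase the
    projective norm. This compares the averages with those of algebraic tensors only at each fixed
    [n]; the maximal function provides the uniformity in [n]. *)

Section modulus.
Context {R : realType}.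
Implicit Types z w : R[i].

Lemma cmodE z : cmod z = ComplexField.Normc.normc z.
Proof. by case: z. Qed.

Lemma normc_cmod z : `|z| = (cmod z)%:C%C.
Proof. by rewrite normc_def. Qed.

Lemma cmod_ge0 z : 0 <= cmod z. Proof. exact: sqrtr_ge0. Qed.

Lemma cmodM z w : cmod (z * w) = cmod z * cmod w.
Proof. by rewrite !cmodE ComplexField.Normc.normcM. Qed.

Lemma cmodD z w : cmod (z + w) <= cmod z + cmod w.
Proof. by rewrite !cmodE; exact: le_normcD. Qed.

Lemma cmod0 : cmod (0 : R[i]) = 0.
Proof. by rewrite cmodE ComplexField.Normc.normc0. Qed.

Lemma cmod1 : cmod (1 : R[i]) = 1.
Proof. by rewrite cmodE ComplexField.Normc.normc1. Qed.

Lemma cmodN z : cmod (- z) = cmod z.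
Proof. by rewrite !cmodE normcN. Qed.

Lemma cmodB z w : cmod (z - w) = cmod (w - z).
Proof. by rewrite -cmodN opprB. Qed.

Lemma cmod_eq0 z : cmod z = 0 -> z = 0.
Proof. by rewrite cmodE; exact: ComplexField.Normc.eq0_normc. Qed.

Lemma cmod_triangle u z w : cmod (z - w) <= cmod (z - u) + cmod (u - w).
Proof. by apply: le_trans (cmodD _ _); rewrite addrA subrK. Qed.

Lemma cmod_Re z : `|complex.Re z| <= cmod z.
Proof.
by rewrite /cmod -sqrtr_sqr ler_wsqrtr// lerDl sqr_ge0.
Qed.

Lemma cmod_Im z : `|complex.Im z| <= cmod z.
Proof.
by rewrite /cmod -sqrtr_sqr ler_wsqrtr// lerDr sqr_ge0.
Qed.

Lemma cmod_Complex (a b : R) : cmod (Complex a b) <= `|a| + `|b|.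
Proof.
rewrite /cmod/= -[leRHS]ger0_norm ?addr_ge0// -sqrtr_sqr.
rewrite ler_wsqrtr// sqrrD !real_normK ?num_real// addrAC lerDl.
by rewrite mulrn_wge0// mulr_ge0.
Qed.

Lemma cmod_sum I (s : seq I) (F : I -> R[i]) :
  cmod (\sum_(i <- s) F i) <= \sum_(i <- s) cmod (F i).
Proof.
elim/big_ind2 : _ => // [|x a y b xa yb]; first by rewrite cmod0.
exact: le_trans (cmodD _ _) (lerD xa yb).
Qed.

Lemma cmod_prod I (s : seq I) (F : I -> R[i]) :
  cmod (\prod_(i <- s) F i) = \prod_(i <- s) cmod (F i).
Proof. exact: (big_morph _ cmodM cmod1). Qed.

Lemma cmod_nat (n : nat) : cmod (n%:R : R[i]) = n%:R.
Proof. by rewrite cmodE normcMn -cmodE cmod1. Qed.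

Lemma cmodX z n : cmod (z ^+ n) = cmod z ^+ n.
Proof. by elim: n => [|n IH]; rewrite ?cmod1 // !exprS cmodM IH. Qed.

Lemma cmodV z : cmod z^-1 = (cmod z)^-1.
Proof. by rewrite !cmodE ComplexField.Normc.normcV. Qed.

Lemma cvg_cmodP (u : nat -> R[i]^o) (l : R[i]^o) :
  u n @[n --> \oo] --> l <-> cmod (u n - l) @[n --> \oo] --> (0 : R).
Proof.
split=> [/cvgrPdist_lt h|/cvgrPdist_lt h].
- apply/cvgrPdist_lt => e e0.
  have := h e%:C%C; rewrite ltcR => /(_ e0); apply: filterS => n.
  by rewrite normc_cmod ltcR cmodB sub0r normrN (ger0_norm (cmod_ge0 _)).
- apply/cvgrPdist_lt => -[e e']; rewrite ltcE/= => /andP[/eqP -> e0].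
  have := h e e0; apply: filterS => n.
  rewrite normc_cmod sub0r normrN (ger0_norm (cmod_ge0 _)) cmodB.
  by rewrite -ltcR.
Qed.

Lemma cReB z w : complex.Re (z - w) = complex.Re z - complex.Re w.
Proof. by case: z w => a b []. Qed.

Lemma cImB z w : complex.Im (z - w) = complex.Im z - complex.Im w.
Proof. by case: z w => a b []. Qed.

Lemma cReD z w : complex.Re (z + w) = complex.Re z + complex.Re w.
Proof. by case: z w => a b []. Qed.

Lemma cImD z w : complex.Im (z + w) = complex.Im z + complex.Im w.
Proof. by case: z w => a b []. Qed.

Lemma cReM z w : complex.Re (z * w) =
  complex.Re z * complex.Re w - complex.Im z * complex.Im w.
Proof. by case: z w => a b []. Qed.

Lemma cImM z w : complex.Im (z * w) =
  complex.Re z * complex.Im w + complex.Im z * complex.Re w.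
Proof. by case: z w => a b []. Qed.

End modulus.

Section measurable_complex.
Context {d} {Y : measurableType d} {R : realType}.
Implicit Types f g : Y -> R[i].

Lemma cmeasurable_cst (c : R[i]) : cmeasurable (fun _ : Y => c).
Proof. by split; exact: measurable_cst. Qed.

Lemma cmeasurableD f g :
  cmeasurable f -> cmeasurable g -> cmeasurable (fun x => f x + g x).
Proof.
move=> [fr fi] [gr gi]; split.
- by under eq_fun do rewrite cReD; exact: measurable_funD.
- by under eq_fun do rewrite cImD; exact: measurable_funD.
Qed.

Lemma cmeasurableM f g :
  cmeasurable f -> cmeasurable g -> cmeasurable (fun x => f x * g x).
Proof.
move=> [fr fi] [gr gi]; split.
- under eq_fun do rewrite cReM.
  by apply: measurable_funB; exact: measurable_funM.
- under eq_fun do rewrite cImM.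
  by apply: measurable_funD; exact: measurable_funM.
Qed.

Lemma cmeasurableB f g :
  cmeasurable f -> cmeasurable g -> cmeasurable (fun x => f x - g x).
Proof.
move=> mf mg; under eq_fun do rewrite -mulN1r.
by apply: cmeasurableD => //; apply: cmeasurableM => //; exact: cmeasurable_cst.
Qed.

Lemma cmeasurable_sum I (s : seq I) (F : I -> Y -> R[i]) :
  (forall i, cmeasurable (F i)) -> cmeasurable (fun x => \sum_(i <- s) F i x).
Proof.
move=> mF; elim: s => [|i s IH].
  by under eq_fun do rewrite big_nil; exact: cmeasurable_cst.
by under eq_fun do rewrite big_cons; exact: cmeasurableD.
Qed.

Lemma cmeasurable_prod I (s : seq I) (F : I -> Y -> R[i]) :
  (forall i, cmeasurable (F i)) -> cmeasurable (fun x => \prod_(i <- s) F i x).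
Proof.
move=> mF; elim: s => [|i s IH].
  by under eq_fun do rewrite big_nil; exact: cmeasurable_cst.
by under eq_fun do rewrite big_cons; exact: cmeasurableM.
Qed.

Lemma cmeasurable_comp d' (Z : measurableType d') (h : Z -> Y) g :
  measurable_fun [set: Z] h -> cmeasurable g -> cmeasurable (fun x => g (h x)).
Proof.
by move=> mh [gr gi]; split; [exact: (measurableT_comp gr mh)
  |exact: (measurableT_comp gi mh)].
Qed.

End measurable_complex.

Lemma cvg_powR {R : realType} (u : nat -> R) (l r : R) : 0 < r ->
  (forall n, 0 <= u n) -> u n @[n --> \oo] --> l ->
  u n `^ r @[n --> \oo] --> l `^ r.
Proof.
move=> r0 u0 ul.
have l0 : 0 <= l.
  have cu : cvgn u by apply/cvg_ex; exists l.
  by rewrite -(cvg_lim _ ul)//; apply: (limr_ge cu); exact: nearW.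
move: l0; rewrite le_eqVlt => /predU1P[l0|l0].
  (* The power need not be differentiable at [0], so this case is done by hand, with the [r]-th root
     of [e] as threshold. *)
  rewrite -l0 powR0 ?gt_eqF//; apply/cvgrPdist_lt => e e0.
  have e1 : 0 < e `^ r^-1 by exact: powR_gt0.
  move/cvgrPdist_lt: ul => /(_ _ e1); apply: filterS => n.
  rewrite -l0 !sub0r !normrN ger0_norm// ger0_norm ?powR_ge0// => h.
  have <- : (e `^ r^-1) `^ r = e by rewrite -powRrM mulVf ?gt_eqF// powRr1// ltW.
  by rewrite gt0_ltr_powR// nnegrE// ltW.
apply: (@continuous_cvg _ _ _ _ _ _ (fun x => x `^ r)) => //.
apply/differentiable_continuous/derivable1_diffP.
by apply: derivable_powR; rewrite in_itv/= andbT.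
Qed.

Lemma lee_poweR {R : realType} (x y : \bar R) (r : R) : (0 <= r)%R ->
  (0 <= x)%E -> (x <= y)%E -> (x `^ r <= y `^ r)%E.
Proof.
move=> r0 x0 xy; apply: gt0_ler_poweR => //; rewrite in_itv/= leey andbT//.
exact: le_trans xy.
Qed.

(** * Real-valued functions: Minkowski sums and Fatou's lemma in L_r *)

Section Lnorm_real.
Context {d} {Y : measurableType d} {R : realType}.
Variable P : {measure set Y -> \bar R}.
Implicit Types (f g : Y -> R) (r c : R).

Local Notation "'NR' r f" := (Lnorm P r%:E (fun y => (f y)%:E))
  (at level 10, r at level 9, f at level 9).

Lemma measurable_norm_powR r f : measurable_fun [set: Y] f ->
  measurable_fun [set: Y] (fun x => (`|f x| `^ r)%:E).
Proof.
move=> mf; apply/measurable_EFinP/(measurableT_comp (measurable_powR _)).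
exact: measurableT_comp.
Qed.

Lemma measurable_enorm_powR r f : measurable_fun [set: Y] f ->
  measurable_fun [set: Y] (fun x => `|(f x)%:E| `^ r)%E.
Proof.
move=> mf; apply: (eq_measurable_fun (fun x => (`|f x| `^ r)%:E)).
  by move=> x _; rewrite poweR_EFin.
exact: measurable_norm_powR.
Qed.

Lemma Lnorm_le r f g : 0 < r -> measurable_fun [set: Y] f ->
  measurable_fun [set: Y] g ->
  {ae P, forall x, `|f x| <= `|g x|} -> (NR r f <= NR r g)%E.
Proof.
move=> r0 mf mg fg; rewrite unlock; apply: lee_poweR.
- by rewrite invr_ge0 ltW.
- by rewrite integral_ge0// => x _; exact: poweR_ge0.
- apply: ae_ge0_le_integral => //.
  + by move=> *; exact: poweR_ge0.
  + exact: measurable_enorm_powR.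
  + by move=> *; exact: poweR_ge0.
  + exact: measurable_enorm_powR.
  + apply: filterS fg => x fg _.
    rewrite !abse_EFin !poweR_EFin lee_fin ge0_ler_powR// ?nnegrE//.
    exact: ltW.
Qed.

Lemma ae_eq_Lnorm r f g : 0 < r -> measurable_fun [set: Y] f ->
  measurable_fun [set: Y] g ->
  {ae P, forall x, `|f x| = `|g x|} -> NR r f = NR r g.
Proof.
move=> r0 mf mg fg; apply/eqP; rewrite eq_le !Lnorm_le//;
  by apply: filterS fg => x ->.
Qed.

Lemma Lnorm_leP r f c : 0 < r -> 0 <= c ->
  (NR r f <= c%:E)%E <->
  (\int[P]_x (`|f x| `^ r)%:E <= (c `^ r)%:E)%E.
Proof.
move=> r0 c0.
have -> : (\int[P]_x (`|f x| `^ r)%:E = NR r f `^ r)%E.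
  by rewrite poweR_Lnorm ?gt_eqF.
rewrite -poweR_EFin; split=> h.
  by apply: lee_poweR; rewrite ?Lnorm_ge0// ltW.
have H (x : \bar R) : (0 <= x)%E -> x = ((x `^ r) `^ r^-1)%E.
  by move=> x0; rewrite -poweRrM mulfV ?gt_eqF// poweRe1.
rewrite (H (NR r f)) ?Lnorm_ge0// (H c%:E)//.
by apply: lee_poweR; rewrite ?poweR_ge0// invr_ge0 ltW.
Qed.

Lemma Lnorm_lty r f : 0 < r -> (NR r f < +oo)%E ->
  (\int[P]_x (`|f x| `^ r)%:E < +oo)%E.
Proof.
move=> r0 h.
have -> : (\int[P]_x (`|f x| `^ r)%:E = NR r f `^ r)%E.
  by rewrite poweR_Lnorm ?gt_eqF.
exact: poweR_lty.
Qed.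

Lemma Lnorm_cst0 r : 0 < r -> NR r (fun=> 0) = 0%E.
Proof. by move=> r0; apply: Lnorm0; rewrite eqe gt_eqF. Qed.

Lemma Lnorm_scale r (a : R) f : 0 < r -> measurable_fun [set: Y] f ->
  NR r (fun x => a * f x) = (`|a|%:E * NR r f)%E.
Proof.
move=> r0 mf; have r_neq0 : r != 0 by rewrite gt_eqF.
rewrite unlock.
under eq_integral => x _.
  rewrite EFinM abseM poweRM//.
  over.
rewrite ge0_integralZl//; last 3 first.
- exact: measurable_enorm_powR.
- by move=> *; exact: poweR_ge0.
- exact: poweR_ge0.
rewrite poweRM ?poweR_ge0//; last by apply: integral_ge0 => *; exact: poweR_ge0.
by rewrite -poweRrM mulfV// poweRe1.
Qed.

Lemma Lnorm_sum r I (s : seq I) (F : I -> Y -> R) : 1 <= r ->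
  (forall i, measurable_fun [set: Y] (F i)) ->
  (NR r (fun x => \sum_(i <- s) F i x)%R <= \sum_(i <- s) NR r (F i))%E.
Proof.
move=> r1 mF; elim: s => [|i s IH].
  rewrite big_nil; under eq_fun do rewrite big_nil.
  by rewrite Lnorm_cst0// (lt_le_trans _ r1).
rewrite big_cons; under eq_fun do rewrite big_cons.
apply: (le_trans (@minkowski_EFin _ _ _ P (F i)
  (fun x => \sum_(i <- s) F i x) r _ _ r1)) => //.
- exact: measurable_sum.
- by rewrite leeD2l.
Qed.

(** Fatou's lemma for [r]-th powers. It serves to control the distance to a pointwise limit in the
    completeness proof, and to bound the supremum of an increasing sequence of maximal functions. *)
Lemma Lnorm_fatou r (F : nat -> Y -> R) f c : 0 < r -> 0 <= c ->
  (forall n, measurable_fun [set: Y] (F n)) -> measurable_fun [set: Y] f ->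
  {ae P, forall x, F n x @[n --> \oo] --> f x} ->
  (\forall n \near \oo, (NR r (F n) <= c%:E)%E) -> (NR r f <= c%:E)%E.
Proof.
move=> r0 c0 mF mf Ff Fc; apply/Lnorm_leP => //.
apply: (@le_trans _ _ (\int[P]_x limn_einf (fun n => (`|F n x| `^ r)%:E))%E).
  apply: ae_ge0_le_integral => //.
  - exact: measurable_norm_powR.
  - move=> x _; rewrite limn_einf_lim; apply: lime_ge; first exact: is_cvg_einfs.
    by apply: nearW => n; apply: le_ereal_inf_tmp => _ [m _ <-]; rewrite lee_fin powR_ge0.
  - have -> : (fun x => limn_einf (fun n => (`|F n x| `^ r)%:E)) =
       (fun x => - limn_esup (fun n => - (`|F n x| `^ r)%:E))%E.
      by apply/funext => x; rewrite limn_esupN oppeK.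
    apply: measurableT_comp => //; apply: measurable_fun_limn_esup => n.
    by apply: measurableT_comp => //; exact: measurable_norm_powR.
  - apply: filterS Ff => x Fx _.
    have h : (`|F n x| `^ r)%:E @[n --> \oo] --> (`|f x| `^ r)%:E.
      apply: cvg_EFin; first exact: nearW.
      by apply: cvg_powR => //; exact: cvg_norm.
    by rewrite (cvg_limn_einf_sup h).1.
apply: (le_trans (fatou P measurableT _ _)).
  by move=> n; exact: measurable_norm_powR.
- by move=> *; rewrite lee_fin powR_ge0.
rewrite limn_einf_lim; apply: lime_le; first exact: is_cvg_einfs.
apply: filterS Fc => n Fc; apply: (@le_trans _ _ (\int[P]_x (`|F n x| `^ r)%:E)%E).
  by apply: ereal_inf_lbound; exists n => //=.
exact/Lnorm_leP.
Qed.

End Lnorm_real.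

(** * Convergence in L_r *)

(** Taking running maxima of the thresholds makes [s] monotone, so that [Q j] holds for all pairs of
    later indices and not only for consecutive ones; passing to a limit in one of the indices
    requires this. *)
Lemma rapid_subsequence (Q : nat -> nat -> nat -> Prop) :
  (forall j, exists N, forall m n, (N <= m)%N -> (N <= n)%N -> Q j m n) ->
  exists2 s : nat -> nat, {homo s : m n / (m <= n)%N} &
    forall j m n, (s j <= m)%N -> (s j <= n)%N -> Q j m n.
Proof.
move=> /choice[N HN]; exists (fun j => \max_(i < j.+1) N i) => [m n mn|j m n].
  rewrite (big_ord_widen _ (fun i => N i) (_ : m.+1 <= n.+1)%N)//.
  rewrite [leqRHS](bigID (fun i : 'I_n.+1 => (i < m.+1)%N))/=.
  exact: leq_maxl.
have Nj : (N j <= \max_(i < j.+1) N i)%N by exact: (leq_bigmax (@ord_max j)).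
by move=> jm jn; apply: HN; [exact: leq_trans Nj jm|exact: leq_trans Nj jn].
Qed.

Section sequences.
Context {R : realType}.
Implicit Types (b : nat -> R) (z : nat -> R[i]).

Lemma bounded_series_tail b : (forall j, 0 <= b j) ->
  (exists M, forall n, \sum_(0 <= j < n) b j <= M) ->
  forall e, 0 < e -> exists J, forall n, (J <= n)%N -> \sum_(J <= j < n) b j < e.
Proof.
move=> b0 [M bM] e e0.
have nd : nondecreasing_seq (series b).
  by apply: nondecreasing_series => *; exact: b0.
have cb : cvgn (series b).
  by apply: nondecreasing_is_cvgn => //; exists M => _ [n _ <-]; exact: bM.
have /cvgrPdist_lt /(_ e e0)[J _ HJ] := cb.
exists J => n Jn.
have := HJ J (leqnn J) => /=; rewrite ger0_norm; last first.
  by rewrite subr_ge0; exact: nondecreasing_cvgn_le.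
apply: le_lt_trans.
have -> : \sum_(J <= j < n) b j = series b n - series b J.
  by rewrite sub_series_geq.
by rewrite lerB//; exact: nondecreasing_cvgn_le.
Qed.

Lemma cmod_telescope z b J n : (J <= n)%N ->
  (forall j, cmod (z j.+1 - z j) <= b j) ->
  cmod (z n - z J) <= \sum_(J <= j < n) b j.
Proof.
move=> /subnKC <- zb; elim: (n - J)%N => [|k IH].
  by rewrite addn0 subrr cmod0 big_geq.
rewrite addnS big_nat_recr ?leq_addr//=.
rewrite (le_trans (cmod_triangle (z (J + k)%N) _ _))//.
by rewrite addrC lerD.
Qed.

Lemma complex_cauchy_cvg z :
  (forall e, 0 < e -> exists J, forall n, (J <= n)%N -> cmod (z n - z J) < e) ->
  exists l : R[i], cmod (z n - l) @[n --> \oo] --> (0 : R).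
Proof.
move=> cz.
have cF (F : R[i] -> R) : (forall x y, F (x - y) = F x - F y) ->
    (forall x, `|F x| <= cmod x) -> cvgn (F \o z).
  move=> FB Fle; apply/cauchy_cvgP/cauchy_exP => e /cz[J HJ].
  exists (F (z J)), J => // n /= Jn; rewrite /ball/= distrC -FB.
  exact: le_lt_trans (Fle _) (HJ n Jn).
have /cvg_ex[a ra] := cF _ (@cReB R) (@cmod_Re R).
have /cvg_ex[b rb] := cF _ (@cImB R) (@cmod_Im R).
exists (Complex a b).
apply: (@squeeze_cvgr _ _ _ _ (fun=> 0)
  (fun n => `|complex.Re (z n) - a| + `|complex.Im (z n) - b|)).
- apply: nearW => n; rewrite cmod_ge0/=; case: (z n) => c d /=.
  exact: cmod_Complex.
- exact: cvg_cst.
- rewrite -[X in _ --> X]addr0; apply: cvgD.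
    by rewrite -(normr0 R) -(subrr a); apply: cvg_norm; apply: cvgB => //; exact: cvg_cst.
  by rewrite -(normr0 R) -(subrr b); apply: cvg_norm; apply: cvgB => //; exact: cvg_cst.
Qed.

Lemma cvg_cmod_sub z w l : cmod (z n - l) @[n --> \oo] --> (0 : R) ->
  cmod (z n - w) @[n --> \oo] --> cmod (l - w).
Proof.
move=> zl; apply/cvgrPdist_lt => e e0.
move/cvgrPdist_lt : zl => /(_ e e0); apply: filterS => n.
rewrite sub0r normrN ger0_norm ?cmod_ge0//; apply: le_lt_trans.
have h1 := cmod_triangle l (z n) w; have h2 := cmod_triangle (z n) l w.
by rewrite (cmodB l (z n)) in h2; rewrite ler_norml; apply/andP; split; lra.
Qed.

Lemma ecvg0P (a : nat -> \bar R) : (forall n, 0 <= a n)%E ->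
  a n @[n --> \oo] --> 0%E <->
  (forall e, 0 < e -> exists N, forall n, (N <= n)%N -> (a n <= e%:E)%E).
Proof.
move=> a0; split=> [/fine_cvgP[[N1 _ H1] /cvgrPdist_le H] e e0|H].
  have [N2 _ H2] := H _ e0; exists (maxn N1 N2) => n; rewrite geq_max => /andP[n1 n2].
  rewrite -(fineK (H1 n n1)) lee_fin.
  have := H2 n n2; rewrite sub0r normrN; apply: le_trans; exact: ler_norm.
have afin e n : (a n <= e%:E)%E -> a n \is a fin_num.
  by move=> h; rewrite ge0_fin_numE// (le_lt_trans h)// ltry.
apply/fine_cvgP; split.
  by have [N HN] := H 1 ltr01; exists N => // n /= /HN; exact: afin.
apply/cvgrPdist_le => e e0; have [N HN] := H _ e0; exists N => // n /= /HN h.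
rewrite sub0r normrN ger0_norm ?fine_ge0//.
by rewrite -lee_fin fineK//; exact: afin h.
Qed.

Lemma cvg_half_expn : (2^-1 : R) ^+ n @[n --> \oo] --> 0.
Proof. by apply: cvg_expr; rewrite ger0_norm// invf_lt1// ltr1n. Qed.

End sequences.

Section convergence_in_Lr.
Context {d} {Y : measurableType d} {R : realType}.
Variable P : probability Y R.
Implicit Types (f : Y -> R) (g h : Y -> R[i]) (r c : R).

Local Notation "'NR' r f" := (Lnorm P r%:E (fun y => (f y)%:E))
  (at level 10, r at level 9, f at level 9).

Lemma integral_le_Lnorm r f : 1 <= r -> measurable_fun [set: Y] f ->
  (\int[P]_x `|f x|%:E <= NR r f)%E.
Proof.
(* The case [r = 1] is separate because the conjugate exponent would be infinite. *)
rewrite le_eqVlt => /predU1P[<- _|r1 mf].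
  by rewrite Lnorm1.
have r0 : 0 < r by exact: lt_trans r1.
have q0 : 0 < (1 - r^-1)^-1 by rewrite invr_gt0 subr_gt0 invf_lt1.
have := @hoelder _ _ _ P f (fun=> 1) r (1 - r^-1)^-1 mf (measurable_cst _) r0 q0.
rewrite invrK subrKC => /(_ erefl).
rewrite Lnorm1 /=; under eq_integral do rewrite mulr1.
move=> /le_trans; apply.
have -> : Lnorm P ((1 - r^-1)^-1)%:E (EFin \o (fun=> 1)) = 1%E.
  apply: (etrans (Lnorm_cst1 P (1 - r^-1)^-1)).
  exact: (etrans (congr1 (fun x => poweR x _) (probability_setT P)) (poweR1r _)).
by rewrite mule1.
Qed.

(** On a probability space the [L_1] norm is at most the [L_r] norm, so the sum of the [|F j|] has
    integral at most [2 * c] and is finite almost everywhere. *)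
Lemma ae_summable r c (F : nat -> Y -> R) : 1 <= r -> 0 <= c ->
  (forall j, measurable_fun [set: Y] (F j)) ->
  (forall j, (NR r (F j) <= (c * 2^-1 ^+ j)%:E)%E) ->
  {ae P, forall x, exists M, forall n, \sum_(0 <= j < n) `|F j x| <= M}.
Proof.
move=> r1 c0 mF Fc.
have mE j : measurable_fun [set: Y] (fun x => `|F j x|%:E).
  by apply/measurable_EFinP; exact: measurableT_comp.
have IS : P.-integrable setT (fun x => \sum_(j <oo) `|F j x|%:E)%E.
  apply/integrableP; split.
    by apply: ge0_emeasurable_sum => // j x _ _; rewrite lee_fin.
  rewrite (eq_integral (fun x => \sum_(j <oo) `|F j x|%:E)%E); last first.
    by move=> x _; rewrite gee0_abs// nneseries_ge0// => *; rewrite lee_fin.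
  rewrite integral_nneseries//.
  apply: (@le_lt_trans _ _ (\sum_(j <oo) (c * 2^-1 ^+ j)%:E)%E).
    apply: lee_nneseries => j _ //.
      by move=> _; apply: integral_ge0 => *; rewrite lee_fin.
    exact: le_trans (integral_le_Lnorm r1 (mF j)) (Fc j).
  apply: (@le_lt_trans _ _ (2 * c)%:E); last exact: ltry.
  apply: lime_le.
    by apply: is_cvg_nneseries => *; rewrite lee_fin mulr_ge0// exprn_ge0.
  apply: nearW => n; rewrite sumEFin lee_fin -mulr_sumr mulrC ler_wpM2r//.
  have h : `|2^-1 : R| < 1 by rewrite ger0_norm// invf_lt1// ltr1n.
  have -> : \sum_(0 <= j < n) (2^-1 : R) ^+ j = series (geometric 1 2^-1) n.
    by rewrite /series/=; apply: eq_bigr => j _; rewrite mul1r.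
  apply: le_trans (geometric_le_lim n ler01 _ h) _ => //.
  by rewrite div1r (_ : 1 - 2^-1 = 2^-1) ?invrK//; lra.
have := integrable_ae measurableT IS; apply: filterS => x /(_ I) Hx.
exists (fine (\sum_(j <oo) `|F j x|%:E)%E) => n.
rewrite -lee_fin fineK// -sumEFin.
by apply: nneseries_lim_ge => *; rewrite lee_fin.
Qed.

Lemma ae_cvg0 r c (F : nat -> Y -> R) : 1 <= r -> 0 <= c ->
  (forall j, measurable_fun [set: Y] (F j)) ->
  (forall j, (NR r (F j) <= (c * 2^-1 ^+ j)%:E)%E) ->
  {ae P, forall x, F j x @[j --> \oo] --> 0}.
Proof.
move=> r1 c0 mF Fc; have := ae_summable r1 c0 mF Fc.
apply: filterS => x HM; apply/cvgrPdist_lt => e e0.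
have [J HJ] := bounded_series_tail (fun j => normr_ge0 _) HM e0.
exists J => // n /= Jn; rewrite sub0r normrN.
apply: le_lt_trans (HJ n.+1 (leqW Jn)).
by rewrite big_nat_recr//= lerDr sumr_ge0.
Qed.

Lemma CLnorm_triangle r g1 g2 g3 : 1 <= r ->
  cmeasurable g1 -> cmeasurable g2 -> cmeasurable g3 ->
  (CLnorm P r (fun x => g1 x - g3 x)%R <=
   CLnorm P r (fun x => g1 x - g2 x)%R + CLnorm P r (fun x => g2 x - g3 x)%R)%E.
Proof.
move=> r1 m1 m2 m3.
have m12 := measurable_cmod (cmeasurableB m1 m2).
have m23 := measurable_cmod (cmeasurableB m2 m3).
have m13 := measurable_cmod (cmeasurableB m1 m3).
apply: le_trans (@minkowski_EFin _ _ _ P _ _ r m12 m23 r1).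
apply: Lnorm_le.
- exact: lt_le_trans r1.
- exact: m13.
- exact: (measurable_funD m12 m23).
- apply: nearW => x; rewrite !ger0_norm ?addr_ge0 ?cmod_ge0//.
  exact: cmod_triangle.
Qed.

Lemma CLnormC r g h :
  CLnorm P r (fun x => g x - h x)%R = CLnorm P r (fun x => h x - g x)%R.
Proof. by apply: eq_Lnorm => x; rewrite cmodB. Qed.

Definition CLcauchy r (u : nat -> Y -> R[i]) := forall e, 0 < e ->
  exists N, forall m n, (N <= m)%N -> (N <= n)%N ->
    (CLnorm P r (fun x => u m x - u n x)%R <= e%:E)%E.

(** A rapid subsequence has almost everywhere summable increments, hence a pointwise limit; Fatou's
    lemma then bounds the distance from every late [u m] to this limit. *)
Lemma Riesz_Fischer r (u : nat -> Y -> R[i]) : 1 <= r ->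
  (forall n, CLfun P r (u n)) -> CLcauchy r u ->
  exists2 g, CLfun P r g &
    CLnorm P r (fun x => u n x - g x)%R @[n --> \oo] --> 0%E.
Proof.
move=> r1 Lu cu; have r0 : 0 < r by exact: lt_le_trans r1.
have mB m n := measurable_cmod (cmeasurableB (Lu m).1 (Lu n).1).
have [s smono sQ] : exists2 s : nat -> nat, {homo s : m n / (m <= n)%N} &
    forall j m n, (s j <= m)%N -> (s j <= n)%N ->
    (CLnorm P r (fun x => u m x - u n x)%R <= (1 * 2^-1 ^+ j)%:E)%E.
  apply: (@rapid_subsequence (fun j m n =>
    (CLnorm P r (fun x => u m x - u n x)%R <= (1 * 2^-1 ^+ j)%:E)%E)) => j.
  by apply: cu; rewrite mul1r exprn_gt0.
have sj j : (NR r (fun x => cmod (u (s j.+1) x - u (s j) x)) <=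
    (1 * 2^-1 ^+ j)%:E)%E.
  by apply: sQ => //; exact: smono.
pose v j x := u (s j) x.
have cv : {ae P, forall x, exists l, cmod (v j x - l) @[j --> \oo] --> (0 : R)}.
  have := ae_summable r1 ler01 (fun j => mB _ _) sj.
  apply: filterS => x HM; apply: complex_cauchy_cvg => e e0.
  have [J HJ] := bounded_series_tail (fun j => normr_ge0 _) HM e0.
  exists J => n Jn; apply: le_lt_trans (HJ n Jn).
  by apply: (@cmod_telescope _ (v^~ x) _ J n Jn) => j; rewrite ger0_norm// cmod_ge0.
(* Upper limits make [g] defined and measurable at every point, including those where the
   subsequence diverges. *)
pose lim_of (F : R[i] -> R) x := fine (limn_esup (fun j => (F (v j x))%:E)).
pose g x := Complex (lim_of (@complex.Re R) x) (lim_of (@complex.Im R) x).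
have mg : cmeasurable g.
  have mL F : (forall j, measurable_fun [set: Y] (fun x => F (v j x))) ->
      measurable_fun [set: Y] (lim_of F).
    move=> mF; apply: (@measurableT_comp _ _ _ _ _ _ fine) => //.
    by apply: measurable_fun_limn_esup => j; apply/measurable_EFinP.
  by split; apply: mL => j; [exact: (Lu (s j)).1.1|exact: (Lu (s j)).1.2].
have vg : {ae P, forall x, cmod (v j x - g x) @[j --> \oo] --> (0 : R)}.
  apply: filterS cv => x [l vl].
  suff -> : g x = l by [].
  have lE (F : R[i] -> R) : (forall x y, F (x - y) = F x - F y) ->
      (forall x, `|F x| <= cmod x) -> lim_of F x = F l.
    move=> FB Fle.
    have h : F (v j x) @[j --> \oo] --> F l.
      apply/cvgrPdist_lt => e e0; move/cvgrPdist_lt : vl => /(_ e e0).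
      apply: filterS => n; rewrite sub0r normrN ger0_norm ?cmod_ge0//.
      by apply: le_lt_trans; rewrite distrC -FB.
    have h' : (F (v j x))%:E @[j --> \oo] --> (F l)%:E.
      by apply: cvg_EFin => //; exact: nearW.
    by rewrite /lim_of (cvg_limn_einf_sup h').2.
  by rewrite /g (lE _ (@cReB R) (@cmod_Re R)) (lE _ (@cImB R) (@cmod_Im R)); case: (l).
have bnd J m : (s J <= m)%N ->
    (CLnorm P r (fun x => u m x - g x)%R <= (1 * 2^-1 ^+ J)%:E)%E.
  move=> sm.
  apply: (@Lnorm_fatou _ _ _ P r (fun j x => cmod (u m x - v j x)) _ _ r0).
  - by rewrite mul1r exprn_ge0.
  - by move=> n; exact: mB.
  - exact: measurable_cmod (cmeasurableB (Lu m).1 mg).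
  - apply: filterS vg => x vg.
    rewrite cmodB; under eq_fun do rewrite cmodB.
    exact: cvg_cmod_sub.
  - by exists J => // j /= Jj; apply: sQ => //; exact: smono.
exists g; first split => //.
- have := bnd 0%N (s 0%N) (leqnn _); set A := CLnorm P r _ => A1.
  have := @CLnorm_triangle r g (u (s 0%N)) (fun=> 0) r1 mg (Lu _).1 (cmeasurable_cst _).
  have E (w : Y -> R[i]) : CLnorm P r (fun x => w x - 0) = CLnorm P r w.
    by apply: eq_Lnorm => x; rewrite subr0.
  rewrite !E => /le_lt_trans; apply; rewrite CLnormC lte_add_pinfty//.
    by rewrite (le_lt_trans A1)// ltry.
  exact: (Lu _).2.
- apply/ecvg0P => [n|e e0]; first exact: Lnorm_ge0.
  have /cvgrPdist_le /(_ e e0)[J _ HJ] := @cvg_half_expn R.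
  exists (s J) => n /bnd /le_trans; apply; rewrite lee_fin mul1r.
  have := HJ J (leqnn J); rewrite sub0r normrN; apply: le_trans.
  exact: ler_norm.
Qed.

Lemma CLlim_spec r (u : nat -> Y -> R[i]) : 1 <= r ->
  (forall n, CLfun P r (u n)) -> CLcauchy r u ->
  CLfun P r (CLlim P r u) /\
  CLnorm P r (fun x => u n x - CLlim P r u x)%R @[n --> \oo] --> 0%E.
Proof.
move=> r1 Lu cu; have [g Lg ug] := Riesz_Fischer r1 Lu cu.
exact: (xgetPex (P := [set g | CLfun P r g /\
    CLnorm P r (fun y => u n y - g y) @[n --> \oo] --> 0%E]) (fun=> 0)
    (ex_intro _ g (conj Lg ug))).
Qed.

Lemma CLlim_dist r (u : nat -> Y -> R[i]) c N : 1 <= r ->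
  (forall n, CLfun P r (u n)) -> CLcauchy r u ->
  (forall m n, (N <= m)%N -> (N <= n)%N ->
    (CLnorm P r (fun x => u m x - u n x)%R <= c%:E)%E) ->
  forall m, (N <= m)%N ->
    (CLnorm P r (fun x => u m x - CLlim P r u x)%R <= c%:E)%E.
Proof.
move=> r1 Lu cu HN m Nm; have [Lg] := CLlim_spec r1 Lu cu.
move=> /ecvg0P H; apply/lee_addgt0Pr => e e0.
have [n|M HM] := H _ _ e0; first exact: Lnorm_ge0.
have := CLnorm_triangle r1 (Lu m).1 (Lu (maxn N M)).1 Lg.1.
move/le_trans; apply; apply: leeD.
  by apply: HN => //; exact: leq_maxl.
by apply: HM; exact: leq_maxr.
Qed.

End convergence_in_Lr.

(** * Integration on powers of a probability space *)

Definition cintegrable {d} {Y : measurableType d} {R : realType}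
    (P : {measure set Y -> \bar R}) (g : Y -> R[i]) :=
  P.-integrable setT (fun x => (complex.Re (g x))%:E) /\
  P.-integrable setT (fun x => (complex.Im (g x))%:E).

Lemma integral_probability_cst {d} {Y : measurableType d} {R : realType}
  (P : probability Y R) (c : R) : (\int[P]_x c%:E = c%:E)%E.
Proof.
apply: (etrans (integral_cst P measurableT c%:E)).
exact: (etrans (congr1 (fun x => c%:E * x)%E (probability_setT P)) (mule1 _)).
Qed.

Lemma Rintegral_probability_cst {d} {Y : measurableType d} {R : realType}
  (P : probability Y R) (c : R) : \int[P]_x c = c.
Proof. by rewrite /Rintegral integral_probability_cst. Qed.

Section product_integral.
Context {d1 d2} {Y1 : measurableType d1} {Y2 : measurableType d2} {R : realType}.
Variables (P1 : probability Y1 R) (P2 : probability Y2 R).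

Lemma integrable_tensor (a : Y1 -> R) (b : Y2 -> R) :
  P1.-integrable setT (EFin \o a) -> P2.-integrable setT (EFin \o b) ->
  (P1 \x P2)%E.-integrable setT (fun z => (a z.1 * b z.2)%:E).
Proof.
move=> ia ib.
have ma : measurable_fun [set: Y1] a.
  by apply/measurable_EFinP; case/integrableP: ia.
have mb : measurable_fun [set: Y2] b.
  by apply/measurable_EFinP; case/integrableP: ib.
apply/integrable12ltyP.
  apply/measurable_EFinP; apply: measurable_funM.
    exact: (measurableT_comp ma measurable_fst).
  exact: (measurableT_comp mb measurable_snd).
under eq_integral => x _.
  under eq_integral => y _ do rewrite /= normrM EFinM.
  rewrite ge0_integralZl//; last by apply/measurable_EFinP; exact: measurableT_comp.
  over.
rewrite ge0_integralZr//; last 2 first.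
  by apply/measurable_EFinP; exact: measurableT_comp.
  by apply: integral_ge0.
case/integrableP: ia => _ ia; case/integrableP: ib => _ ib.
by rewrite lte_mul_pinfty ?integral_ge0// ge0_fin_numE ?integral_ge0.
Qed.

Lemma integral_tensor (a : Y1 -> R) (b : Y2 -> R) :
  P1.-integrable setT (EFin \o a) -> P2.-integrable setT (EFin \o b) ->
  \int[(P1 \x P2)%E]_z (a z.1 * b z.2) = (\int[P1]_x a x) * (\int[P2]_y b y).
Proof.
move=> ia ib; rewrite /Rintegral -integral12_prod_meas1; last exact: integrable_tensor.
rewrite /fubini_F/=.
have fb : (\int[P2]_y (b y)%:E)%E \is a fin_num by exact: integrable_fin_num.
have fa : (\int[P1]_x (a x)%:E)%E \is a fin_num by exact: integrable_fin_num.
transitivity (fine (\int[P1]_x ((a x)%:E * (\int[P2]_y b y)%:E))%E).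
  congr fine; apply: eq_integral => x _.
  by under eq_integral do rewrite EFinM; rewrite integralZl// fineK.
by rewrite integralZr// fineK// fineM.
Qed.

Lemma cintegrable_tensor (g : Y1 -> R[i]) (h : Y2 -> R[i]) :
  cintegrable P1 g -> cintegrable P2 h ->
  cintegrable (P1 \x P2)%E (fun z => g z.1 * h z.2) /\
  Cintegral (P1 \x P2)%E (fun z => g z.1 * h z.2) =
  Cintegral P1 g * Cintegral P2 h.
Proof.
move=> [gr gi] [hr hi].
have irr := integrable_tensor gr hr; have iii := integrable_tensor gi hi.
have iri := integrable_tensor gr hi; have iir := integrable_tensor gi hr.
split; first split.
- under eq_fun do rewrite cReM EFinB; exact: integrableB.
- under eq_fun do rewrite cImM EFinD; exact: integrableD.
rewrite /Cintegral; apply/eqP; rewrite eq_complex/=; apply/andP; split; apply/eqP.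
- transitivity (\int[(P1 \x P2)%E]_z (complex.Re (g z.1) * complex.Re (h z.2) -
      complex.Im (g z.1) * complex.Im (h z.2))).
    by apply: eq_Rintegral => z _; exact: cReM.
  by rewrite RintegralB//; congr (_ - _); exact: integral_tensor.
- transitivity (\int[(P1 \x P2)%E]_z (complex.Re (g z.1) * complex.Im (h z.2) +
      complex.Im (g z.1) * complex.Re (h z.2))).
    by apply: eq_Rintegral => z _; exact: cImM.
  by rewrite RintegralD//; congr (_ + _); exact: integral_tensor.
Qed.

End product_integral.

Section product_probability.
Context {dX} {X : measurableType dX} {R : realType}.
Variable mu : probability X R.

Lemma ge0_integral_prob_powS m (F : m.+1.-tuple X -> \bar R) :
  measurable_fun setT F -> (forall z, 0 <= F z)%E ->
  (\int[prob_pow mu m.+1]_z F z =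
   \int[mu \x prob_pow mu m]_z F (tcons z))%E.
Proof.
move=> mF F0.
by have := ge0_integral_pushforward (@measurable_tcons _ X m)
  (mu \x prob_pow mu m)%E measurableT mF (fun y _ => F0 y).
Qed.

Lemma cintegral_prob_powS m (g : m.+1.-tuple X -> R[i]) :
  cmeasurable g ->
  cintegrable (mu \x prob_pow mu m)%E (fun z => g (tcons z)) ->
  cintegrable (prob_pow mu m.+1) g /\
  Cintegral (prob_pow mu m.+1) g = Cintegral (mu \x prob_pow mu m)%E (fun z => g (tcons z)).
Proof.
move=> [mr mi] [ir ii].
have mr' : measurable_fun setT (fun z => (complex.Re (g z))%:E) by exact/measurable_EFinP.
have mi' : measurable_fun setT (fun z => (complex.Im (g z))%:E) by exact/measurable_EFinP.
have h F (mF : measurable_fun setT F)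
    (iF : (mu \x prob_pow mu m)%E.-integrable setT (F \o @tcons _ X m)) :=
  (integrable_pushforward (@measurable_tcons _ X m) mF iF measurableT,
   integral_pushforward (@measurable_tcons _ X m) mF iF measurableT).
split.
  by split; [exact: (h _ mr' ir).1|exact: (h _ mi' ii).1].
congr Complex; rewrite /Rintegral; congr fine.
- exact: (h _ mr' ir).2.
- exact: (h _ mi' ii).2.
Qed.

Lemma cmeasurable_tnth n (u : 'I_n -> X -> R[i]) :
  (forall i, cmeasurable (u i)) ->
  cmeasurable (fun x : n.-tuple X => \prod_(i < n) u i (tnth x i)).
Proof.
move=> mu_; apply: cmeasurable_prod => i.
by apply: cmeasurable_comp => //; exact: measurable_tnth.
Qed.

Lemma prod_tnth_tcons (A : comPzSemiRingType) n (u : 'I_n.+1 -> X -> A)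
    (z : X * n.-tuple X) :
  \prod_(i < n.+1) u i (tnth (tcons z) i) =
  u ord0 z.1 * \prod_(i < n) u (lift ord0 i) (tnth z.2 i).
Proof.
rewrite big_ord_recl tnth0; congr (_ * _); apply: eq_bigr => i _.
by rewrite tnthS.
Qed.

Lemma Cintegral_prod n (u : 'I_n -> X -> R[i]) :
  (forall i, cmeasurable (u i)) -> (forall i, cintegrable mu (u i)) ->
  cintegrable (prob_pow mu n) (fun x => \prod_(i < n) u i (tnth x i)) /\
  Cintegral (prob_pow mu n) (fun x => \prod_(i < n) u i (tnth x i)) =
  \prod_(i < n) Cintegral mu (u i).
Proof.
elim: n u => [|n IH] u mu_ iu.
  rewrite big_ord0; under eq_fun do rewrite big_ord0.
  split; first by split; apply: finite_measure_integrable_cst.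
  exact: congr2 (Rintegral_probability_cst _ _) (Rintegral_probability_cst _ _).
have [i1 e1] := IH _ (fun i => mu_ (lift ord0 i)) (fun i => iu (lift ord0 i)).
have [i2 e2] := cintegrable_tensor (iu ord0) i1.
have E : (fun z : X * n.-tuple X => \prod_(i < n.+1) u i (tnth (tcons z) i)) =
    fun z => u ord0 z.1 * \prod_(i < n) u (lift ord0 i) (tnth z.2 i).
  by apply/funext => z; exact: prod_tnth_tcons.
have := @cintegral_prob_powS n (fun x => \prod_(i < n.+1) u i (tnth x i)) (cmeasurable_tnth mu_).
rewrite E => /(_ i2)[i3 e3]; split => //.
by rewrite e3 e2 e1 big_ord_recl.
Qed.

Lemma ge0_integral_prod n (u : 'I_n -> X -> R) (c : 'I_n -> R) :
  (forall i, measurable_fun setT (u i)) -> (forall i x, 0 <= u i x) ->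
  (forall i, (\int[mu]_x (u i x)%:E = (c i)%:E)%E) ->
  (\int[prob_pow mu n]_x (\prod_(i < n) u i (tnth x i))%:E =
   (\prod_(i < n) c i)%:E)%E.
Proof.
elim: n u c => [|n IH] u c mu_ u0 iu.
  rewrite big_ord0; under eq_integral do rewrite big_ord0.
  exact: integral_probability_cst.
have mt : measurable_fun setT (fun x : n.+1.-tuple X => \prod_(i < n.+1) u i (tnth x i)).
  by apply: measurable_prod => i _; apply: measurableT_comp => //; exact: measurable_tnth.
have mt' : measurable_fun setT (fun x : n.-tuple X =>
    \prod_(i < n) u (lift ord0 i) (tnth x i)).
  by apply: measurable_prod => i _; apply: measurableT_comp => //; exact: measurable_tnth.
rewrite ge0_integral_prob_powS; [|exact/measurable_EFinP|]; last first.
  by move=> z; rewrite lee_fin prodr_ge0.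
under eq_integral do rewrite prod_tnth_tcons EFinM.
rewrite fubini_tonelli1; last 2 first.
- apply/emeasurable_funM; apply/measurable_EFinP.
    exact: (measurableT_comp (mu_ ord0) measurable_fst).
  exact: (measurableT_comp mt' measurable_snd).
- by move=> z; rewrite mule_ge0 ?lee_fin// prodr_ge0.
rewrite /fubini_F/=.
under eq_integral => x _.
  rewrite ge0_integralZl//; last 3 first.
  - exact/measurable_EFinP.
  - by move=> y _; rewrite lee_fin prodr_ge0.
  - by rewrite lee_fin.
  rewrite (IH (fun i => u (lift ord0 i)) (fun i => c (lift ord0 i)))//.
  over.
rewrite ge0_integralZr//.
- by rewrite iu big_ord_recl EFinM.
- exact/measurable_EFinP.
- by move=> x _; rewrite lee_fin.
- by rewrite lee_fin prodr_ge0// => i _; rewrite -lee_fin -iu integral_ge0// => x _; rewrite lee_fin.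
Qed.

Lemma ae_tnth n (i : 'I_n) (Q : set X) : {ae mu, forall x, Q x} ->
  {ae prob_pow mu n, forall z, Q (tnth z i)}.
Proof.
move=> [A [mA A0 QA]]; have mt := @measurable_tnth _ X n i.
exists ((@tnth n X ^~ i) @^-1` A); split.
- by rewrite -[X in measurable X]setTI; exact: mt.
(* The measure of the cylinder over [A] is the integral of a product whose [i]-th factor is the
   indicator of [A] and whose other factors are [1]. *)
- pose u j x : R := if j == i then \1_A x else 1.
  pose c j : R := if j == i then 0 else 1.
  have := @ge0_integral_prod n u c.
  have -> : \prod_(j < n) c j = 0.
    by rewrite (bigD1 i)//= /c eqxx mul0r.
  rewrite (_ : (fun x : n.-tuple X => _) = fun x : n.-tuple X => (\1_A (tnth x i))%:E); last first.
    apply/funext => x; rewrite (bigD1 i)//= /u eqxx big1 ?mulr1// => j ji.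
    by rewrite (negbTE ji).
  rewrite (_ : (fun x : n.-tuple X => _) =
     fun x => (\1_((@tnth n X ^~ i) @^-1` A) x)%:E)//.
  rewrite integral_indic// ?setIT; last by rewrite -[X in measurable X]setTI; exact: mt.
  apply.
  + by move=> j; rewrite /u; case: (j == i) => //; exact: measurable_indic.
  + by move=> j x; rewrite /u; case: (j == i).
  + move=> j; rewrite /u /c; case: (j == i).
      by rewrite integral_indic// setIT.
    exact: integral_probability_cst.
- by move=> z /= nQ; exact: QA.
Qed.

(** By Tonelli the measures of the sections of a null set integrate to zero, so almost all of them
    vanish. The first coordinate is the inner one because the injectivity proof freezes the others
    and studies the dependence on the first. *)
Lemma ae_prob_powS m (Q : set (m.+1.-tuple X)) :
  {ae prob_pow mu m.+1, forall z, Q z} ->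
  {ae prob_pow mu m, forall y, {ae mu, forall x, Q (tcons (x, y))}}.
Proof.
move=> [A [mA A0 QA]].
have mA' : measurable_fun setT (fun z : m.+1.-tuple X => (\1_A z : R)%:E).
  by apply/measurable_EFinP; exact: measurable_indic.
have mA'' : measurable_fun setT (fun z : X * m.-tuple X => (\1_A (tcons z) : R)%:E).
  by apply: (measurableT_comp mA'); exact: measurable_tcons.
have A'0 z : (0 <= (\1_A z : R)%:E)%E by rewrite lee_fin.
have E0 : (\int[prob_pow mu m.+1]_z (\1_A z : R)%:E = 0)%E.
  by rewrite integral_indic// setIT.
have := etrans (esym (ge0_integral_prob_powS mA' A'0)) E0.
rewrite fubini_tonelli2// => h0.
have mG := measurable_fun_fubini_tonelli_G _ mA'' (fun z => ltac:(by rewrite lee_fin)) (m1 := mu).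
have := (ae_eq_integral_abs (prob_pow mu m) measurableT mG).1.
have -> : (\int[prob_pow mu m]_x `|fubini_G mu (fun z => (\1_A (tcons z))%:E) x| = 0)%E.
  rewrite -[RHS]h0; apply: eq_integral => y _; rewrite gee0_abs//.
  by apply: integral_ge0 => *; rewrite lee_fin.
move=> /(_ erefl); apply: filterS => y /(_ I).
rewrite /fubini_G/= => hy.
have mty : measurable_fun setT (fun x : X => tcons (x, y)).
  by apply: (measurableT_comp (@measurable_tcons _ X m)).
exists ((fun x => tcons (x, y)) @^-1` A); split.
- by rewrite -[X in measurable X]setTI; exact: mty.
- rewrite -hy -[X in mu X]setIT -integral_indic//.
  by rewrite -[X in measurable X]setTI; exact: mty.
- by move=> x /= nQ; exact: QA.
Qed.

End product_probability.

(** * Injectivity of the algebraic tensor product *)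

Section Lp_closure.
Context {dX} {X : measurableType dX} {R : realType}.
Variables (mu : probability X R) (p : R).
Hypothesis p1 : 1 <= p.

Lemma CLfun0 : CLfun mu p (fun=> 0).
Proof.
split; first exact: cmeasurable_cst.
rewrite /CLnorm; under eq_fun do rewrite cmod0.
by rewrite Lnorm_cst0 ?ltry// (lt_le_trans ltr01).
Qed.

Lemma CLfun_linear b c f g : CLfun mu p f -> CLfun mu p g ->
  CLfun mu p (fun x => b * f x + c * g x).
Proof.
move=> [mf f1] [mg g1].
have mbf := cmeasurableM (cmeasurable_cst b) mf.
have mcg := cmeasurableM (cmeasurable_cst c) mg.
have p0 : 0 < p by exact: lt_le_trans p1.
split; first exact: cmeasurableD.
have := CLnorm_triangle mu p1 mbf (cmeasurable_cst 0) (cmeasurableM (cmeasurable_cst (-1)) mcg).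
rewrite (_ : CLnorm mu p _ = CLnorm mu p (fun x => b * f x + c * g x)); last first.
  by apply: eq_Lnorm => x; rewrite mulN1r opprK.
move=> /le_lt_trans; apply; rewrite lte_add_pinfty//.
  rewrite (_ : CLnorm mu p _ = Lnorm mu p%:E (fun x => (cmod b * cmod (f x))%:E)); last first.
    by apply: eq_Lnorm => x; rewrite subr0 cmodM.
  by rewrite Lnorm_scale//; [rewrite lte_mul_pinfty// lee_fin|exact: measurable_cmod].
rewrite (_ : CLnorm mu p _ = Lnorm mu p%:E (fun x => (cmod c * cmod (g x))%:E)); last first.
  by apply: eq_Lnorm => x; rewrite sub0r cmodN !cmodM cmodN cmod1 mul1r.
by rewrite Lnorm_scale//; [rewrite lte_mul_pinfty// lee_fin|exact: measurable_cmod].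
Qed.

Lemma CLfun_lincomb I (s : seq I) (e : I -> R[i]) (F : I -> X -> R[i]) :
  (forall i, CLfun mu p (F i)) -> CLfun mu p (fun x => \sum_(i <- s) e i * F i x).
Proof.
move=> LF; elim: s => [|i s IH].
  by under eq_fun do rewrite big_nil; exact: CLfun0.
rewrite (_ : (fun x => _) = fun x => e i * F i x + 1 * \sum_(j <- s) e j * F j x).
  exact: CLfun_linear.
by apply/funext => x; rewrite big_cons mul1r.
Qed.

Lemma Lp_normE (f : Lp mu p) : (Lp_norm f)%:E = CLnorm mu p f.
Proof.
by rewrite /Lp_norm fineK// ge0_fin_numE ?Lnorm_ge0//; exact: (LpP f).2.
Qed.

Lemma Lp_norm_ge0 (f : Lp mu p) : 0 <= Lp_norm f.
Proof. by rewrite fine_ge0// Lnorm_ge0. Qed.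

Lemma Lp_norm_eq0 (f : Lp mu p) : Lp_norm f = 0 -> {ae mu, forall x, f x = 0}.
Proof.
move=> f0; have mf := measurable_cmod (LpP f).1.
have : CLnorm mu p f = 0%E by rewrite -Lp_normE f0.
move/Lnorm_eq0_eq0 => /(_ _ _)[].
- exact/measurable_EFinP.
- by rewrite lte_fin (lt_le_trans ltr01).
- move=> N [mN N0 h]; exists N; split => // x nx; apply: h => /= /(_ I) [] e.
  by apply: nx; exact: cmod_eq0.
Qed.

End Lp_closure.

Section tensor_congruence.
Context {dX} {X : measurableType dX} {R : realType}.
Variables (mu : probability X R) (p : R) (d : nat).
Local Notation tensor := (tensor mu p d).
Implicit Types s t w : tensor.

Lemma teq_catCA s t w : tensor_eq (s ++ t ++ w) (t ++ s ++ w).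
Proof.
by rewrite !catA; apply: teq_cat; [exact: teq_catC|exact: teq_refl].
Qed.

Lemma tscale0 t : tensor_eq (tscale 0 t) [::].
Proof.
elim: t => [|[a u] t IH]; first exact: teq_refl.
rewrite /= -cat1s -[X in tensor_eq _ X]cat0s; apply: teq_cat IH.
by rewrite mul0r; exact: teq_zero.
Qed.

End tensor_congruence.

(** * Multilinear evaluation of formal sums, modulo null sets *)

Section evaluation.
Context {dX} {X : measurableType dX} {R : realType}.
Variables (mu : probability X R) (p : R) (d : nat).
Context {dY} {Y : measurableType dY}.
Variable P : probability Y R.
Variable W : 'I_d -> Lp mu p -> Y -> R[i].
Implicit Types s t : tensor mu p d.

(** Two instances are used: [W i u] evaluates [u] at the [i]-th coordinate, which gives
    [tensor_fun], or is a Birkhoff average of [u], which gives the averages on the diagonal. *)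
Definition tensor_eval t (y : Y) : R[i] :=
  \sum_(au <- t) au.1 * \prod_(i < d) W i (au.2 i) y.

Lemma tensor_eval_cat s t y :
  tensor_eval (s ++ t) y = tensor_eval s y + tensor_eval t y.
Proof. exact: big_cat. Qed.

Lemma tensor_eval_scale a t y :
  tensor_eval (tscale a t) y = a * tensor_eval t y.
Proof.
rewrite /tensor_eval big_map mulr_sumr; apply: eq_bigr => au _.
by rewrite mulrA.
Qed.

Lemma cmeasurable_eval t : (forall i u, cmeasurable (W i u)) ->
  cmeasurable (tensor_eval t).
Proof.
move=> mW; apply: cmeasurable_sum => au; apply: cmeasurableM.
  exact: cmeasurable_cst.
exact: cmeasurable_prod.
Qed.

Hypothesis HW : forall i b c (u v w : Lp mu p),
  {ae mu, forall x, u x = b * v x + c * w x} ->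
  {ae P, forall y, W i u y = b * W i v y + c * W i w y}.

Lemma tensor_eval_eq s t : tensor_eq s t ->
  {ae P, forall y, tensor_eval s y = tensor_eval t y}.
Proof.
elim => {s t}.
- by move=> t; exact: aeW.
- by move=> s t _; apply: filterS => y ->.
- by move=> s t w _ + _; apply: filterS2 => y -> ->.
- move=> s s' t t' _ + _; apply: filterS2 => y + +.
  by rewrite !tensor_eval_cat => -> ->.
- by move=> s t; apply: aeW => y; rewrite !tensor_eval_cat addrC.
- by move=> u; apply: aeW => y; rewrite /tensor_eval big_seq1 big_nil mul0r.
- move=> a b u; apply: aeW => y.
  by rewrite /tensor_eval big_cons !big_seq1 mulrDl.
- move=> a b c i u v w uvw ui.
  (* Compatibility with equality almost everywhere is the linearity hypothesis with coefficients [1]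
     and [0]. *)
  have HWeq (f g : Lp mu p) j : ae_eq mu setT f g ->
      {ae P, forall y, W j f y = W j g y}.
    move=> fg; have : {ae mu, forall x, f x = 1 * g x + 0 * g x}.
      by apply: filterS fg => x /(_ I) ->; rewrite mul1r mul0r addr0.
    by move/(HW j); apply: filterS => y ->; rewrite mul1r mul0r addr0.
  have hi : {ae P, forall y, W i (u i) y = b * W i (v i) y + c * W i (w i) y}.
    by apply: HW; apply: filterS ui => x; exact.
  have hj : {ae P, forall y, forall j, j != i ->
      W j (u j) y = W j (v j) y /\ W j (u j) y = W j (w j) y}.
    apply: filter_forall => j; have [->|ji] := eqVneq j i; first exact: aeW.
    have [uv uw] := uvw j ji.
    by move: (HWeq _ _ j uv) (HWeq _ _ j uw); apply: filterS2 => y.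
  have FF : Filter (almost_everywhere P) by exact: _.
  apply: (@filterS2 _ _ FF _ _ _ _ hi hj) => y {}hi {}hj.
  have E (f : 'I_d -> Lp mu p) :
      (forall j, j != i -> W j (u j) y = W j (f j) y) ->
      \prod_(j < d) W j (f j) y = W i (f i) y * \prod_(j < d | j != i) W j (u j) y.
    by move=> uf; rewrite (bigD1 i isT); congr (_ * _); apply: eq_bigr => j /uf.
  rewrite /tensor_eval big_seq1 big_cons big_seq1 (E u)// (E v) => [|j /hj[]//].
  rewrite (E w) => [|j /hj[]//].
  by move: hi => /= ->; ring.
Qed.

End evaluation.

Section injectivity.
Context {dX} {X : measurableType dX} {R : realType}.
Variables (mu : probability X R) (p : R).
Hypothesis p1 : 1 <= p.

Lemma tensor_fun_eval d (t : tensor mu p d) :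
  tensor_fun t = tensor_eval (fun i (u : Lp mu p) x => u (tnth x i)) t.
Proof. by []. Qed.

Lemma tensor_fun_eq d (s t : tensor mu p d) : tensor_eq s t ->
  {ae prob_pow mu d, forall x, tensor_fun s x = tensor_fun t x}.
Proof.
apply: (@tensor_eval_eq _ _ _ mu p d _ _ (prob_pow mu d)
  (fun i (u : Lp mu p) x => u (tnth x i))) => i b c u v w uvw.
exact: (ae_tnth i uvw).
Qed.

Lemma cmeasurable_tensor_fun d (t : tensor mu p d) : cmeasurable (tensor_fun t).
Proof.
apply: (@cmeasurable_eval _ _ _ mu p d _ _
  (fun i (u : Lp mu p) x => u (tnth x i))) => i u.
by apply: cmeasurable_comp (LpP u).1; exact: measurable_tnth.
Qed.

Definition ocons_Lp d (f : Lp mu p) (u : 'I_d -> Lp mu p) (i : 'I_d.+1) : Lp mu p :=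
  if unlift ord0 i is Some j then u j else f.

(* The tensor [f (x) G] of order [d + 1]. *)
Definition ten d (f : Lp mu p) (G : tensor mu p d) : tensor mu p d.+1 :=
  [seq (au.1, ocons_Lp f au.2) | au <- G].

Definition tens d (l : seq (Lp mu p * tensor mu p d)) : tensor mu p d.+1 :=
  flatten [seq ten fG.1 fG.2 | fG <- l].

Lemma ocons_Lp0 d f (u : 'I_d -> Lp mu p) : ocons_Lp f u ord0 = f.
Proof. by rewrite /ocons_Lp unlift_none. Qed.

Lemma ocons_LpS d f (u : 'I_d -> Lp mu p) i : ocons_Lp f u (lift ord0 i) = u i.
Proof. by rewrite /ocons_Lp liftK. Qed.

Lemma tensor_fun_ten d f (G : tensor mu p d) (z : X * d.-tuple X) :
  tensor_fun (ten f G) (tcons z) = f z.1 * tensor_fun G z.2.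
Proof.
rewrite /tensor_fun big_map mulr_sumr; apply: eq_bigr => -[a u] _ /=.
rewrite (prod_tnth_tcons (fun i => Lp_fun (ocons_Lp f u i))) ocons_Lp0 mulrCA.
by congr (_ * (_ * _)); apply: eq_bigr => i _; rewrite ocons_LpS.
Qed.

Lemma tensor_fun_tens d (l : seq (Lp mu p * tensor mu p d)) z :
  tensor_fun (tens l) (tcons z) = \sum_(fG <- l) fG.1 z.1 * tensor_fun fG.2 z.2.
Proof.
elim: l => [|[f G] l IH]; first by rewrite big_nil /tensor_fun big_nil.
rewrite big_cons -IH -tensor_fun_ten.
exact: big_cat.
Qed.

Lemma ten_cat d f (G G' : tensor mu p d) : ten f (G ++ G') = ten f G ++ ten f G'.
Proof. exact: map_cat. Qed.

Lemma ten_eq d f (G G' : tensor mu p d) :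
  tensor_eq G G' -> tensor_eq (ten f G) (ten f G').
Proof.
elim=> {G G'}.
- by move=> t; exact: teq_refl.
- by move=> s t _; exact: teq_sym.
- by move=> s t w _ st _; exact: teq_trans.
- by move=> s s' t t' _ ? _ ?; rewrite !ten_cat; exact: teq_cat.
- by move=> s t; rewrite !ten_cat; exact: teq_catC.
- by move=> u; exact: teq_zero.
- by move=> a b u; exact: teq_add.
- move=> a b c i u v w uvw ui.
  apply: (@teq_linear _ _ _ _ _ _ _ _ _ (lift ord0 i)); rewrite ?ocons_LpS// => j ji.
  rewrite /ocons_Lp; case: unliftP => [k jk|_]; last by split; exact: ae_eq_refl.
  by apply: uvw; apply: contra ji => /eqP <-; rewrite jk.
Qed.

Lemma ten_linear d (f g h : Lp mu p) b c (G : tensor mu p d) :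
  ae_eq mu setT f (fun x => b * g x + c * h x) ->
  tensor_eq (ten f G) (ten g (tscale b G) ++ ten h (tscale c G)).
Proof.
move=> fgh; elim: G => [|[a u] G IH]; first exact: teq_refl.
apply: (teq_trans (t := [:: (a * b, ocons_Lp g u); (a * c, ocons_Lp h u)] ++
   (ten g (tscale b G) ++ ten h (tscale c G)))).
  apply: (@teq_cat _ _ _ _ _ _ [:: (a, ocons_Lp f u)] _ _ _ _ IH).
  apply: (@teq_linear _ _ _ _ _ _ _ _ _ ord0); rewrite ?ocons_Lp0// => j j0.
  rewrite /ocons_Lp; case: unliftP => [k jk|j0']; first by split; exact: ae_eq_refl.
  by rewrite j0' eqxx in j0.
rewrite /= (mulrC a b) (mulrC a c) -cat1s -[X in tensor_eq _ X]cat1s.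
apply: teq_cat; first exact: teq_refl.
rewrite -cat1s -[X in tensor_eq _ (_ ++ X)]cat1s.
exact: teq_catCA.
Qed.

(** The linear span of the first components of [l], modulo null sets. The remainder [h] is an
    element of [Lp] and its coefficient [1] is written out so that [ten_linear] applies at each
    step. *)
Fixpoint in_span d (l : seq (Lp mu p * tensor mu p d)) (f : Lp mu p) : Prop :=
  if l is gG :: l' then exists c (h : Lp mu p),
    ae_eq mu setT f (fun x => c * gG.1 x + 1 * h x) /\ in_span l' h
  else ae_eq mu setT f (fun=> 0).

(** If [f] is a combination of the first components, a multiple of [F] can be added to each second
    component instead of keeping the term of [f] and [F]. This shortens the sum by one term. *)
Lemma ten_in_span d (l : seq (Lp mu p * tensor mu p d)) f : in_span l f ->
  forall F, exists2 l' : seq (Lp mu p * tensor mu p d), size l' = size l &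
    tensor_eq (ten f F ++ tens l) (tens l').
Proof.
elim: l f => [|[g G] l IH] f /=.
  move=> f0 F; exists [::] => //; rewrite cats0.
  (* Writing zero as a combination with both coefficients [0] lets multilinearity remove the
     term. *)
  have h : ae_eq mu setT f (fun x => 0 * f x + 0 * f x).
    by apply: filterS f0 => x + xT => /(_ xT) ->; rewrite mulr0 addr0.
  apply: (teq_trans (ten_linear F h)).
  rewrite -[X in tensor_eq _ X]cats0.
  by apply: teq_cat; exact: (ten_eq _ (tscale0 _)).
move=> [c [h [fgh lh]]] F.
have [l' sl' El'] := IH h lh (tscale 1 F).
exists ((g, tscale c F ++ G) :: l'); first by rewrite /= sl'.
apply: (teq_trans (t := (ten g (tscale c F) ++ ten h (tscale 1 F)) ++ tens ((g, G) :: l))).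
  by apply: teq_cat; [exact: ten_linear|exact: teq_refl].
rewrite /tens/= ten_cat -!catA; apply: teq_cat; first exact: teq_refl.
apply: (teq_trans (teq_catCA _ _ _)); apply: teq_cat => //.
exact: teq_refl.
Qed.

(** The coefficients depend on the second components because in the application they are quotients
    of the values of these tensors at one point. *)
Lemma in_spanP d (l : seq (Lp mu p * tensor mu p d)) (e : tensor mu p d -> R[i])
    (f : Lp mu p) :
  ae_eq mu setT f (fun x => \sum_(gG <- l) e gG.2 * gG.1 x) -> in_span l f.
Proof.
elim: l f => [|[g G] l IH] f /=.
  by apply: filterS => x + xT => /(_ xT) ->; rewrite big_nil.
move=> fE.
have Lh : CLfun mu p (fun x => \sum_(gG <- l) e gG.2 * gG.1 x).
  by apply: (CLfun_lincomb p1) => gG; exact: LpP.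
exists (e G), (MkLp Lh); split; last by apply: IH; exact: aeW.
by apply: filterS fE => x + xT => /(_ xT) ->; rewrite big_cons mul1r.
Qed.

Lemma ae_exists {dY} {Y : measurableType dY} (P : probability Y R) (Q : set Y) :
  {ae P, forall x, Q x} -> exists x, Q x.
Proof.
move=> [A [mA A0 QA]]; apply: contrapT => nQ.
have AT : A = setT.
  by apply/seteqP; split => // x _; apply: QA => /= Qx; apply: nQ; exists x.
have := probability_setT P; rewrite -AT A0 => /eqP.
by rewrite eq_sym onee_eq0.
Qed.

(* Induction on the order, then on the number of terms of [\sum_j f_j (x) F_j]:
   either [f_0] lies in the span of the other [f_j], or [F_0 = 0]. *)
Lemma tensor_fun_inj d (t : tensor mu p d) :
  {ae prob_pow mu d, forall x, tensor_fun t x = 0} -> tensor_eq t [::].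
Proof.
elim: d t => [|d IHd] t.
  move=> /ae_exists[x tx].
  (* There is only one family indexed by the empty set, so a tensor of order [0] reduces to one
     scalar, which is its value at [x]. *)
  pose u0 (i : 'I_0) : Lp mu p := match notF (ltn_ord i) with end.
  have : tensor_eq t [:: (\sum_(au <- t) au.1, u0)].
    elim: t {tx} => [|[a u] t IH].
      by rewrite big_nil; apply: teq_sym; exact: teq_zero.
    rewrite big_cons -cat1s (_ : u = u0); last by apply/funext => -[].
    apply: (teq_trans (teq_cat (teq_refl _) IH)).
    exact: teq_add.
  move=> /teq_trans; apply.
  rewrite (_ : \sum_(au <- t) _ = 0); first exact: teq_zero.
  by rewrite -[RHS]tx; apply: eq_bigr => au _; rewrite big_ord0 mulr1.
have main n (l : seq (Lp mu p * tensor mu p d)) : size l = n ->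
    {ae prob_pow mu d.+1, forall x, tensor_fun (tens l) x = 0} ->
    tensor_eq (tens l) [::].
  elim: n l => [|n IHn] [|[f F] l]//; first by move=> _ _; exact: teq_refl.
  move=> [sl] l0; have [lf|nlf] := pselect (in_span l f).
    have [l' sl' El'] := ten_in_span lf F.
    apply: (teq_trans El'); apply: IHn; first by rewrite sl'.
    apply: filterS2 (tensor_fun_eq El') l0 => x <-; exact.
  have F0 : tensor_eq F [::].
    (* For almost every [y] the relation holds for almost every [x]. If [F] did not vanish at such a
       [y], dividing by its value there would put [f] in the span of the other first components. *)
    apply: IHd; have := ae_prob_powS l0; apply: filterS => y hy.
    apply: contrapT => /eqP Fy; apply: nlf.
    apply: (@in_spanP _ _ (fun G => - (tensor_fun G y / tensor_fun F y))).
    apply: filterS hy => x + _; rewrite (tensor_fun_tens _ (x, y)) big_cons /= => h.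
    apply: (mulIf Fy); rewrite mulr_suml.
    have /eqP := h; rewrite addr_eq0 => /eqP ->.
    rewrite -sumrN; apply: eq_bigr => gG _.
    by field.
  have El : tensor_eq (tens ((f, F) :: l)) (tens l).
    rewrite -[X in tensor_eq _ X]cat0s.
    by apply: teq_cat; [exact: (ten_eq _ F0)|exact: teq_refl].
  apply: (teq_trans El); apply: IHn => //.
  by apply: filterS2 (tensor_fun_eq El) l0 => x <-; exact.
have -> : t = tens [seq (au.2 ord0, [:: (au.1, fun i => au.2 (lift ord0 i))]) | au <- t].
  elim: t => [//|[a u] t IH]; rewrite /tens/=; congr (_ :: _); last exact: IH.
  congr pair; apply/funext => i; rewrite /ocons_Lp.
  by case: unliftP => [j ->|->].
exact: main erefl.
Qed.

End injectivity.

(** * Lower bounds for the projective norm *)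

Lemma prod_powR {R : realType} I (s : seq I) (F : I -> R) r :
  (forall i, 0 <= F i) -> (\prod_(i <- s) F i) `^ r = \prod_(i <- s) (F i `^ r).
Proof.
move=> F0; elim: s => [|i s IH]; first by rewrite !big_nil powR1.
by rewrite !big_cons powRM ?IH// prodr_ge0.
Qed.

Section sublinear.
Context {dX} {X : measurableType dX} {R : realType}.
Variables (mu : probability X R) (p : R) (d : nat).
Context {dY} {Y : measurableType dY}.
Variables (P : probability Y R) (r K : R).
Hypothesis r1 : 1 <= r.
Variable Phi : tensor mu p d -> Y -> R.

(** A seminorm is presented as the [L_r] norm of a function-valued [Phi]: subadditivity is then
    checked pointwise, while congruent tensors need only give functions equal almost everywhere. *)
Record sublinear := {
  sublinear_ge0 : forall t y, 0 <= Phi t y ;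
  sublinear_measurable : forall t, measurable_fun setT (Phi t) ;
  sublinear_eq : forall s t, tensor_eq s t -> {ae P, forall y, Phi s y = Phi t y} ;
  sublinear_cat : forall s t y, Phi (s ++ t) y <= Phi s y + Phi t y ;
  sublinear_scale : forall a t y, Phi (tscale a t) y = cmod a * Phi t y ;
  sublinear_elementary : forall u,
    (Lnorm P r%:E (fun y => (Phi [:: (1, u)] y)%:E) <=
     (K * \prod_(i < d) Lp_norm (u i))%:E)%E }.

Hypothesis HPhi : sublinear.

Local Notation q t := (Lnorm P r%:E (fun y => (Phi t y)%:E)).

Let r0 : 0 < r. Proof. exact: lt_le_trans r1. Qed.

Lemma Lnorm_sublinear_cat s t : (q (s ++ t) <= q s + q t)%E.
Proof.
apply: le_trans (@minkowski_EFin _ _ _ P (Phi s) (Phi t) r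
  (sublinear_measurable HPhi s) (sublinear_measurable HPhi t) r1).
apply: Lnorm_le => //.
- exact: sublinear_measurable.
- by apply: measurable_funD; exact: sublinear_measurable.
- apply: aeW => y; have := sublinear_ge0 HPhi.
  move=> h; rewrite !ger0_norm ?addr_ge0 ?h//; exact: sublinear_cat.
Qed.

Lemma Lnorm_sublinear_scale a t : q (tscale a t) = ((cmod a)%:E * q t)%E.
Proof.
rewrite -[in RHS](ger0_norm (cmod_ge0 a)) -Lnorm_scale//; last first.
  exact: sublinear_measurable.
by apply: eq_Lnorm => y; rewrite (sublinear_scale HPhi).
Qed.

Lemma Lnorm_sublinear_eq s t : tensor_eq s t -> q s = q t.
Proof.
move=> st; apply: ae_eq_Lnorm => //; try exact: sublinear_measurable.
by have := sublinear_eq HPhi st; apply: filterS => y ->.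
Qed.

Lemma Lnorm_sublinear_lty t : (q t < +oo)%E.
Proof.
elim: t => [|[a u] t IH].
  have := Lnorm_sublinear_scale 0 [::]; rewrite /= cmod0 mul0e => ->.
  exact: ltry.
have -> : (a, u) :: t = tscale a [:: (1, u)] ++ t by rewrite /= mulr1.
apply: (le_lt_trans (Lnorm_sublinear_cat _ _)); rewrite lte_add_pinfty//.
rewrite Lnorm_sublinear_scale lte_mul_pinfty ?lee_fin ?cmod_ge0//.
by apply: (le_lt_trans (sublinear_elementary HPhi u)); exact: ltry.
Qed.

Definition snorm t : R := fine (q t).

Lemma snormE t : (snorm t)%:E = q t.
Proof. by rewrite fineK// ge0_fin_numE ?Lnorm_ge0// Lnorm_sublinear_lty. Qed.

Lemma snorm_ge0 t : 0 <= snorm t.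
Proof. by rewrite fine_ge0// Lnorm_ge0. Qed.

Lemma snorm_eq s t : tensor_eq s t -> snorm s = snorm t.
Proof. by move=> st; rewrite /snorm (Lnorm_sublinear_eq st). Qed.

Lemma snorm_cat s t : snorm (s ++ t) <= snorm s + snorm t.
Proof. by rewrite -lee_fin EFinD !snormE; exact: Lnorm_sublinear_cat. Qed.

Lemma snorm_scale a t : snorm (tscale a t) = cmod a * snorm t.
Proof.
by apply: EFin_inj; rewrite EFinM !snormE; exact: Lnorm_sublinear_scale.
Qed.

Lemma snorm_elementary u : snorm [:: (1, u)] <= K * \prod_(i < d) Lp_norm (u i).
Proof. by rewrite -lee_fin snormE; exact: sublinear_elementary. Qed.

End sublinear.

Section projective_norm.
Context {dX} {X : measurableType dX} {R : realType}.
Variables (mu : probability X R) (p : R) (d : nat).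
Hypothesis p1 : 1 <= p.
Let p0 : 0 < p. Proof. exact: lt_le_trans p1. Qed.

Lemma Lnorm_elementary (u : 'I_d -> Lp mu p) :
  CLnorm (prob_pow mu d) p (tensor_fun [:: (1, u)]) =
  (\prod_(i < d) Lp_norm (u i))%:E.
Proof.
pose c i := fine (\int[mu]_x ((cmod (u i x)) `^ p)%:E)%E.
have iE i : (\int[mu]_x ((cmod (u i x)) `^ p)%:E = (c i)%:E)%E.
  rewrite fineK// ge0_fin_numE.
    have := Lnorm_lty p0 (LpP (u i)).2.
    by under eq_integral do rewrite ger0_norm ?cmod_ge0//.
  by apply: integral_ge0 => x _; rewrite lee_fin powR_ge0.
have c0 i : 0 <= c i.
  by rewrite fine_ge0// integral_ge0// => x _; rewrite lee_fin powR_ge0.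
have nE i : Lp_norm (u i) = c i `^ p^-1.
  rewrite /Lp_norm /CLnorm unlock fine_poweR; congr (fine _ `^ _).
  apply: eq_integral => x _.
  by rewrite abse_EFin poweR_EFin ger0_norm ?cmod_ge0.
rewrite /CLnorm unlock (eq_bigr _ (fun i _ => nE i)) -prod_powR// -poweR_EFin.
rewrite -(@ge0_integral_prod _ _ _ mu d (fun i x => cmod (u i x) `^ p))//.
- congr (_ `^ _)%E; apply: eq_integral => z _.
  rewrite abse_EFin poweR_EFin; congr EFin.
  rewrite /tensor_fun big_seq1 mul1r cmod_prod ger0_norm ?prodr_ge0//.
    by rewrite prod_powR// => i; exact: cmod_ge0.
  by move=> i _; exact: cmod_ge0.
- move=> i; apply: (measurableT_comp (measurable_powR _)).
  by apply: measurable_cmod; exact: (LpP (u i)).1.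
- by move=> i x; exact: powR_ge0.
Qed.

Lemma sublinear_J : sublinear (prob_pow mu d) p 1
  (fun (t : tensor mu p d) x => cmod (tensor_fun t x)).
Proof.
split.
- by move=> *; exact: cmod_ge0.
- by move=> t; apply: measurable_cmod; exact: cmeasurable_tensor_fun.
- by move=> s t /tensor_fun_eq; apply: filterS => x ->.
- move=> s t y; apply: le_trans (cmodD _ _).
  by rewrite /tensor_fun big_cat.
- move=> a t y; rewrite -cmodM; congr cmod.
  exact: (tensor_eval_scale (fun i (u : Lp mu p) x => u (tnth x i))).
- by move=> u; rewrite mul1r -Lnorm_elementary.
Qed.

Let Jnorm := snorm (prob_pow mu d) p
  (fun (t : tensor mu p d) x => cmod (tensor_fun t x)).

Lemma Jnorm_elementary u : Jnorm [:: (1, u)] = \prod_(i < d) Lp_norm (u i).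
Proof.
by apply: EFin_inj; rewrite (snormE p1 sublinear_J); exact: Lnorm_elementary.
Qed.

Lemma Jnorm_eq0 t : Jnorm t = 0 -> tensor_eq t [::].
Proof.
move=> t0; apply: (tensor_fun_inj p1).
have : CLnorm (prob_pow mu d) p (tensor_fun t) = 0%E.
  apply: (etrans (esym (snormE p1 sublinear_J t))).
  by rewrite -/Jnorm t0.
move/Lnorm_eq0_eq0 => /(_ _ _)[].
- apply/measurable_EFinP; apply: measurable_cmod; exact: cmeasurable_tensor_fun.
- by rewrite lte_fin.
- move=> N [mN N0 h]; exists N; split => // x nx; apply: h => /= /(_ I) [] e.
  by apply: nx; exact: cmod_eq0.
Qed.

(* Taking the maximum with [Jnorm] turns a seminorm that is small on elementary
   tensors into a cross norm, which is below the largest one. *)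
Lemma le_projective_norm {dY} {Y : measurableType dY} (P : probability Y R)
    (r K : R) (Phi : tensor mu p d -> Y -> R) : 1 <= r -> 0 < K ->
  sublinear P r K Phi ->
  forall t, (Lnorm P r%:E (fun y => (Phi t y)%:E) <= (K * projective_norm t)%:E)%E.
Proof.
move=> r1 K0 HPhi t.
have JJ := sublinear_J.
pose beta s := Num.max (Jnorm s) (K^-1 * snorm P r Phi s).
have K0' : 0 <= K^-1 by rewrite invr_ge0 ltW.
suff cb : cross_norm beta.
  rewrite -(snormE r1 HPhi) lee_fin -ler_pdivrMl//.
  apply: le_trans (cross_norm_le t cb).
  by rewrite /beta le_max lexx orbT.
split.
- move=> s s' ss'; rewrite /beta.
  by rewrite (snorm_eq r1 HPhi ss') /Jnorm (snorm_eq p1 JJ ss').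
- move=> s bs; apply: Jnorm_eq0; apply/eqP; rewrite eq_le snorm_ge0 andbT.
  by rewrite -bs /beta le_max lexx.
- move=> s s'; rewrite /beta ge_max; apply/andP; split.
    apply: le_trans (snorm_cat p1 JJ _ _) _.
    by apply: lerD; rewrite le_max lexx.
  apply: le_trans (ler_wpM2l K0' (snorm_cat r1 HPhi _ _)) _.
  by rewrite mulrDr; apply: lerD; rewrite le_max lexx orbT.
- move=> a s; rewrite /beta /Jnorm (snorm_scale p1 JJ) (snorm_scale r1 HPhi).
  by rewrite mulrCA maxr_pMr// cmod_ge0.
- move=> u; rewrite /beta Jnorm_elementary; apply/max_idPl.
  by rewrite ler_pdivrMl//; exact: snorm_elementary.
Qed.

End projective_norm.

(** * Maximal ergodic theorem *)

Lemma measurable_gt_set {d} {Y : measurableType d} {R : realType} (c : R)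
  (f : Y -> R) : measurable_fun [set: Y] f -> measurable [set x | c < f x].
Proof.
move=> mf; rewrite (_ : [set x | _] = setT `&` f @^-1` `]c, +oo[%classic).
  exact: (mf measurableT _ (measurable_itv _)).
by apply/seteqP; split => x /=; rewrite in_itv/= andbT // => -[].
Qed.

Section measure_preserving.
Context {dX} {X : measurableType dX} {R : realType}.
Variables (mu : probability X R) (T : {mfun X >-> X}).
Hypothesis Tmp : measure_preserving mu T.

Lemma ge0_integral_iter k (h : X -> \bar R) : measurable_fun [set: X] h ->
  (forall x, 0 <= h x)%E -> (\int[mu]_x h (iter k T x) = \int[mu]_x h x)%E.
Proof.
move=> mh h0.
have hE := ge0_integral_pushforward (measurable_iter T k) mu measurableT mh
  (fun y _ => h0 y).
rewrite preimage_setT in hE; rewrite -[LHS]hE.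
apply: eq_measure_integral => [|mk A mA _]; first exact: measurable_iter.
exact: (iter_measure_preserving Tmp k mA).
Qed.

Lemma integrable_iter k (f : X -> R) : mu.-integrable setT (EFin \o f) ->
  mu.-integrable setT (EFin \o (fun x => f (iter k T x))).
Proof.
move=> /integrableP[mf fi]; apply/integrableP; split.
  exact: (measurableT_comp mf (measurable_iter T k)).
rewrite (ge0_integral_iter k (h := fun x => `|(f x)%:E|%E))//.
exact: measurableT_comp.
Qed.

Lemma integral_iter k (f : X -> R) : mu.-integrable setT (EFin \o f) ->
  (\int[mu]_x (f (iter k T x))%:E = \int[mu]_x (f x)%:E)%E.
Proof.
move=> fi; have mf : measurable_fun setT (EFin \o f) by case/integrableP: fi.
have := integral_pushforward (measurable_iter T k) mf (mu := mu) (D := setT).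
rewrite preimage_setT => /(_ (integrable_iter k fi) measurableT) hE.
apply: (etrans (esym hE)).
apply: eq_measure_integral => [|mk A mA _]; first exact: measurable_iter.
exact: (iter_measure_preserving Tmp k mA).
Qed.

(** The general codomain lets real and complex functions share the definition. *)
Definition birkhoff_sum (A : nmodType) (f : X -> A) n x := \sum_(0 <= k < n) f (iter k T x).

(* This is [max_(n <= N) birkhoff_sum f n x], by the recursion on which both the
   maximal ergodic theorem and Birkhoff's theorem rely. *)
Fixpoint maximal_sum (f : X -> R) N x : R :=
  if N is N'.+1 then Num.max 0 (f x + maximal_sum f N' (T x)) else 0.

Lemma birkhoff_sumS (A : nmodType) (f : X -> A) n x :
  birkhoff_sum f n.+1 x = f x + birkhoff_sum f n (T x).
Proof.
rewrite /birkhoff_sum big_nat_recl//; congr (_ + _).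
by apply: eq_bigr => k _; rewrite -iterSr.
Qed.

Lemma maximal_sum_ge0 f N x : 0 <= maximal_sum f N x.
Proof. by case: N => //= N; rewrite le_max lexx. Qed.

Lemma maximal_sum_le f N x : maximal_sum f N x <= maximal_sum f N.+1 x.
Proof.
elim: N x => [|N IH] x; first exact: maximal_sum_ge0.
rewrite [leLHS]/=; rewrite ge_max maximal_sum_ge0/=.
by rewrite le_max; apply/orP; right; rewrite lerD2l; exact: IH.
Qed.

Lemma maximal_sum_homo f x : {homo maximal_sum f ^~ x : m n / (m <= n)%N >-> m <= n}.
Proof. by apply: homo_leq => [//|y z w|N]; [exact: le_trans|exact: maximal_sum_le]. Qed.

Lemma birkhoff_sum_le f N n x : (n <= N)%N ->
  birkhoff_sum f n x <= maximal_sum f N x.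
Proof.
elim: n N x => [|n IH] [|N] x // nN.
- by rewrite /birkhoff_sum big_geq.
- by rewrite /birkhoff_sum big_geq// maximal_sum_ge0.
- by rewrite birkhoff_sumS/= le_max lerD2l IH// orbT.
Qed.

Lemma measurable_maximal_sum f N : measurable_fun [set: X] f ->
  measurable_fun [set: X] (maximal_sum f N).
Proof.
move=> mf; elim: N => [|N IH]; first exact: measurable_cst.
apply: (measurable_maxr (measurable_cst _)); apply: measurable_funD => //.
exact: (measurableT_comp IH (measurable_iter T 1)).
Qed.

Lemma integrable_maximal_sum f N : mu.-integrable setT (EFin \o f) ->
  mu.-integrable setT (EFin \o maximal_sum f N).
Proof.
move=> fi; elim: N => [|N IH]; first exact: integrable0.
have mf : measurable_fun setT f by apply/measurable_EFinP; case/integrableP: fi.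
apply: (le_integrable measurableT _ _ (integrableD measurableT fi (integrable_iter 1 IH))).
  by apply/measurable_EFinP; exact: measurable_maximal_sum.
move=> x _; rewrite -EFinD lee_fin ger0_norm ?maximal_sum_ge0//=.
by rewrite ge_max normr_ge0/= ler_norm.
Qed.

(** Garsia's argument, with [F] for [maximal_sum T f N]. Where [F > 0], the recursion and
    monotonicity in [N] give [F - F \o T <= f]; elsewhere [F = 0] and [F - F \o T <= 0]. Invariance
    of [mu] makes the integral of [F - F \o T] zero. *)
Lemma maximal_ergodic f N : mu.-integrable setT (EFin \o f) ->
  (0 <= \int[mu]_(x in [set x | (0 < maximal_sum f N x)%R]) (f x)%:E)%E.
Proof.
move=> fi; set E := [set x | _].
have iN := integrable_maximal_sum N fi.
have iNT := integrable_iter 1 iN.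
have mf : measurable_fun setT f by apply/measurable_EFinP; case/integrableP: fi.
have mN := measurable_maximal_sum N mf.
have mE : measurable E.
  exact: measurable_gt_set.
have -> : (0 = \int[mu]_x ((maximal_sum f N x)%:E - (maximal_sum f N (T x))%:E))%E.
  rewrite integralB//= (integral_iter 1 iN) subee//.
  exact: integrable_fin_num.
rewrite [leRHS]integral_mkcond; apply: le_integral => //.
- exact: integrableB.
- by apply/(integrable_mkcond _ mE); exact: integrableS fi.
- move=> x _; rewrite /patch; case: ifPn => xE.
    rewrite -EFinB lee_fin lerBlDr.
    move: xE; rewrite inE /E/=; case: (N) => [|n]/=; first by rewrite ltxx.
    rewrite lt_max ltxx/= => h; rewrite max_r ?(ltW h)//.
    by rewrite lerD2l maximal_sum_le.
  rewrite -EFinB lee_fin subr_le0.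
  have : maximal_sum f N x <= 0.
    by move: xE; rewrite notin_setE /E/= => /negP; rewrite -leNgt.
  by move=> /le_trans; apply; exact: maximal_sum_ge0.
Qed.

(* Only the values of [f] above [l / 2] count: this form of the weak type
   inequality can be summed over dyadic levels [l]. *)
Lemma weak_maximal (f : X -> R) N (l : R) : 0 < l -> (forall x, 0 <= f x) ->
  mu.-integrable setT (EFin \o f) ->
  ((l / 2)%R%:E *
     mu [set x | exists2 n, (n <= N)%N & (n%:R * l < birkhoff_sum f n x)%R] <=
   \int[mu]_(x in [set x | (l / 2 < f x)%R]) (f x)%:E)%E.
Proof.
move=> l0 f0 fi.
have mf : measurable_fun setT f by apply/measurable_EFinP; case/integrableP: fi.
pose g x := f x - l.
have gi : mu.-integrable setT (EFin \o g).
  rewrite (_ : EFin \o g = (EFin \o f) \- (EFin \o cst l))%E//.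
  by apply: integrableB => //; exact: finite_measure_integrable_cst.
have := maximal_ergodic N gi; set E := [set x | 0 < _] => E0.
set B := [set x | exists2 n, _ & _].
have mg := measurable_funB mf (measurable_cst l).
have mE : measurable E.
  by apply: measurable_gt_set; exact: measurable_maximal_sum.
set C := [set x | l / 2 < f x].
have mC : measurable C.
  exact: measurable_gt_set.
have BE : B `<=` E.
  move=> x [n nN h]; rewrite /E/=; apply: lt_le_trans (birkhoff_sum_le _ _ nN).
  rewrite /birkhoff_sum /g big_split/= sumr_const_nat subn0 mulNrn subr_gt0.
  by rewrite mulr_natl in h.
have mB : measurable B.
  rewrite (_ : B = \bigcup_(n in [set n | (n <= N)%N]) [set x | n%:R * l < birkhoff_sum f n x]).
    apply: bigcup_measurable => n _; apply: measurable_gt_set.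
    apply: measurable_sum => k; exact: (measurableT_comp mf (measurable_iter T k)).
  by apply/seteqP; split => x /= [n ? ?]; exists n.
apply: (@le_trans _ _ ((l / 2)%R%:E * mu E)%E).
  by rewrite lee_pmul2l ?lte_fin ?divr_gt0// le_measure ?inE.
(* Giving back half of the subtracted level leaves [f - l / 2] on [E], which is at most [f] on [C]
   and nonpositive outside [C]. *)
have key : (\int[mu]_(x in E) (g x)%:E + (l / 2)%R%:E * mu E <= \int[mu]_(x in C) (f x)%:E)%E.
  rewrite -integral_cst// -integralD//; first last.
  - exact: finite_measure_integrable_cst.
  - exact: integrableS gi.
  rewrite [leLHS]integral_mkcond [leRHS]integral_mkcond.
  apply: le_integral => //.
  - apply/(integrable_mkcond _ mE); apply: integrableD => //.
      exact: integrableS gi.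
    exact: finite_measure_integrable_cst.
  - by apply/(integrable_mkcond _ mC); exact: integrableS fi.
  - move=> x _; rewrite /patch.
    case: ifPn => _; case: ifPn; rewrite /= ?lexx ?lee_fin //.
      by move=> _; rewrite /g; lra.
    by rewrite notin_setE /C/= => /negP; rewrite -leNgt /g; lra.
apply: le_trans key; by rewrite leeDr.
Qed.

End measure_preserving.

(** * Birkhoff's theorem *)

Section birkhoff.
Context {dX} {X : measurableType dX} {R : realType}.
Variables (mu : probability X R) (T : {mfun X >-> X}).
Hypotheses (Tmp : measure_preserving mu T) (Terg : ergodic mu T).

(* The set [E] where the maximal sums [F_N] are unbounded is invariant. If it had
   full measure, the functions [F_(N+1) - F_N \o T], which have nonnegative
   integrals, would converge to [f] under the bound [|f|]. *)
Lemma ae_maximal_sum_bounded (f : X -> R) :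
  mu.-integrable setT (EFin \o f) -> (\int[mu]_x (f x)%:E < 0)%E ->
  {ae mu, forall x, exists M, forall N, maximal_sum T f N x <= M}.
Proof.
move=> fi f0.
have mf : measurable_fun setT f by apply/measurable_EFinP; case/integrableP: fi.
pose E := \bigcap_(m in [set: nat]) \bigcup_(N in [set: nat])
  [set x | m%:R < maximal_sum T f N x].
have mE : measurable E.
  apply: bigcap_measurableType => m _; apply: bigcup_measurable => N _.
  by apply: measurable_gt_set; exact: measurable_maximal_sum.
have EP x : E x <-> forall M, exists N, M < maximal_sum T f N x.
  split=> [Ex M|h m _]; last by have [N hN] := h m%:R; exists N.
  have [N _ hN] := Ex (Num.truncn `|M|).+1 I; exists N.
  apply: lt_trans hN; apply: le_lt_trans (ler_norm M) _.
  exact: truncnS_gt.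
have TE : T @^-1` E = E.
  apply/seteqP; split => x.
    move=> /EP h; apply/EP => M; have [N hN] := h (M - f x).
    by exists N.+1; rewrite /= lt_max; apply/orP; right; rewrite -ltrBlDl.
  move=> /EP h; apply/EP => M.
  (* Exceeding [0] excludes [N = 0] and selects the second argument of the maximum in the recursion;
     exceeding [M + f x] then leaves more than [M] at [T x]. *)
  have [[|N]] := h (Num.max 0 (M + f x)).
    by rewrite /= gt_max ltxx.
  rewrite /= gt_max => /andP[h1 h2]; exists N.
  move: h1; rewrite lt_max ltxx /= => h1.
  by move: h2; rewrite lt_max => /orP[]; lra.
have [E0|E1] := Terg mE TE.
  exists E; split => // x /= nh; apply/EP => M; apply: contrapT => hM.
  apply: nh; exists M => N; rewrite leNgt; apply/negP => h.
  by apply: hM; exists N.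
have aeE : {ae mu, forall x, E x}.
  exists (~` E); split => //; first exact: measurableC.
  by rewrite probability_setC// E1 subee.
exfalso; move: f0; apply/negP; rewrite -leNgt.
pose h N x := ((maximal_sum T f N.+1 x)%:E - (maximal_sum T f N (T x))%:E)%E.
have iN N := integrable_maximal_sum Tmp N fi.
have iNT N := integrable_iter Tmp 1 (iN N).
have [|||||_ _ cv] := @dominated_convergence _ X R mu setT measurableT h
  (EFin \o f) (fun x => `|(f x)%:E|%E).
- move=> N; apply: emeasurable_funB; first by case/integrableP: (iN N.+1).
  by case/integrableP: (iNT N).
- by case/integrableP: fi.
- apply: filterS aeE => x Ex _.
  (* Once the maximal sum at [T x] exceeds [- f x], the recursion takes its second argument and
     [h N x] equals [f x] exactly. *)
  have /EP/(_ (- f x))[N0 hN0] : E (T x) by move: Ex; rewrite -{1}TE.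
  apply: cvg_near_cst; exists N0 => // N /= N0N.
  rewrite /h -EFinB /= max_r; first by rewrite addrK.
  have := maximal_sum_homo T f (T x) N0N; lra.
- exact: integrable_abse.
(* With [F] the maximal sum at [T x]: either [f x + F >= 0] and the difference is [f x], or it is
   [- F] with [0 <= F < - f x]. *)
- apply: aeW => x N _; rewrite /h -EFinB lee_fin /=.
  have := maximal_sum_ge0 T f N (T x); set F := maximal_sum _ _ _ _ => F0.
  have [h1|h1] := leP 0 (f x + F).
    by rewrite addrK.
  by rewrite sub0r normrN ger0_norm// ler_normr; apply/orP; right; lra.
rewrite -(cvg_lim _ cv)//; apply: lime_ge; first exact: cvgP cv.
apply: nearW => N /=; rewrite /h integralB//; [|exact: (iN N.+1)|exact: iNT].
rewrite (integral_iter Tmp 1 (iN N)).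
have fN : (\int[mu]_x (maximal_sum T f N x)%:E)%E \is a fin_num.
  exact: (integrable_fin_num measurableT (iN N)).
rewrite sube_ge0; last by rewrite fN.
apply: le_integral => [//|||x _]; [exact: iN|exact: (iN N.+1)|].
by rewrite lee_fin maximal_sum_le.
Qed.

(** Subtracting the integral plus [e] from [f] gives a function of integral [- e], whose Birkhoff
    sums are bounded above at almost every point. *)
Lemma ae_birkhoff_sum_le (f : X -> R) (e : R) : 0 < e ->
  mu.-integrable setT (EFin \o f) ->
  {ae mu, forall x, exists M, forall n,
    birkhoff_sum T f n x <= n%:R * (\int[mu]_y f y + e) + M}.
Proof.
move=> e0 fi; set a := Rintegral _ _ _.
have ci : mu.-integrable setT (EFin \o cst (a + e)).
  exact: finite_measure_integrable_cst.
pose g x := f x - (a + e).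
have gE : EFin \o g = ((EFin \o f) \- (EFin \o cst (a + e)%R))%E by [].
have gi : mu.-integrable setT (EFin \o g) by rewrite gE; exact: integrableB.
have g0 : (\int[mu]_x (g x)%:E < 0)%E.
  rewrite [ltLHS](_ : _ = \int[mu]_x ((EFin \o f) \- (EFin \o cst (a + e)%R))%E x)%E//.
  rewrite integralB//= integral_probability_cst.
  rewrite -(fineK (integrable_fin_num measurableT fi)) -EFinB lte_fin.
  by rewrite -/(Rintegral _ _ _) -/a; lra.
have := ae_maximal_sum_bounded gi g0; apply: filterS => x [M hM].
exists M => n; have := le_trans (birkhoff_sum_le T g x (leqnn n)) (hM n).
rewrite /birkhoff_sum /g big_split/= sumr_const_nat subn0 mulNrn -mulr_natl.
lra.
Qed.

(** In the application [x] is [n] times the integral, [s] the Birkhoff sum, [c] the error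
    [n / (m + 1)], the [b]'s are the pointwise constants and [h] is [n * (e / 2)]. *)
Let sandwich (x s c b1 b2 b h : R) : b1 <= b -> b2 <= b -> b <= h -> c <= h ->
  s <= x + c + b1 -> - s <= - x + c + b2 -> `|x - s| <= h + h.
Proof. by move=> *; rewrite ler_norml; apply/andP; split; lra. Qed.

(** The one-sided bound is applied to [f] and to [- f]. The errors [1 / (m + 1)] keep the
    exceptional sets countable in number, and the constants depending on the point disappear after
    division by [n]. *)
Lemma birkhoff (f : X -> R) : mu.-integrable setT (EFin \o f) ->
  {ae mu, forall x, n%:R^-1 * birkhoff_sum T f n x @[n --> \oo] --> \int[mu]_y f y}.
Proof.
move=> fi.
have fNi : mu.-integrable setT (EFin \o (fun x => - f x)).
  by apply: integrableN fi.
have aN : \int[mu]_x (- f x) = - \int[mu]_x f x.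
  rewrite -mulN1r -RintegralZl//; apply: eq_Rintegral => x _.
  by rewrite mulN1r.
have up := ae_foralln (fun m => ae_birkhoff_sum_le (e := m.+1%:R^-1) ltac:(by rewrite invr_gt0) fi).
have dn := ae_foralln (fun m => ae_birkhoff_sum_le (e := m.+1%:R^-1) ltac:(by rewrite invr_gt0) fNi).
apply: filterS2 up dn => x up dn; set a := Rintegral _ _ _.
apply/cvgrPdist_le => e e0.
pose m := Num.truncn (2 / e).
have me : m.+1%:R^-1 <= e / 2.
  have h : 2 / e < m.+1%:R by exact: truncnS_gt.
  by rewrite -(invf_div 2) lef_pV2 ?posrE ?divr_gt0// ltW.
have [M1 h1] := up m; have [M2 h2] := dn m.
pose M := Num.max `|M1| `|M2|.
have M_ge0 : 0 <= M by rewrite le_max normr_ge0.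
have hM1 : M1 <= M by rewrite (le_trans (ler_norm _))// le_max lexx.
have hM2 : M2 <= M by rewrite (le_trans (ler_norm _))// le_max lexx orbT.
exists (Num.truncn (2 * M / e)).+1 => // n /= nN.
have n0 : 0 < n%:R :> R by rewrite ltr0n (leq_trans _ nN).
have nM : 2 * M / e < n%:R.
  by apply: (lt_le_trans (truncnS_gt _)); rewrite ler_nat.
have {}nM : M <= n%:R * (e / 2).
  by move: nM; rewrite ltr_pdivrMr// => nM; lra.
have {}me : n%:R * m.+1%:R^-1 <= n%:R * (e / 2) by rewrite ler_pM2l.
have {}h1 := h1 n; have {}h2 := h2 n.
rewrite aN (_ : birkhoff_sum T (fun x => - f x) n x = - birkhoff_sum T f n x) in h2; last first.
  by rewrite /birkhoff_sum sumrN.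
have -> : a - n%:R^-1 * birkhoff_sum T f n x = n%:R^-1 * (n%:R * a - birkhoff_sum T f n x).
  by rewrite mulrBr mulrA mulVf ?gt_eqF// mul1r.
rewrite normrM ger0_norm ?invr_ge0 ?ler0n// ler_pdivrMl//.
rewrite -/a in h1 h2.
rewrite !mulrDr mulrN in h1 h2.
have -> : n%:R * e = n%:R * (e / 2) + n%:R * (e / 2) by rewrite -mulrDr -splitr.
exact: (sandwich hM1 hM2 nM me h1 h2).
Qed.

Definition birkhoff_avg (u : X -> R[i]) n x : R[i] := n%:R^-1 * birkhoff_sum T u n x.

Lemma birkhoff_complex (u : X -> R[i]) : cintegrable mu u ->
  {ae mu, forall x, cmod (birkhoff_avg u n x - Cintegral mu u) @[n --> \oo] --> (0 : R)}.
Proof.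
move=> [ui1 ui2]; apply: filterS2 (birkhoff ui1) (birkhoff ui2) => x h1 h2.
have E n : birkhoff_avg u n x = Complex (n%:R^-1 * birkhoff_sum T (fun y => complex.Re (u y)) n x)
    (n%:R^-1 * birkhoff_sum T (fun y => complex.Im (u y)) n x).
  have -> : birkhoff_avg u n x = (n%:R^-1 : R)%:C%C * birkhoff_sum T u n x.
    by rewrite /birkhoff_avg fmorphV rmorph_nat.
  have RE : complex.Re (birkhoff_sum T u n x) = birkhoff_sum T (fun y => complex.Re (u y)) n x.
    by rewrite /birkhoff_sum; apply: (big_morph (@complex.Re R) (@cReD R)).
  have IE : complex.Im (birkhoff_sum T u n x) = birkhoff_sum T (fun y => complex.Im (u y)) n x.
    by rewrite /birkhoff_sum; apply: (big_morph (@complex.Im R) (@cImD R)).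
  by apply/eqP; rewrite eq_complex cReM cImM RE IE /= !mul0r subr0 addr0 !eqxx.
apply: (@squeeze_cvgr _ _ _ _ (fun=> 0) (fun n =>
   `|n%:R^-1 * birkhoff_sum T (fun y => complex.Re (u y)) n x - \int[mu]_y complex.Re (u y)| +
   `|n%:R^-1 * birkhoff_sum T (fun y => complex.Im (u y)) n x - \int[mu]_y complex.Im (u y)|)).
- apply: nearW => n; rewrite cmod_ge0 E /=.
  exact: cmod_Complex.
- exact: cvg_cst.
- have h (v : nat -> R) (l : R) : v n @[n --> \oo] --> l -> `|v n - l| @[n --> \oo] --> (0 : R).
    move=> vl; rewrite -(normr0 R) -(subrr l); apply: cvg_norm; apply: cvgB => //.
    exact: cvg_cst.
  by rewrite -[X in _ --> X]addr0; apply: cvgD; exact: h.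
Qed.

End birkhoff.

(** * Maximal inequality in L_p *)

Section dyadic.
Context {R : realType}.
Variable p : R.
Hypothesis p2 : 2 <= p.
Implicit Types y w : R.

Local Notation c j := (((2 : R) ^+ j) `^ (p - 1)).

(** The ratio is the power [p - 1] of [2], which is at least [2] because [p >= 2]; so partial sums
    are at most twice their last term. *)
Let cS j : 2 * c j <= c j.+1.
Proof.
rewrite exprS powRM ?exprn_ge0// ler_wpM2r ?powR_ge0//.
rewrite -[leLHS]powRr1//; apply: ler_powR; first by rewrite ler1n.
by move: p2; lra.
Qed.

Let csum n : \sum_(0 <= j < n.+1) c j <= 2 * c n.
Proof.
elim: n => [|n IH].
  by rewrite big_nat1 ler_peMl ?powR_ge0// ler1n.
rewrite big_nat_recr//= mulr_natl mulr2n lerD//.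
exact: le_trans IH (cS n).
Qed.

Lemma dyadic_sum_le y n : 0 <= y ->
  \sum_(0 <= j < n) c j * (2 ^+ j < y)%R%:R <= 2 * y `^ (p - 1).
Proof.
move=> y0; elim: n => [|n IH]; first by rewrite big_geq// mulr_ge0// powR_ge0.
have [ny|ny] := ltP (2 ^+ n) y; last first.
  by rewrite big_nat_recr//= ltNge ny/= mulr0 addr0.
apply: (@le_trans _ _ (\sum_(0 <= j < n.+1) c j)).
  by apply: ler_sum => j _; rewrite ler_piMr ?powR_ge0// lern1 leq_b1.
apply: le_trans (csum n) _; rewrite ler_wpM2l//.
by apply: ge0_ler_powR; rewrite ?nnegrE ?exprn_ge0 ?(ltW ny)//; move: p2; lra.
Qed.

(** For [w > 1] the single term with [2 ^+ j < w <= 2 ^+ j.+1] already suffices; the summand [1]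
    covers [w <= 1]. *)
Lemma powR_le_dyadic w : 0 <= w ->
  ((w `^ p)%:E <= 1 + \sum_(j <oo) ((2 ^+ j.+1) `^ p * (2 ^+ j < w)%R%:R)%:E)%E.
Proof.
move=> w0.
have s0 (P : pred nat) : (0 <= \sum_(j <oo | P j) ((2 ^+ j.+1) `^ p * (2 ^+ j < w)%R%:R)%:E)%E.
  by apply: nneseries_ge0 => j _ _; rewrite lee_fin mulr_ge0// powR_ge0.
have [w1|w1] := leP w 1.
  apply: (@le_trans _ _ 1%E); last by rewrite leeDl.
  rewrite lee_fin [leRHS](_ : 1 = 1 `^ p); last by rewrite powR1.
  apply: ge0_ler_powR; rewrite ?nnegrE//.
  by move: p2; lra.
have ex : exists n, w <= 2 ^+ n.
  exists (Num.truncn w).+1; apply: ltW; apply: (lt_trans (truncnS_gt w)).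
  by rewrite -natrX ltr_nat ltn_expl.
case: (ex_minnP ex) => -[|j] jw jmin.
  by rewrite expr0 leNgt w1 in jw.
have jw' : 2 ^+ j < w by rewrite ltNge; apply/negP => /jmin; rewrite ltnn.
apply: (@le_trans _ _ (\sum_(0 <= i < j.+1) ((2 ^+ i.+1) `^ p * (2 ^+ i < w)%R%:R)%:E)%E).
  rewrite big_nat_recr//= jw' mulr1; apply: (@le_trans _ _ ((2 ^+ j.+1) `^ p)%:E).
    rewrite lee_fin; apply: ge0_ler_powR; rewrite ?nnegrE ?exprn_ge0//.
    by move: p2; lra.
  by rewrite leeDr// sume_ge0// => i _; rewrite lee_fin mulr_ge0// powR_ge0.
apply: (@le_trans _ _ (\sum_(i <oo) ((2 ^+ i.+1) `^ p * (2 ^+ i < w)%R%:R)%:E)%E).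
  by apply: nneseries_lim_ge => i _ _; rewrite lee_fin mulr_ge0// powR_ge0.
by rewrite leeDr.
Qed.

End dyadic.

Lemma measurable_bigmax {d} {Y : measurableType d} {R : realType} I (s : seq I)
  (F : I -> Y -> R) : (forall i, measurable_fun [set: Y] (F i)) ->
  measurable_fun [set: Y] (fun y => \big[Num.max/0]_(i <- s) F i y).
Proof.
move=> mF; elim: s => [|i s IH].
  by under eq_fun do rewrite big_nil; exact: measurable_cst.
by under eq_fun do rewrite big_cons; exact: measurable_maxr.
Qed.

Section maximal.
Context {dX} {X : measurableType dX} {R : realType}.
Variables (mu : probability X R) (T : {mfun X >-> X}).
Hypotheses (Tmp : measure_preserving mu T).
Variable p : R.
Hypothesis p2 : 2 <= p.
Let p0 : 0 < p. Proof. by move: p2; lra. Qed.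
Let p1 : 1 <= p. Proof. by move: p2; lra. Qed.

(** The term [n = 0] has the value [0], because [0^-1 = 0]. *)
Definition maximal_avg (f : X -> R) N x : R :=
  \big[Num.max/0]_(n < N) (n%:R^-1 * birkhoff_sum T f n x).

Lemma maximal_avg_ge f N n x : (n < N)%N ->
  n%:R^-1 * birkhoff_sum T f n x <= maximal_avg f N x.
Proof.
move=> nN; rewrite /maximal_avg (bigD1 (Ordinal nN))//=.
by rewrite le_max lexx.
Qed.

Lemma maximal_avg_ge0 f N x : 0 <= maximal_avg f N x.
Proof.
case: N => [|N]; first by rewrite /maximal_avg big_ord0.
by apply: le_trans (maximal_avg_ge f x (ltn0Sn N)); rewrite invr0 mul0r.
Qed.

Lemma maximal_avg_gt f N l x : 0 <= l -> l < maximal_avg f N x ->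
  exists2 n, (n <= N)%N & n%:R * l < birkhoff_sum T f n x.
Proof.
move=> l0; apply: contraPP => /forall2NP h; apply/negP; rewrite -leNgt.
apply: (@big_ind _ (fun z => z <= l)) => // [a b al bl|[n nN] _ /=].
  by rewrite ge_max al.
have [->|n0] := eqVneq n 0%N; first by rewrite invr0 mul0r.
have [/negP|/negP] := h n; first by rewrite -ltnNge => /ltn_trans /(_ nN); rewrite ltnn.
by rewrite -leNgt => hn; rewrite ler_pdivrMl// ltr0n lt0n.
Qed.

Lemma measurable_maximal_avg f N : measurable_fun [set: X] f ->
  measurable_fun [set: X] (maximal_avg f N).
Proof.
move=> mf; apply: measurable_bigmax => n.
apply: measurable_funM => //; apply: measurable_sum => k.
exact: (measurableT_comp mf (measurable_iter T k)).
Qed.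

Lemma maximal_avgZ a f N x : 0 <= a ->
  maximal_avg (fun y => a * f y) N x = a * maximal_avg f N x.
Proof.
move=> a0; rewrite /maximal_avg.
elim/big_ind2 : _ => [|y1 y2 z1 z2 -> ->|n _]; first by rewrite mulr0.
  by rewrite maxr_pMr.
by rewrite /birkhoff_sum -mulr_sumr mulrCA.
Qed.

(* The factors come from comparing [w `^ p] with its dyadic sum, from
   [weak_maximal] and from the geometric sum [dyadic_sum_le]. *)
Let C := 2 * 2 `^ p * (2 * 2 `^ (p - 1)).

(** Marcinkiewicz interpolation over dyadic levels: [a j] is the contribution of the level [2 ^+ j]
    to the maximal function, and the weak type inequality bounds its integral by that of [b j],
    which only involves [f]. The summand [1] stands for the values below the lowest level. *)
Lemma strong_maximal_nonhomogeneous (f : X -> R) N : (forall x, 0 <= f x) ->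
  mu.-integrable setT (EFin \o f) ->
  (\int[mu]_x (maximal_avg f N x `^ p)%:E <= 1 + C%:E * \int[mu]_x (f x `^ p)%:E)%E.
Proof.
move=> f0 fi.
have mf : measurable_fun setT f by apply/measurable_EFinP; case/integrableP: fi.
have mW := measurable_maximal_avg N mf.
pose a j x : R := (2 ^+ j.+1) `^ p * (2 ^+ j < maximal_avg f N x)%R%:R.
pose b j x : R := 2 * 2 `^ p * (f x * ((2 ^+ j) `^ (p - 1) * (2 ^+ j < 2 * f x)%R%:R)).
have a0 j x : 0 <= a j x by rewrite mulr_ge0// powR_ge0.
have b0 j x : 0 <= b j x by rewrite !mulr_ge0// powR_ge0.
have mind (c : R) (g : X -> R) : measurable_fun setT g ->
    measurable_fun setT (fun x => (c < g x)%R%:R : R).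
  move=> mg; rewrite (_ : (fun x => _) = \1_[set x | c < g x]).
    by apply: measurable_indic; exact: measurable_gt_set.
  by apply/funext => x; rewrite indicE; congr (nat_of_bool _)%:R; apply/idP/idP; rewrite inE.
have ma j : measurable_fun setT (fun x => (a j x)%:E).
  by apply/measurable_EFinP; apply: measurable_funM => //; exact: mind.
have mb j : measurable_fun setT (fun x => (b j x)%:E).
  apply/measurable_EFinP; apply: measurable_funM => //; apply: measurable_funM => //.
  apply: measurable_funM => //; apply: mind; exact: measurable_funM.
have ab j : (\int[mu]_x (a j x)%:E <= \int[mu]_x (b j x)%:E)%E.
  have := weak_maximal Tmp N (exprn_gt0 j (ltr0Sn R 1)) f0 fi.
  set A := [set x | exists2 n, _ & _]; set B := [set x | _ < f x] => hw.
  pose S := [set x | 2 ^+ j < maximal_avg f N x].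
  have mS : measurable S by exact: measurable_gt_set.
  have mB : measurable B by exact: measurable_gt_set.
  have mA : measurable A.
    rewrite (_ : A = \bigcup_(n in [set n | (n <= N)%N])
        [set x | n%:R * 2 ^+ j < birkhoff_sum T f n x]).
      apply: bigcup_measurable => n _; apply: measurable_gt_set.
      by apply: measurable_sum => k; exact: (measurableT_comp mf (measurable_iter T k)).
    by apply/seteqP; split => x /= [n ? ?]; exists n.
  (* The rest of the weight, [2 ^+ j / 2], is the factor in front of the measure in [weak_maximal]
     at level [2 ^+ j]. *)
  pose k := 2 * 2 `^ p * (2 ^+ j) `^ (p - 1).
  have k0 : 0 <= k by rewrite !mulr_ge0 ?powR_ge0.
  have kE : (2 ^+ j.+1) `^ p = k * (2 ^+ j / 2).
    rewrite exprS powRM ?exprn_ge0// /k.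
    rewrite -(@mulr_powRB1 _ (2 ^+ j) p) ?exprn_ge0//.
    by field.
  have aE : (\int[mu]_x (a j x)%:E = ((2 ^+ j.+1) `^ p)%:E * mu S)%E.
    rewrite -[X in mu X]setIT -integral_indic// -ge0_integralZl_EFin ?powR_ge0//.
      apply: eq_integral => x _; rewrite -EFinM; congr (_ * _)%:E.
      by rewrite indicE; congr (nat_of_bool _)%:R; apply/idP/idP; rewrite inE.
    by apply/measurable_EFinP; exact: measurable_indic.
  have bE : (\int[mu]_x (b j x)%:E = k%:E * \int[mu]_(x in B) (f x)%:E)%E.
    rewrite [X in (_ * X)%E]integral_mkcond -ge0_integralZl_EFin//.
    - apply: eq_integral => x _; rewrite /b /k /patch.
      have -> : (x \in B) = (2 ^+ j < 2 * f x).
        by apply/idP/idP; rewrite inE /B/= ltr_pdivrMr// mulrC.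
      by case: (2 ^+ j < 2 * f x); rewrite -EFinM; congr EFin => /=; ring.
    - by move=> x _; rewrite /patch; case: ifP => _; rewrite ?lee_fin.
    - by apply/(measurable_restrictT _ mB)/measurable_funTS/measurable_EFinP.
  rewrite aE bE kE EFinM -muleA; apply: lee_wpmul2l; first by rewrite lee_fin.
  apply: le_trans hw; apply: lee_wpmul2l; first by rewrite lee_fin divr_ge0// exprn_ge0.
  apply: le_measure; [by rewrite inE|by rewrite inE|move=> x hx].
  by apply: maximal_avg_gt hx; exact: exprn_ge0.
apply: (@le_trans _ _ (\int[mu]_x (1 + \sum_(j <oo) (a j x)%:E))%E).
  apply: ge0_le_integral => //.
  - by move=> x _; rewrite lee_fin powR_ge0.
  - by apply/measurable_EFinP; exact: (measurableT_comp (measurable_powR _)).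
  - apply: emeasurable_funD => //; apply: ge0_emeasurable_sum => // j x _ _.
    by rewrite lee_fin.
  - by move=> x _; apply: powR_le_dyadic => //; exact: maximal_avg_ge0.
rewrite ge0_integralD//; last 2 first.
- by move=> x _; apply: nneseries_ge0 => *; rewrite lee_fin.
- by apply: ge0_emeasurable_sum => // j x _ _; rewrite lee_fin.
rewrite integral_probability_cst leeD2l// integral_nneseries//; last first.
  by move=> *; rewrite lee_fin.
apply: (@le_trans _ _ (\sum_(j <oo) \int[mu]_x (b j x)%:E)%E).
  by apply: lee_nneseries => j _ // _; apply: integral_ge0 => *; rewrite lee_fin.
rewrite -integral_nneseries//; last by move=> *; rewrite lee_fin.
have mfp : measurable_fun setT (fun x => (f x `^ p)%:E).
  by apply/measurable_EFinP; exact: (measurableT_comp (measurable_powR _)).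
rewrite -ge0_integralZl//; last 2 first.
- by move=> x _; rewrite lee_fin powR_ge0.
- by rewrite lee_fin !mulr_ge0// powR_ge0.
apply: ge0_le_integral => //.
- by move=> x _; apply: nneseries_ge0 => *; rewrite lee_fin.
- by apply: ge0_emeasurable_sum => // j x _ _; rewrite lee_fin.
- exact: measurable_funeM.
move=> x _; apply: lime_le.
  by apply: is_cvg_nneseries => *; rewrite lee_fin.
apply: nearW => n; rewrite sumEFin -EFinM lee_fin -!mulr_sumr.
(* Taken at [2 * f x], the dyadic sum is bounded by a multiple of the power [p - 1] of [f x]; the
   factor [f x] of [b j] completes it to the power [p]. *)
have := dyadic_sum_le p2 n (mulr_ge0 (ler0n R 2) (f0 x)).
rewrite powRM// => h; rewrite /C -[leRHS]mulrA ler_wpM2l ?mulr_ge0 ?powR_ge0//.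
apply: (le_trans (ler_wpM2l (f0 x) h)).
by rewrite -(mulr_powRB1 (f0 x) p0) le_eqVlt; apply/orP; left; apply/eqP; ring.
Qed.

Definition maximal_cst : R := (1 + C) `^ p^-1.

Lemma maximal_cst_gt0 : 0 < maximal_cst.
Proof.
apply: powR_gt0; rewrite ltr_pwDl// !mulr_ge0// powR_ge0.
Qed.

(** Scaling by [s] reduces to norm at most [1], where the nonhomogeneous bound becomes [1 + C]. A
    positive bound [s] in place of the norm itself avoids dividing by zero. *)
Lemma strong_maximal (f : X -> R) N : (forall x, 0 <= f x) -> measurable_fun setT f ->
  forall s, 0 < s -> (Lnorm mu p%:E (fun x => (f x)%:E) <= s%:E)%E ->
  (Lnorm mu p%:E (fun x => (maximal_avg f N x)%:E) <= (maximal_cst * s)%:E)%E.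
Proof.
move=> f0 mf s s0 fs.
pose g x := s^-1 * f x.
have g0 x : 0 <= g x by rewrite mulr_ge0// invr_ge0 ltW.
have mg : measurable_fun setT g by exact: measurable_funM.
have gn : (Lnorm mu p%:E (fun x => (g x)%:E) <= 1%:E)%E.
  rewrite Lnorm_scale// ger0_norm ?invr_ge0 ?(ltW s0)//.
  by rewrite lee_pdivrMl// mule1.
have gi : mu.-integrable setT (EFin \o g).
  apply/integrableP; split; first exact/measurable_EFinP.
  apply: (le_lt_trans (integral_le_Lnorm mu p1 mg)).
  by apply: (le_lt_trans gn); exact: ltry.
have := strong_maximal_nonhomogeneous N g0 gi => hg.
have E : (fun x => (maximal_avg f N x)%:E) = (fun x => (s * maximal_avg g N x)%:E).
  apply/funext => x; rewrite -maximal_avgZ ?(ltW s0)//; congr (maximal_avg _ _ _)%:E.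
  by apply/funext => y; rewrite /g mulrA mulfV ?gt_eqF// mul1r.
rewrite E Lnorm_scale//; last exact: measurable_maximal_avg.
rewrite ger0_norm ?(ltW s0)// mulrC EFinM lee_pmul2l ?lte_fin//.
apply/Lnorm_leP => //; first exact: powR_ge0.
rewrite /maximal_cst -powRrM mulVf ?gt_eqF// powRr1; last by rewrite addr_ge0// !mulr_ge0// powR_ge0.
under eq_integral do rewrite ger0_norm ?maximal_avg_ge0//.
apply: (le_trans hg); rewrite EFinD leeD2l//.
rewrite -[leRHS]mule1 lee_wpmul2l ?lee_fin ?mulr_ge0 ?powR_ge0//.
have := (@Lnorm_leP _ _ _ mu p g 1 p0 ler01).1 gn; rewrite powR1.
by under eq_integral do rewrite ger0_norm//.
Qed.

End maximal.

(** * Averages of tensors on the diagonal *)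

(** The product is at most the [d]-th power of the largest factor, and raising this to [p / d] gives
    the [p]-th power of that factor, which is one of the summands. *)
Lemma prod_le_sum_powR {R : realType} d (y : 'I_d -> R) (p : R) : (0 < d)%N ->
  0 < p -> (forall i, 0 <= y i) ->
  (\prod_(i < d) y i) `^ (p / d%:R) <= \sum_(i < d) y i `^ p.
Proof.
move=> d0 p0 y0.
have [i _ hi] := @Order.TotalTheory.arg_maxP _ _ _ (Ordinal d0) predT y isT.
have dn0 : d%:R != 0 :> R by rewrite pnatr_eq0 -lt0n.
apply: (@le_trans _ _ (y i `^ p)); last first.
  by rewrite (bigD1 i)//= lerDl sumr_ge0// => j _; exact: powR_ge0.
have -> : y i `^ p = (y i ^+ d) `^ (p / d%:R).
  by rewrite -powR_mulrn// -powRrM mulrCA mulfV// mulr1.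
apply: ge0_ler_powR; rewrite ?nnegrE ?prodr_ge0 ?exprn_ge0//.
  by rewrite divr_ge0// ltW.
rewrite -[X in _ ^+ X](card_ord d) -prodr_const.
by apply: ler_prod => j _; rewrite y0; exact: hi.
Qed.

Section product_Lnorm.
Context {dX} {X : measurableType dX} {R : realType}.
Variables (mu : probability X R) (p : R) (d : nat).
Hypotheses (d0 : (0 < d)%N) (p0 : 0 < p).

(** A form of Hoelder's inequality. Once each factor is divided by its bound, the integral of the
    product to the power [p / d] is at most a sum of [d] integrals each at most [1]; this is the
    origin of the constant. *)
Lemma Lnorm_prod (g : 'I_d -> X -> R) (c : 'I_d -> R) :
  (forall i x, 0 <= g i x) -> (forall i, measurable_fun setT (g i)) ->
  (forall i, 0 < c i) ->
  (forall i, (Lnorm mu p%:E (fun x => (g i x)%:E) <= (c i)%:E)%E) ->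
  (Lnorm mu (p / d%:R)%:E (fun x => (\prod_(i < d) g i x)%:E) <=
   (d%:R `^ (p / d%:R)^-1 * \prod_(i < d) c i)%:E)%E.
Proof.
move=> g0 mg c0 gc.
have dR : 0 < d%:R :> R by rewrite ltr0n.
set r := p / d%:R; have r0 : 0 < r by rewrite divr_gt0.
pose y i x := (c i)^-1 * g i x.
have y0 i x : 0 <= y i x by rewrite mulr_ge0// invr_ge0 (ltW (c0 i)).
have my i : measurable_fun setT (y i) by exact: measurable_funM.
have yle i : (\int[mu]_x (y i x `^ p)%:E <= 1)%E.
  have h : (Lnorm mu p%:E (fun x => (y i x)%:E) <= 1%:E)%E.
    rewrite Lnorm_scale// ger0_norm ?invr_ge0 ?(ltW (c0 i))//.
    by rewrite lee_pdivrMl// mule1.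
  have := (@Lnorm_leP _ _ _ mu p (y i) 1 p0 ler01).1 h; rewrite powR1.
  by under eq_integral do rewrite ger0_norm//.
have mP : measurable_fun setT (fun x => \prod_(i < d) y i x).
  by apply: measurable_prod => i _.
have E : (fun x => (\prod_(i < d) g i x)%:E) =
    (fun x => ((\prod_(i < d) c i) * \prod_(i < d) y i x)%:E).
  apply/funext => x; rewrite -big_split/=; congr EFin; apply: eq_bigr => i _.
  by rewrite /y mulrA mulfV ?gt_eqF// mul1r.
have c1 : 0 <= \prod_(i < d) c i by rewrite prodr_ge0// => i _; exact: ltW.
rewrite E Lnorm_scale// (ger0_norm c1) [X in (_ <= X%:E)%E]mulrC [X in (_ <= X)%E]EFinM.
apply: lee_wpmul2l; first by rewrite lee_fin.
apply/Lnorm_leP => //.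
rewrite -powRrM mulVf ?gt_eqF// powRr1//.
have mp i : measurable_fun setT (fun x => (y i x `^ p)%:E).
  by apply/measurable_EFinP; exact: (measurableT_comp (measurable_powR _)).
apply: (@le_trans _ _ (\int[mu]_x (\sum_(i < d) (y i x `^ p)%:E))%E).
  apply: ge0_le_integral => //.
  - exact: measurable_norm_powR.
  - by apply: emeasurable_sum => i.
  - move=> x _; rewrite sumEFin lee_fin ger0_norm ?prodr_ge0//.
    exact: prod_le_sum_powR.
rewrite ge0_integral_sum//; last by move=> i x _; rewrite lee_fin powR_ge0.
apply: (@le_trans _ _ (\sum_(i < d) 1%E)%E); first exact: lee_sum.
by rewrite sumEFin lee_fin sumr_const card_ord.
Qed.

End product_Lnorm.

Section averages.
Context {dX} {X : measurableType dX} {R : realType}.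
Variables (mu : probability X R) (T : {mfun X >-> X}).
Hypotheses (Tmp : measure_preserving mu T).
Variables (p : R) (d : nat).
Hypotheses (d2 : (2 <= d)%N) (dp : d%:R <= p).
Let r := p / d%:R.
Let d0 : (0 < d)%N. Proof. exact: ltn_trans d2. Qed.
Let dR : 0 < d%:R :> R. Proof. by rewrite ltr0n. Qed.
Let p2 : 2 <= p. Proof. by apply: le_trans dp; rewrite ler_nat. Qed.
Let p1 : 1 <= p. Proof. by move: p2; lra. Qed.
Let p0 : 0 < p. Proof. by move: p2; lra. Qed.

Lemma exponent_ge1 : 1 <= r. Proof. by rewrite /r ler_pdivlMr// mul1r. Qed.

(* The average over [0 <= k_1, ..., k_d < n] of the tensors [V^k t], restricted
   to the diagonal (see [diag_avgE]). *)
Definition diag_avg n (t : tensor mu p d) : X -> R[i] :=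
  tensor_eval (fun (i : 'I_d) (u : Lp mu p) x => birkhoff_avg T u n x) t.

Lemma cmeasurable_birkhoff_avg (u : X -> R[i]) n :
  cmeasurable u -> cmeasurable (birkhoff_avg T u n).
Proof.
move=> mu_; apply: cmeasurableM; first exact: cmeasurable_cst.
apply: cmeasurable_sum => k; apply: cmeasurable_comp mu_.
exact: measurable_iter.
Qed.

Lemma cmeasurable_diag_avg n t : cmeasurable (diag_avg n t).
Proof.
apply: cmeasurable_eval => i u.
exact: cmeasurable_birkhoff_avg (LpP u).1.
Qed.

Lemma diag_avg_eq n s t : tensor_eq s t ->
  {ae mu, forall x, diag_avg n s x = diag_avg n t x}.
Proof.
apply: tensor_eval_eq => i b c u v w uvw.
have := ae_foralln (fun k => ae_iter Tmp k uvw); apply: filterS => x h.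
rewrite /birkhoff_avg /birkhoff_sum [in LHS](eq_bigr _ (fun k _ => h k)).
rewrite big_split/= -!mulr_sumr; ring.
Qed.

(** Truncation at [N] keeps the values finite; since the bounds are uniform in [N],
    [ae_monotone_sup] later passes to the supremum over all [n]. *)
Definition maximal_diag N t x : R := \big[Num.max/0]_(n < N) cmod (diag_avg n t x).

Lemma maximal_diag_ge N n t x : (n < N)%N ->
  cmod (diag_avg n t x) <= maximal_diag N t x.
Proof. by move=> nN; exact: (le_bigmax 0 (fun n : 'I_N => cmod (diag_avg n t x)) (Ordinal nN)). Qed.

Lemma maximal_diag_le N t x c : 0 <= c ->
  (forall n, cmod (diag_avg n t x) <= c) -> maximal_diag N t x <= c.
Proof. by move=> c0 h; apply: bigmax_le. Qed.

Lemma maximal_diag_ge0 N t x : 0 <= maximal_diag N t x.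
Proof.
by apply: (@big_ind _ (fun z => 0 <= z)) => // [a b a0 b0|n _]; rewrite ?le_max ?a0// cmod_ge0.
Qed.

Lemma maximal_diag_homo t x : {homo (fun N => maximal_diag N t x) : m n / (m <= n)%N >-> m <= n}.
Proof.
move=> m n mn; apply: bigmax_le => [|i _]; first exact: maximal_diag_ge0.
by apply: maximal_diag_ge; exact: leq_trans (ltn_ord i) mn.
Qed.

Lemma measurable_maximal_diag N t : measurable_fun setT (maximal_diag N t).
Proof.
apply: measurable_bigmax => n; apply: measurable_cmod.
exact: cmeasurable_diag_avg.
Qed.

Let M := maximal_cst p.
Definition maximal_diag_cst : R := d%:R `^ r^-1 * M ^+ d.

Lemma maximal_diag_cst_gt0 : 0 < maximal_diag_cst.
Proof.
by rewrite mulr_gt0 ?powR_gt0 ?exprn_gt0//; exact: maximal_cst_gt0.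
Qed.

Lemma maximal_diag_elementary N (u : 'I_d -> Lp mu p) :
  (Lnorm mu r%:E (fun x => (maximal_diag N [:: (1, u)] x)%:E) <=
   (maximal_diag_cst * \prod_(i < d) Lp_norm (u i))%:E)%E.
Proof.
have r0 : 0 < r by exact: lt_le_trans exponent_ge1.
(* [Lnorm_prod] requires positive bounds. A factor of norm [0] vanishes almost everywhere, so the
   tensor is then congruent to the empty sum. *)
have [[i ui0]|/forallNP u0] := pselect (exists i, Lp_norm (u i) = 0).
  have u0 : tensor_eq [:: (1, u)] [::].
    apply: (teq_trans (t := [:: (1 * 0, u); (1 * 0, u)])).
      apply: (@teq_linear _ _ _ _ _ _ _ _ _ i) => [j _|]; first by split; exact: ae_eq_refl.
      by apply: filterS (Lp_norm_eq0 p1 ui0) => x -> _; rewrite mulr0 addr0.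
    rewrite mulr0; apply: (teq_trans (teq_cat (teq_zero u) (teq_zero u))).
    exact: teq_refl.
  have := ae_foralln (fun n => diag_avg_eq n u0) => h.
  rewrite (ae_eq_Lnorm (g := fun=> 0))//; last 2 first.
  - exact: measurable_maximal_diag.
  - apply: filterS h => x h; congr (`|_|); apply/eqP.
    rewrite eq_le maximal_diag_ge0 andbT; apply: maximal_diag_le => // n.
    by rewrite h /diag_avg /tensor_eval big_nil cmod0.
  rewrite Lnorm_cst0// lee_fin mulr_ge0 ?(ltW maximal_diag_cst_gt0)//.
  by rewrite prodr_ge0// => j _; exact: Lp_norm_ge0.
pose g i x := maximal_avg T (fun y => cmod (u i y)) N x.
have g0 i x : 0 <= g i x by exact: maximal_avg_ge0.
have mcu i : measurable_fun setT (fun y => cmod (u i y)).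
  by apply: measurable_cmod; exact: (LpP (u i)).1.
have mg i : measurable_fun setT (g i) by exact: measurable_maximal_avg.
have un0 i : 0 < Lp_norm (u i).
  by rewrite lt_neqAle Lp_norm_ge0 andbT eq_sym; apply/eqP; exact: u0.
have gn i : (Lnorm mu p%:E (fun x => (g i x)%:E) <= (M * Lp_norm (u i))%:E)%E.
  apply: (strong_maximal Tmp p2) => //; first by move=> x; exact: cmod_ge0.
  by rewrite Lp_normE.
have c0 i : 0 < M * Lp_norm (u i) by rewrite mulr_gt0//; exact: maximal_cst_gt0.
have := Lnorm_prod d0 p0 g0 mg c0 gn.
rewrite big_split/= prodr_const card_ord mulrA; apply: le_trans.
apply: Lnorm_le => //.
- exact: measurable_maximal_diag.
- by apply: measurable_prod => i _.
- apply: aeW => x; rewrite !ger0_norm ?maximal_diag_ge0 ?prodr_ge0//.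
  apply: bigmax_le => [|n _]; first by rewrite prodr_ge0.
  rewrite /diag_avg /tensor_eval big_seq1 mul1r cmod_prod.
  apply: ler_prod => i _; rewrite cmod_ge0/=.
  apply: le_trans (maximal_avg_ge T _ x (ltn_ord n)).
  rewrite /birkhoff_avg cmodM cmodV cmod_nat ler_wpM2l ?invr_ge0//.
  exact: cmod_sum.
Qed.

Lemma sublinear_maximal_diag N : sublinear mu r maximal_diag_cst (maximal_diag N).
Proof.
split.
- exact: maximal_diag_ge0.
- exact: measurable_maximal_diag.
- move=> s t st; have := ae_foralln (fun n => diag_avg_eq n st).
  by apply: filterS => x h; apply: eq_bigr => n _; rewrite h.
- move=> s t x; apply: bigmax_le => [|n _].
    by rewrite addr_ge0// maximal_diag_ge0.
  rewrite /diag_avg tensor_eval_cat; apply: le_trans (cmodD _ _) _.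
  by apply: lerD; exact: maximal_diag_ge.
- move=> a t x; rewrite /maximal_diag.
  elim/big_ind2 : _ => [|y1 y2 z1 z2 -> ->|n _]; first by rewrite mulr0.
    by rewrite maxr_pMr// cmod_ge0.
  by rewrite /diag_avg tensor_eval_scale cmodM.
- exact: maximal_diag_elementary.
Qed.

Lemma Lnorm_maximal_diag N t :
  (Lnorm mu r%:E (fun x => (maximal_diag N t x)%:E) <=
   (maximal_diag_cst * projective_norm t)%:E)%E.
Proof.
exact: (le_projective_norm p1 exponent_ge1 maximal_diag_cst_gt0
  (sublinear_maximal_diag N)).
Qed.

Lemma CLnorm_diag_avg n t :
  (CLnorm mu r (diag_avg n t) <= (maximal_diag_cst * projective_norm t)%:E)%E.
Proof.
apply: le_trans (Lnorm_maximal_diag n.+1 t); apply: Lnorm_le.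
- exact: lt_le_trans exponent_ge1.
- by apply: measurable_cmod; exact: cmeasurable_diag_avg.
- exact: measurable_maximal_diag.
- apply: aeW => x; rewrite !ger0_norm ?maximal_diag_ge0 ?cmod_ge0//.
  exact: maximal_diag_ge.
Qed.

(** The continuity of [D] thus becomes the case [n = 1] of the maximal inequality, with the constant
    [maximal_diag_cst] in place of [1]. *)
Lemma tensor_diagE (t : tensor mu p d) x : tensor_diag t x = diag_avg 1 t x.
Proof.
apply: eq_bigr => au _; congr (_ * _); apply: eq_bigr => i _.
by rewrite /birkhoff_avg /birkhoff_sum big_nat1/= invr1 mul1r.
Qed.

Lemma tensor_diag_sub (s t : tensor mu p d) x :
  tensor_diag s x - tensor_diag t x = tensor_diag (s ++ tscale (-1) t) x.
Proof.
by rewrite !tensor_diagE /diag_avg tensor_eval_cat tensor_eval_scale mulN1r.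
Qed.

Lemma diag_avgE n t x :
  diag_avg n t x = (n%:R ^+ d)^-1 *
    \sum_(k : {ffun 'I_d -> 'I_n}) tensor_diag (tensor_V Tmp (fun i => k i) t) x.
Proof.
rewrite /diag_avg /tensor_eval.
under [in RHS]eq_bigr do rewrite /tensor_diag big_map/=.
rewrite exchange_big/= mulr_sumr; apply: eq_bigr => -[a u] _ /=.
rewrite -mulr_sumr mulrCA; congr (_ * _).
rewrite /birkhoff_avg big_split/= prodr_const card_ord exprVn; congr (_ * _).
under eq_bigr do rewrite /birkhoff_sum big_mkord.
exact: bigA_distr_bigA.
Qed.

End averages.

(** * Monotone suprema and complex integrals *)

Section monotone_sup.
Context {d} {Y : measurableType d} {R : realType}.
Variable P : probability Y R.

(** The extended supremum has integral at most [c] by monotone convergence, hence is finite almost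
    everywhere; Fatou's lemma then gives the [L_r] bound for its real version [h]. *)
Lemma ae_monotone_sup (r c : R) (F : nat -> Y -> R) : 1 <= r -> 0 <= c ->
  (forall N, measurable_fun [set: Y] (F N)) -> (forall N x, 0 <= F N x) ->
  (forall x, {homo F ^~ x : m n / (m <= n)%N >-> m <= n}) ->
  (forall N, (Lnorm P r%:E (fun x => (F N x)%:E) <= c%:E)%E) ->
  exists h : Y -> R, [/\ measurable_fun [set: Y] h,
    (Lnorm P r%:E (fun x => (h x)%:E) <= c%:E)%E &
    {ae P, forall x, forall N, F N x <= h x}].
Proof.
move=> r1 c0 mF F0 ndF Fc.
have mE N : measurable_fun [set: Y] (fun x => (F N x)%:E) by exact/measurable_EFinP.
have ndE x : nondecreasing_seq (fun N => (F N x)%:E).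
  by move=> m n mn; rewrite lee_fin ndF.
have cE x : cvgn (fun N => (F N x)%:E) by exact: ereal_nondecreasing_is_cvgn.
pose H x := limn (fun N => (F N x)%:E).
have mH : measurable_fun [set: Y] H.
  by apply: (emeasurable_fun_cvg (fun N x => (F N x)%:E)).
have FH N x : ((F N x)%:E <= H x)%E.
  apply: lime_ge => //; exists N => // n /= Nn; exact: ndE.
have H0 x : (0 <= H x)%E by apply: le_trans (FH 0%N x); rewrite lee_fin.
have HI : P.-integrable setT H.
  apply/integrableP; split => //; rewrite (eq_integral H); last first.
    by move=> x _; rewrite gee0_abs.
  rewrite (@monotone_convergence _ _ _ P setT measurableT (fun N x => (F N x)%:E) mE);
    last 2 first.
  - by move=> N x _; rewrite lee_fin.
  - by move=> x _; exact: ndE.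
  apply: (@le_lt_trans _ _ c%:E); last exact: ltry.
  apply: lime_le.
    apply: ereal_nondecreasing_is_cvgn => m n mn; apply: ge0_le_integral => //.
    + by move=> x _; rewrite lee_fin.
    + by move=> x _; exact: ndE.
  apply: nearW => N; apply: le_trans (Fc N).
  apply: le_trans (integral_le_Lnorm P r1 (mF N)).
  by rewrite le_eqVlt; apply/orP; left; apply/eqP/eq_integral => x _; rewrite ger0_norm.
have aefin := integrable_ae measurableT HI.
have mh : measurable_fun [set: Y] (fine \o H) by exact: measurableT_comp.
exists (fine \o H); split => //.
- apply: (@Lnorm_fatou _ _ _ P r F) => //.
  + exact: lt_le_trans r1.
  + apply: filterS aefin => x /(_ I) Hfin.
    have hc : (F N x)%:E @[N --> \oo] --> (fine (H x))%:E.
      by rewrite fineK//; exact: cE.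
    exact: (fine_cvg hc).
  + exact: nearW.
- by apply: filterS aefin => x /(_ I) Hfin N; rewrite -lee_fin fineK.
Qed.

End monotone_sup.

Section complex_integral.
Context {d} {Y : measurableType d} {R : realType}.
Variable P : probability Y R.
Implicit Types f g : Y -> R[i].

Lemma cintegrableD f g : cintegrable P f -> cintegrable P g ->
  cintegrable P (fun x => f x + g x).
Proof.
move=> [fr fi] [gr gi]; split.
- by under eq_fun do rewrite cReD EFinD; exact: integrableD.
- by under eq_fun do rewrite cImD EFinD; exact: integrableD.
Qed.

Lemma CintegralD f g : cintegrable P f -> cintegrable P g ->
  Cintegral P (fun x => f x + g x) = Cintegral P f + Cintegral P g.
Proof.
move=> [fr fi] [gr gi]; rewrite /Cintegral.
apply/eqP; rewrite eq_complex/= -!RintegralD//; apply/andP; split; apply/eqP.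
- by apply: eq_Rintegral => x _; exact: cReD.
- by apply: eq_Rintegral => x _; exact: cImD.
Qed.

Lemma cintegrableZ a f : cintegrable P f -> cintegrable P (fun x => a * f x).
Proof.
move=> [fr fi]; split.
- under eq_fun do rewrite cReM EFinB !EFinM.
  by apply: integrableB => //; exact: integrableZl.
- under eq_fun do rewrite cImM EFinD !EFinM.
  by apply: integrableD => //; exact: integrableZl.
Qed.

Lemma CintegralZ a f : cintegrable P f ->
  Cintegral P (fun x => a * f x) = a * Cintegral P f.
Proof.
move=> [fr fi]; have hi k (g : Y -> R) : P.-integrable setT (fun x => (g x)%:E) ->
  P.-integrable setT (EFin \o (fun x => k * g x)) by move=> ig; exact: (integrableZl measurableT k ig).
have aE : a * Cintegral P f = Complex
    (complex.Re a * (\int[P]_x complex.Re (f x)) - complex.Im a * (\int[P]_x complex.Im (f x)))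
    (complex.Re a * (\int[P]_x complex.Im (f x)) + complex.Im a * (\int[P]_x complex.Re (f x))).
  by apply/eqP; rewrite eq_complex cReM cImM /= !eqxx.
rewrite aE; congr Complex.
- transitivity (\int[P]_x (complex.Re a * complex.Re (f x) - complex.Im a * complex.Im (f x))).
    by apply: eq_Rintegral => x _; exact: cReM.
  rewrite RintegralB; [|by []|exact: hi|exact: hi].
  by congr (_ - _); exact: RintegralZl.
- transitivity (\int[P]_x (complex.Re a * complex.Im (f x) + complex.Im a * complex.Re (f x))).
    by apply: eq_Rintegral => x _; exact: cImM.
  rewrite RintegralD; [|by []|exact: hi|exact: hi].
  by congr (_ + _); exact: RintegralZl.
Qed.

Lemma CLfun_cintegrable p f : 1 <= p -> CLfun P p f -> cintegrable P f.
Proof.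
move=> p1 [[mr mi] fp]; have mc := measurable_cmod (conj mr mi).
have fi : (\int[P]_x `|cmod (f x)|%:E < +oo)%E.
  exact: le_lt_trans (integral_le_Lnorm P p1 mc) fp.
have h (g : Y -> R) : measurable_fun setT g -> (forall x, `|g x| <= cmod (f x)) ->
    P.-integrable setT (fun x => (g x)%:E).
  move=> mg gf; apply/integrableP; split; first exact/measurable_EFinP.
  apply: le_lt_trans fi; apply: ge0_le_integral => //.
  - by apply: measurableT_comp => //; exact/measurable_EFinP.
  - by apply/measurable_EFinP; exact: measurableT_comp.
  - by move=> x _; rewrite lee_fin (ger0_norm (cmod_ge0 _)).
by split; apply: h => // x; [exact: cmod_Re|exact: cmod_Im].
Qed.

(** Real and imaginary parts are estimated separately, whence the factor [2]. *)
Lemma Cintegral_dist p f g : 1 <= p -> CLfun P p f -> CLfun P p g ->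
  ((cmod (Cintegral P f - Cintegral P g))%:E <=
   2%:E * CLnorm P p (fun x => f x - g x)%R)%E.
Proof.
move=> p1 Lf Lg.
have [fr fi] := CLfun_cintegrable p1 Lf; have [gr gi] := CLfun_cintegrable p1 Lg.
have mc := measurable_cmod (cmeasurableB Lf.1 Lg.1).
have h (F : R[i] -> R) : (forall x y, F (x - y) = F x - F y) ->
    (forall x, `|F x| <= cmod x) -> measurable_fun setT (fun x => F (f x)) ->
    measurable_fun setT (fun x => F (g x)) ->
    P.-integrable setT (fun x => (F (f x))%:E) ->
    P.-integrable setT (fun x => (F (g x))%:E) ->
    ((`|\int[P]_x F (f x) - \int[P]_x F (g x)|)%:E <=
     CLnorm P p (fun x => f x - g x)%R)%E.
  move=> FB Fle mFf mFg iFf iFg; rewrite -RintegralB//.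
  have iB : P.-integrable setT (EFin \o (fun x => F (f x) - F (g x))).
    by have := integrableB measurableT iFf iFg.
  apply: (@le_trans _ _ (\int[P]_x `|F (f x) - F (g x)|%:E)%E).
    rewrite EFin_normr_Rintegral//; apply: le_abse_integral => //.
    by case/integrableP: iB.
  apply: le_trans (integral_le_Lnorm P p1 mc).
  apply: ge0_le_integral => //.
  - by apply/measurable_EFinP; apply: measurableT_comp => //; exact: measurable_funB.
  - by apply/measurable_EFinP; exact: measurableT_comp.
  - by move=> x _; rewrite lee_fin (ger0_norm (cmod_ge0 _)) -FB.
apply: (@le_trans _ _ ((`|\int[P]_x complex.Re (f x) - \int[P]_x complex.Re (g x)|)%:E +
   (`|\int[P]_x complex.Im (f x) - \int[P]_x complex.Im (g x)|)%:E)%E).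
  by rewrite -EFinD lee_fin; exact: cmod_Complex.
rewrite (_ : 2%:E = 1 + 1)%E// ge0_muleDl// mul1e.
apply: leeD; [apply: h|apply: h] => //; try exact: cReB; try exact: cImB;
  try exact: cmod_Re; try exact: cmod_Im; try exact: Lf.1.1; try exact: Lf.1.2;
  try exact: Lg.1.1; exact: Lg.1.2.
Qed.

End complex_integral.

(** * Convergence for algebraic tensors *)

Lemma cvgM_complex {R : realType} (f g : nat -> R[i]^o) (a b : R[i]^o) :
  f n @[n --> \oo] --> a -> g n @[n --> \oo] --> b ->
  (f n * g n : R[i]^o) @[n --> \oo] --> (a * b : R[i]^o).
Proof. by move=> fa gb; exact: (@cvgM R[i] nat \oo _ f g a b fa gb). Qed.

Lemma cvgD_complex {R : realType} (f g : nat -> R[i]^o) (a b : R[i]^o) :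
  f n @[n --> \oo] --> a -> g n @[n --> \oo] --> b ->
  (f n + g n : R[i]^o) @[n --> \oo] --> (a + b : R[i]^o).
Proof. by move=> fa gb; exact: (@cvgD R[i] R[i]^o nat \oo _ f g a b fa gb). Qed.

Lemma cvg_prod_complex {R : realType} I (s : seq I) (F : I -> nat -> R[i]^o) (l : I -> R[i]^o) :
  (forall i, F i n @[n --> \oo] --> l i) ->
  (\prod_(i <- s) F i n : R[i]^o) @[n --> \oo] --> (\prod_(i <- s) l i : R[i]^o).
Proof.
move=> Fl; elim: s => [|i s IH].
  rewrite big_nil (_ : (fun n => _) = fun=> 1); first exact: cvg_cst.
  by apply/funext => n; rewrite big_nil.
rewrite big_cons (_ : (fun n => _) = fun n => F i n * \prod_(j <- s) F j n).
  exact: (cvgM_complex (Fl i) IH).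
by apply/funext => n; rewrite big_cons.
Qed.

Section fixed_tensor.
Context {dX} {X : measurableType dX} {R : realType}.
Variables (mu : probability X R) (T : {mfun X >-> X}).
Hypotheses (Tmp : measure_preserving mu T) (Terg : ergodic mu T).
Variables (p : R) (d : nat).
Hypotheses (d2 : (2 <= d)%N) (dp : d%:R <= p).
Let r := p / d%:R.
Let p1 : 1 <= p.
Proof. by apply: le_trans dp; rewrite ler1n (ltn_trans _ d2). Qed.
Let r1 : 1 <= r. Proof. exact: exponent_ge1. Qed.
Let r0 : 0 < r. Proof. exact: lt_le_trans r1. Qed.
Implicit Types s t : tensor mu p d.

Definition tensor_mean t : R[i]^o := Cintegral (prob_pow mu d) (tensor_fun t).

Lemma Cintegral_tensor_fun t : cintegrable (prob_pow mu d) (tensor_fun t) /\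
  tensor_mean t = \sum_(au <- t) au.1 * \prod_(i < d) Cintegral mu (au.2 i).
Proof.
rewrite /tensor_mean; elim: t => [|[a u] t [i1 e1]].
  rewrite big_nil (_ : tensor_fun [::] = fun=> 0); last first.
    by apply/funext => x; rewrite /tensor_fun big_nil.
  split; first by split; exact: finite_measure_integrable_cst.
  exact: congr2 (Rintegral_probability_cst _ _) (Rintegral_probability_cst _ _).
have [i2 e2] := Cintegral_prod (fun i => (LpP (u i)).1)
  (fun i => CLfun_cintegrable p1 (LpP (u i))).
have -> : tensor_fun ((a, u) :: t) = fun x : d.-tuple X =>
    a * \prod_(i < d) u i (tnth x i) + tensor_fun t x.
  by apply/funext => x; rewrite /tensor_fun big_cons.
split; first by apply: cintegrableD => //; exact: cintegrableZ.
rewrite CintegralD//; last exact: cintegrableZ.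
by rewrite CintegralZ// big_cons e1 e2.
Qed.

Lemma ae_diag_avg_cvg t :
  {ae mu, forall x, cmod (diag_avg T n t x - tensor_mean t) @[n --> \oo] --> (0 : R)}.
Proof.
rewrite (Cintegral_tensor_fun t).2.
suff h : {ae mu, forall x, (diag_avg T n t x : R[i]^o) @[n --> \oo] -->
    (\sum_(au <- t) au.1 * \prod_(i < d) Cintegral mu (au.2 i) : R[i]^o)}.
  by apply: filterS h => x h; exact/cvg_cmodP.
elim: t => [|[a u] t IH].
  apply: aeW => x; rewrite big_nil.
  rewrite (_ : (fun n => _) = fun=> 0); first exact: cvg_cst.
  by apply/funext => n; rewrite /diag_avg /tensor_eval big_nil.
have hu : {ae mu, forall x, forall i : 'I_d,
    (birkhoff_avg T (u i) n x : R[i]^o) @[n --> \oo] --> (Cintegral mu (u i) : R[i]^o)}.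
  apply: filter_forall => i.
  have := birkhoff_complex Tmp Terg (CLfun_cintegrable p1 (LpP (u i))).
  by apply: filterS => x h; exact/cvg_cmodP.
apply: filterS2 hu IH => x hu IH; rewrite big_cons.
rewrite (_ : (fun n => _) = fun n =>
   (a * \prod_(i < d) birkhoff_avg T (u i) n x : R[i]^o) + (diag_avg T n t x : R[i]^o)).
  apply: (cvgD_complex _ IH); apply: (cvgM_complex (cvg_cst _)).
  exact: cvg_prod_complex hu.
by apply/funext => n; rewrite /diag_avg /tensor_eval big_cons.
Qed.

Lemma ae_diag_avg_bounded t : exists h : X -> R, [/\ measurable_fun [set: X] h,
    (Lnorm mu r%:E (fun x => (h x)%:E) <=
     (maximal_diag_cst p d * projective_norm t)%:E)%E &
    {ae mu, forall x, forall n, cmod (diag_avg T n t x) <= h x}].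
Proof.
have c0 : 0 <= maximal_diag_cst p d * projective_norm t.
  by rewrite -lee_fin; apply: le_trans (Lnorm_maximal_diag Tmp d2 dp 0 t); exact: Lnorm_ge0.
have [h [mh hc Fh]] := ae_monotone_sup r1 c0
  (fun N => measurable_maximal_diag T N t)
  (fun N x => maximal_diag_ge0 T N t x)
  (fun x => maximal_diag_homo T t x)
  (fun N => Lnorm_maximal_diag Tmp d2 dp N t).
exists h; split => //.
apply: filterS Fh => x hx n; apply: le_trans (hx n.+1).
exact: maximal_diag_ge.
Qed.

(** Dominated convergence for [r]-th powers: the majorant of all the averages comes from the maximal
    inequality. *)
Lemma Lnorm_diag_avg_cvg t :
  CLnorm mu r (fun x => diag_avg T n t x - tensor_mean t)%R @[n --> \oo] --> 0%E.
Proof.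
have [h [mh /le_lt_trans /(_ (ltry _)) hfin Fh]] := ae_diag_avg_bounded t.
set l := tensor_mean t.
have mD n : measurable_fun [set: X] (fun x => cmod (diag_avg T n t x - l)).
  apply: measurable_cmod; apply: cmeasurableB; last exact: cmeasurable_cst.
  exact: cmeasurable_diag_avg.
pose g x := `|h x| + cmod l.
have mg : measurable_fun [set: X] g by apply: measurable_funD => //; exact: measurableT_comp.
have gfin : (Lnorm mu r%:E (fun x => (g x)%:E) < +oo)%E.
  apply: le_lt_trans (@minkowski_EFin _ _ _ mu (fun x => `|h x|) (fun=> cmod l) r _ _ r1) _ => //.
    exact: measurableT_comp.
  rewrite lte_add_pinfty//.
    by rewrite (ae_eq_Lnorm (g := h))//; [exact: measurableT_comp|apply: aeW => x; rewrite normr_id].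
  apply: le_lt_trans (ltry (cmod l)).
  apply/Lnorm_leP => //; first exact: cmod_ge0.
  by rewrite ger0_norm ?cmod_ge0// integral_probability_cst.
have [|||||_ cv0 _] := @dominated_convergence _ X R mu setT measurableT
  (fun n x => (`|cmod (diag_avg T n t x - l)| `^ r)%:E) (fun=> 0%E)
  (fun x => (`|g x| `^ r)%:E).
- by move=> n; exact: measurable_norm_powR.
- exact: measurable_cst.
- apply: filterS (ae_diag_avg_cvg t) => x hx _.
  suff : (`|cmod (diag_avg T n t x - l)| `^ r)%:E @[n --> \oo] --> (0 `^ r)%:E.
    by rewrite powR0 ?gt_eqF.
  apply: cvg_EFin; first exact: nearW.
  by apply: cvg_powR => //; rewrite -(normr0 R); exact: cvg_norm.
- apply/integrableP; split; first exact: measurable_norm_powR.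
  by under eq_integral do rewrite /= ger0_norm ?powR_ge0//; exact: Lnorm_lty.
- apply: filterS Fh => x hx n _; rewrite lee_fin ger0_norm ?powR_ge0//.
  apply: ge0_ler_powR; rewrite ?nnegrE ?(ltW r0)//.
  rewrite ger0_norm ?cmod_ge0// (le_trans _ (ler_norm _))//.
  rewrite (le_trans (cmodD _ _))// cmodN lerD2r//.
  by rewrite (le_trans (hx n))// ler_norm.
apply/ecvg0P => [n|e e0]; first exact: Lnorm_ge0.
have [|N HN] := (ecvg0P _).1 cv0 (e `^ r) (powR_gt0 _ e0).
  by move=> n; apply: integral_ge0.
exists N => n /HN h2; apply/Lnorm_leP => //; first exact: ltW.
apply: le_trans h2; rewrite le_eqVlt; apply/orP; left; apply/eqP.
apply: eq_integral => x _; rewrite sube0 gee0_abs// lee_fin powR_ge0//.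
Qed.

End fixed_tensor.

(** * Elements of the projective tensor product *)

Section projective_elements.
Context {dX} {X : measurableType dX} {R : realType}.
Variables (mu : probability X R) (T : {mfun X >-> X}).
Hypotheses (Tmp : measure_preserving mu T) (Terg : ergodic mu T).
Variables (p : R) (d : nat).
Hypotheses (d2 : (2 <= d)%N) (dp : d%:R <= p).
Let r := p / d%:R.
Let p1 : 1 <= p.
Proof. by apply: le_trans dp; rewrite ler1n (ltn_trans _ d2). Qed.
Let r1 : 1 <= r. Proof. exact: exponent_ge1. Qed.
Let r0 : 0 < r. Proof. exact: lt_le_trans r1. Qed.
Let K := maximal_diag_cst p d.
Let K0 : 0 < K. Proof. exact: maximal_diag_cst_gt0. Qed.
Variable f : Lpi mu p d.
Implicit Types s t : tensor mu p d.

Lemma cmeasurable_tensor_diag t : cmeasurable (tensor_diag t).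
Proof.
have := cmeasurable_diag_avg T 1 t.
by rewrite (_ : diag_avg T 1 t = tensor_diag t)//; apply/funext => x; rewrite (tensor_diagE T).
Qed.

Lemma CLnorm_tensor_diag t :
  (CLnorm mu r (tensor_diag t) <= (K * projective_norm t)%:E)%E.
Proof.
have := CLnorm_diag_avg Tmp d2 dp 1 t.
by rewrite (_ : diag_avg T 1 t = tensor_diag t)//; apply/funext => x; rewrite (tensor_diagE T).
Qed.

Lemma CLnorm_tensor_diagB s t :
  (CLnorm mu r (fun x => tensor_diag s x - tensor_diag t x)%R <=
   (K * projective_norm (s ++ tscale (-1) t))%:E)%E.
Proof.
rewrite (_ : (fun x => _) = tensor_diag (s ++ tscale (-1) t)); last first.
  by apply/funext => x; rewrite (tensor_diag_sub T).
exact: CLnorm_tensor_diag.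
Qed.

Lemma CLfun_tensor_diag t : CLfun mu r (tensor_diag t).
Proof.
split; first exact: cmeasurable_tensor_diag.
exact: le_lt_trans (CLnorm_tensor_diag t) (ltry _).
Qed.

Lemma CLcauchy_tensor_diag (g : Lpi mu p d) :
  CLcauchy mu r (fun n => tensor_diag (g n)).
Proof.
move=> e e0; have [N HN] := Lpi_cauchy g (divr_gt0 e0 K0).
exists N => m n Nm Nn; apply: le_trans (CLnorm_tensor_diagB _ _) _.
by rewrite lee_fin mulrC -ler_pdivlMr// ltW// HN.
Qed.

Lemma CLfun_D (g : Lpi mu p d) : CLfun mu r (D g).
Proof. exact: (CLlim_spec r1 (fun n => CLfun_tensor_diag (g n)) (CLcauchy_tensor_diag g)).1. Qed.

Lemma CLnorm_D (g : Lpi mu p d) (c : R) N :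
  (forall m n, (N <= m)%N -> (N <= n)%N ->
    projective_norm (g m ++ tscale (-1) (g n)) <= c) ->
  forall m, (N <= m)%N ->
  (CLnorm mu r (fun x => tensor_diag (g m) x - D g x)%R <= (K * c)%:E)%E.
Proof.
move=> HN; apply: (CLlim_dist r1 (fun n => CLfun_tensor_diag (g n)) (CLcauchy_tensor_diag g)).
move=> m n Nm Nn; apply: le_trans (CLnorm_tensor_diagB _ _) _.
by rewrite lee_fin ler_wpM2l ?(ltW K0)// HN.
Qed.

(** The bound is the same for all [k], since [tensor_V] does not increase the projective norm;
    averaging over any cube therefore preserves it. *)
Lemma CLnorm_DV (k : 'I_d -> nat) (c : R) N :
  (forall m n, (N <= m)%N -> (N <= n)%N ->
    projective_norm (f m ++ tscale (-1) (f n)) <= c) ->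
  forall m, (N <= m)%N ->
  (CLnorm mu r (fun x => tensor_diag (tensor_V Tmp k (f m)) x - D (V Tmp k f) x)%R <=
   (K * c)%:E)%E.
Proof.
move=> HN; apply: (@CLnorm_D (V Tmp k f)) => m n Nm Nn.
apply: le_trans (HN m n Nm Nn).
by rewrite /= -tensor_V_scale /tensor_V -map_cat; exact: projective_norm_V.
Qed.

Lemma CLnorm_tensor_fun t :
  (CLnorm (prob_pow mu d) p (tensor_fun t) <= (projective_norm t)%:E)%E.
Proof.
by have := le_projective_norm p1 p1 ltr01 (sublinear_J mu d p1) t; rewrite mul1r.
Qed.

Lemma CLnorm_tensor_funB s t :
  (CLnorm (prob_pow mu d) p (fun x => tensor_fun s x - tensor_fun t x)%R <=
   (projective_norm (s ++ tscale (-1) t))%:E)%E.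
Proof.
rewrite (_ : (fun x => _) = tensor_fun (s ++ tscale (-1) t)); last first.
  apply/funext => x; rewrite !tensor_fun_eval tensor_eval_cat.
  by rewrite tensor_eval_scale mulN1r.
exact: CLnorm_tensor_fun.
Qed.

Lemma CLfun_tensor_fun t : CLfun (prob_pow mu d) p (tensor_fun t).
Proof.
split; first exact: cmeasurable_tensor_fun.
exact: le_lt_trans (CLnorm_tensor_fun t) (ltry _).
Qed.

Lemma CLcauchy_tensor_fun : CLcauchy (prob_pow mu d) p (fun n => tensor_fun (f n)).
Proof.
move=> e e0; have [N HN] := Lpi_cauchy f e0.
exists N => m n Nm Nn; apply: le_trans (CLnorm_tensor_funB _ _) _.
by rewrite lee_fin ltW// HN.
Qed.

Definition Lpi_mean : R[i]^o := Cintegral (prob_pow mu d) (J f).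

Lemma tensor_mean_dist (c : R) N :
  (forall m n, (N <= m)%N -> (N <= n)%N ->
    projective_norm (f m ++ tscale (-1) (f n)) <= c) ->
  forall m, (N <= m)%N -> cmod (tensor_mean (f m) - Lpi_mean) <= 2 * c.
Proof.
move=> HN m Nm.
have LJ := (CLlim_spec p1 (fun n => CLfun_tensor_fun (f n)) CLcauchy_tensor_fun).1.
have := Cintegral_dist p1 (CLfun_tensor_fun (f m)) LJ.
rewrite -lee_fin => /le_trans; apply; rewrite EFinM lee_pmul2l//.
apply: (CLlim_dist p1 (fun n => CLfun_tensor_fun (f n)) CLcauchy_tensor_fun (N := N)) => //.
move=> i j Ni Nj; apply: le_trans (CLnorm_tensor_funB _ _) _.
by rewrite lee_fin HN.
Qed.

Definition cube_avg n x : R[i]^o := (n%:R ^+ d)^-1 *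
  \sum_(k : {ffun 'I_d -> 'I_n}) D (V Tmp (fun i => k i) f) x.

Lemma cmeasurable_cube_avg n : cmeasurable (cube_avg n).
Proof.
apply: cmeasurableM; first exact: cmeasurable_cst.
by apply: cmeasurable_sum => k; exact: (CLfun_D _).1.
Qed.

Lemma cube_avg_dist n t x : cmod (cube_avg n x - diag_avg T n t x) <=
  (n%:R ^+ d)^-1 * \sum_(k : {ffun 'I_d -> 'I_n})
    cmod (tensor_diag (tensor_V Tmp (fun i => k i) t) x - D (V Tmp (fun i => k i) f) x).
Proof.
rewrite (diag_avgE Tmp) /cube_avg -mulrBr -sumrB cmodM cmodV cmodX cmod_nat.
rewrite ler_wpM2l ?invr_ge0 ?exprn_ge0//; apply: le_trans (cmod_sum _ _) _.
by apply: ler_sum => k _; rewrite cmodB.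
Qed.

Lemma CLnorm_cube_avg (c : R) N : 0 <= c ->
  (forall m n, (N <= m)%N -> (N <= n)%N ->
    projective_norm (f m ++ tscale (-1) (f n)) <= c) ->
  forall m n, (N <= m)%N -> (0 < n)%N ->
  (CLnorm mu r (fun x => cube_avg n x - diag_avg T n (f m) x)%R <= (K * c)%:E)%E.
Proof.
move=> c0 HN m n Nm n0.
have nd0 : (n%:R ^+ d : R) != 0 by rewrite expf_neq0// pnatr_eq0 -lt0n.
pose G (k : {ffun 'I_d -> 'I_n}) x : R :=
  cmod (tensor_diag (tensor_V Tmp (fun i => k i) (f m)) x - D (V Tmp (fun i => k i) f) x).
have mG k : measurable_fun setT (G k).
  apply: measurable_cmod; apply: cmeasurableB (CLfun_D _).1.
  exact: cmeasurable_tensor_diag.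
have nd : 0 <= (n%:R ^+ d : R)^-1 by rewrite invr_ge0 exprn_ge0.
apply: (@le_trans _ _ (Lnorm mu r%:E (fun x => ((n%:R ^+ d)^-1 * \sum_k G k x)%:E))).
  apply: Lnorm_le => //.
  - apply: measurable_cmod; apply: cmeasurableB; first exact: cmeasurable_cube_avg.
    exact: cmeasurable_diag_avg.
  - by apply: measurable_funM => //; apply: measurable_sum => k.
  - apply: aeW => x; rewrite ger0_norm ?cmod_ge0//.
    rewrite ger0_norm; last by rewrite mulr_ge0// sumr_ge0// => k _; exact: cmod_ge0.
    exact: cube_avg_dist.
rewrite Lnorm_scale//; last by apply: measurable_sum => k.
rewrite ger0_norm// lee_pdivrMl ?exprn_gt0 ?ltr0n//.
apply: (le_trans (Lnorm_sum mu _ r1 mG)).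
apply: (@le_trans _ _ (\sum_(k : {ffun 'I_d -> 'I_n}) (K * c)%:E)%E).
  by apply: lee_sum => k _; exact: (CLnorm_DV (fun i => k i) HN Nm).
rewrite sumEFin sumr_const card_ffun !card_ord -EFinM lee_fin.
by rewrite -[leLHS]mulr_natl natrX.
Qed.

Lemma Lpi_small e : 0 < e -> exists N, forall m n, (N <= m)%N -> (N <= n)%N ->
  projective_norm (f m ++ tscale (-1) (f n)) <= e.
Proof.
by move=> /(Lpi_cauchy f)[N HN]; exists N => m n Nm Nn; rewrite ltW// HN.
Qed.

Lemma cube_avg_cvg_Lnorm :
  CLnorm mu r (fun x => cube_avg n x - Lpi_mean)%R @[n --> \oo] --> 0%E.
Proof.
apply/ecvg0P => [n|e e0]; first exact: Lnorm_ge0.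
have e3 : 0 < e / 3 by rewrite divr_gt0.
(* The first bound controls the averages through [K * c], the second the means through [2 * c]; each
   error is then at most [e / 3]. *)
pose c := Num.min (e / 3 / K) (e / 6).
have c0 : 0 < c by rewrite lt_min !divr_gt0.
have cK : K * c <= e / 3 by rewrite mulrC -ler_pdivlMr// ge_min lexx.
have c2 : 2 * c <= e / 3.
  have : c <= e / 6 by rewrite ge_min lexx orbT.
  lra.
have [N HN] := Lpi_small c0.
have [|N' HN'] := (ecvg0P _).1 (Lnorm_diag_avg_cvg Tmp Terg d2 dp (f N)) (e / 3) e3.
  by move=> n; exact: Lnorm_ge0.
exists (maxn 1 N') => n; rewrite geq_max => /andP[n0 N'n].
have mD := cmeasurable_diag_avg T n (f N).
have mC := cmeasurable_cube_avg n.
apply: le_trans (CLnorm_triangle mu r1 mC mD (cmeasurable_cst _)) _.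
have -> : e%:E = ((e / 3)%:E + ((e / 3)%:E + (e / 3)%:E))%E.
  by rewrite -!EFinD; congr EFin; lra.
apply: leeD.
  apply: le_trans (CLnorm_cube_avg (ltW c0) HN (leqnn N) n0) _.
  by rewrite lee_fin.
apply: le_trans (CLnorm_triangle mu r1 mD (cmeasurable_cst (tensor_mean (f N))) (cmeasurable_cst _)) _.
apply: leeD; first exact: HN'.
apply/Lnorm_leP => //; first exact: ltW.
rewrite ger0_norm ?cmod_ge0// integral_probability_cst lee_fin.
apply: ge0_ler_powR; rewrite ?nnegrE ?cmod_ge0 ?(ltW r0) ?(ltW e3)//.
by apply: le_trans c2; exact: tensor_mean_dist HN _ (leqnn N).
Qed.

(** The distance is split at [diag_avg T n (t m) x], [diag_avg T n (t J') x] and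
    [tensor_mean (t J')]. The index [J'] and the threshold for [n] are fixed first; [m] is chosen
    last and may depend on [n] and [x]. *)
Lemma cube_avg_cvg_ae :
  {ae mu, forall x, cmod (cube_avg n x - Lpi_mean) @[n --> \oo] --> (0 : R)}.
Proof.
have [s smono sQ] := @rapid_subsequence (fun j m n =>
  projective_norm (f m ++ tscale (-1) (f n)) <= 2^-1 ^+ j)
  (fun j => Lpi_small (exprn_gt0 j (ltac:(by rewrite invr_gt0) : 0 < (2^-1 : R)))).
pose t j := f (s j).
pose delta j := t j.+1 ++ tscale (-1) (t j).
have /choice[h hP] j := ae_diag_avg_bounded Tmp d2 dp (delta j).
have hle j : (Lnorm mu r%:E (fun x => (h j x)%:E) <= (K * 2^-1 ^+ j)%:E)%E.
  have [_ /le_trans + _] := hP j; apply; rewrite lee_fin ler_wpM2l ?(ltW K0)//.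
  by apply: sQ => //; exact: smono.
have mh j : measurable_fun setT (h j) by have [] := hP j.
have H1 := ae_summable r1 (ltW K0) mh hle.
have H2 := ae_foralln (fun j => let: And3 _ _ hx := hP j in hx).
(* The representatives of [D (V Tmp k f)] are tied to pointwise values here: the [L_r] distances
   decay geometrically for each [k], and there are only countably many pairs of [n] and [k]. *)
have H3 : {ae mu, forall x, forall n, forall k : {ffun 'I_d -> 'I_n},
    cmod (tensor_diag (tensor_V Tmp (fun i => k i) (t j)) x -
          D (V Tmp (fun i => k i) f) x) @[j --> \oo] --> (0 : R)}.
  apply: ae_foralln => n; apply: filter_forall => k.
  apply: (ae_cvg0 (F := fun j x => cmod (tensor_diag (tensor_V Tmp (fun i => k i) (t j)) x -
          D (V Tmp (fun i => k i) f) x)) r1 (ltW K0)) => j.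
    apply: measurable_cmod; apply: cmeasurableB (CLfun_D _).1.
    exact: cmeasurable_tensor_diag.
  exact: (CLnorm_DV (fun i => k i) (sQ j) (leqnn _)).
have H4 := ae_foralln (fun j => ae_diag_avg_cvg Tmp Terg d2 dp (t j)).
have H12 : {ae mu, forall x, (exists M, forall n, \sum_(0 <= j < n) `|h j x| <= M) /\
    (forall j n, cmod (diag_avg T n (delta j) x) <= h j x)}.
  by apply: filterS2 H1 H2 => x.
have H34 : {ae mu, forall x, (forall n, forall k : {ffun 'I_d -> 'I_n},
    cmod (tensor_diag (tensor_V Tmp (fun i => k i) (t j)) x -
          D (V Tmp (fun i => k i) f) x) @[j --> \oo] --> (0 : R)) /\
    (forall j, cmod (diag_avg T n (t j) x - tensor_mean (t j)) @[n --> \oo] --> (0 : R))}.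
  by apply: filterS2 H3 H4 => x.
apply: filterS2 H12 H34 => x [hM hd] [hD hc] {H1 H2 H3 H4}.
apply/cvgrPdist_le => e e0.
have e4 : 0 < e / 4 by rewrite divr_gt0.
have [J HJ] := bounded_series_tail (fun j => normr_ge0 (h j x)) hM e4.
have e8 : 0 < e / 8 by rewrite divr_gt0.
have /cvgrPdist_le /(_ _ e8)[J0 _ HJ0] := @cvg_half_expn R.
pose J' := maxn J J0.
(* The majorants [h j] dominate the averages of the increments for all [n] at once, so this bound
   does not depend on [n]. *)
have tail n m : (J' <= m)%N ->
    cmod (diag_avg T n (t m) x - diag_avg T n (t J') x) <= e / 4.
  move=> J'm; apply: (le_trans (@cmod_telescope _ (fun j => diag_avg T n (t j) x)
      (fun j => `|h j x|) J' m J'm _)).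
    move=> j; apply: le_trans (ler_norm _); apply: le_trans (hd j n).
    by rewrite /diag_avg tensor_eval_cat tensor_eval_scale mulN1r.
  have Jm : (J <= m)%N by rewrite (leq_trans _ J'm)// leq_maxl.
  apply: le_trans (ltW (HJ m Jm)).
  by rewrite (big_cat_nat (leq_maxl J J0) J'm)/= lerDr sumr_ge0.
have /cvgrPdist_le /(_ _ e4)[N _ HN] := hc J'.
exists (maxn 1 N) => // n /=; rewrite geq_max => /andP[n0 Nn].
rewrite sub0r normrN ger0_norm ?cmod_ge0//.
(* For this [n] only finitely many [k] occur, so one index [m] serves them all. *)
have [m J'm hm] : exists2 m, (J' <= m)%N &
    cmod (cube_avg n x - diag_avg T n (t m) x) <= e / 4.
  have : \forall j \near \oo, forall k : {ffun 'I_d -> 'I_n},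
      cmod (tensor_diag (tensor_V Tmp (fun i => k i) (t j)) x -
          D (V Tmp (fun i => k i) f) x) <= e / 4.
    apply: filter_forall => k; move/cvgrPdist_le : (hD n k) => /(_ _ e4).
    by apply: filterS => j; rewrite sub0r normrN ger0_norm ?cmod_ge0.
  move=> [m _ hm]; exists (maxn J' m); first exact: leq_maxl.
  apply: le_trans (cube_avg_dist _ _ _) _.
  rewrite ler_pdivrMl ?exprn_gt0 ?ltr0n//.
  apply: (@le_trans _ _ (\sum_(k : {ffun 'I_d -> 'I_n}) (e / 4))).
    by apply: ler_sum => k _; apply: hm => /=; exact: leq_maxr.
  by rewrite sumr_const card_ffun !card_ord -[leLHS]mulr_natl natrX.
have h1 := cmod_triangle (diag_avg T n (t m) x) (cube_avg n x) Lpi_mean.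
have h2 := cmod_triangle (diag_avg T n (t J') x) (diag_avg T n (t m) x) Lpi_mean.
have h3 := cmod_triangle (tensor_mean (t J')) (diag_avg T n (t J') x) Lpi_mean.
have h4 := tail n m J'm.
have h5 : cmod (diag_avg T n (t J') x - tensor_mean (t J')) <= e / 4.
  by have := HN n Nn; rewrite sub0r normrN ger0_norm ?cmod_ge0.
have h6 := tensor_mean_dist (sQ J') (leqnn (s J')).
have h7 : 2^-1 ^+ J' <= e / 8.
  have := HJ0 J' (leq_maxr _ _); rewrite sub0r normrN; apply: le_trans.
  exact: ler_norm.
rewrite -/(t J') in h6.
have : e / 4 + (e / 4 + (e / 4 + 2 * (e / 8))) = e by field.
move=> <-.
apply: (le_trans h1); apply: lerD => //.
apply: (le_trans h2); apply: lerD => //.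
apply: (le_trans h3); apply: lerD => //.
by apply: (le_trans h6); rewrite ler_wpM2l.
Qed.

End projective_elements.

Theorem theorem1 (R : realType) (dX : measure_display) (X : measurableType dX)
    (mu : probability X R) (hmu : Lebesgue_space mu)
    (d : nat) (hd : (2 <= d)%N) (p : R) (hp : d%:R <= p)
    (T : {mfun X >-> X}) (Tmp : measure_preserving mu T) (Terg : ergodic mu T)
    (f : Lpi mu p d) :
  let r := p / d%:R in
  let S (n : nat) (x : X) : R[i]^o :=
    (n%:R ^+ d)^-1 *
      \sum_(k : {ffun 'I_d -> 'I_n}) D (V Tmp (fun i => k i) f) x in
  let L : R[i]^o := Cintegral (prob_pow mu d) (J f) in
  {ae mu, forall x, S n x @[n --> \oo] --> L} /\
  CLnorm mu r (fun x => S n x - L) @[n --> \oo] --> 0%E.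
Proof.
move=> r S L; split; last exact: (cube_avg_cvg_Lnorm Tmp Terg hd hp f).
apply: filterS (cube_avg_cvg_ae Tmp Terg hd hp f) => x h.
exact/cvg_cmodP.
Qed.
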